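(* Let $\omega=e^{2\pi i/3}$ and let $\alpha\in\mathbf{Q}(\omega)$, $\alpha\notin\{1,\omega,\omega^2\}$. Let $$\lambda=\tfrac13(1+2\omega)(1-\alpha)$$ be the slope of $\mathcal{F}^4_\alpha$, and write $\lambda=p/q$ with $p$ and $q$ relatively prime elements of $\mathbf{Z}[\omega]$. Then, for the generic integral curve of $\mathcal{F}^4_\alpha$, its singularities are ordinary multiple points of multiplicity - $N(q)$, at each one of the points in $\mathcal{P}_\infty$, - $N(p)$, at each one of the points in $\mathcal{P}_1$, - $N(p+\omega^2q)$, at each one of the points in $\mathcal{P}_\omega$, and - $N(p-\omega q)$, at each one of the points in $\mathcal{P}_{\omega^2}$, where, for $m+n\omega\in\mathbf{Z}[\omega]$, $N(m+n\omega)=n^2-nm+m^2$ denotes its norm.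
   Context: For $\alpha\in\mathbf{C}$, $\mathcal{F}^4_\alpha$ is the foliation on the complex projective plane $\mathbf{P}^2$ given by the kernel of $(y^3-z^3)(yz-\alpha x^2)\,dx+(z^3-x^3)(xz-\alpha y^2)\,dy+(x^3-y^3)(xy-\alpha z^2)\,dz$. For $\alpha\in\mathbf{Q}(\omega)$ this foliation has a rational first integral, so all its leaves are contained in algebraic curves; ''generic integral curve'' means all but finitely many of the irreducible invariant algebraic curves. The twelve points of the dual Hesse configuration are grouped as follows: $\mathcal{P}_1=\{(1:1:1),(1:\omega:\omega^2),(1:\omega^2:\omega)\}$, $\mathcal{P}_\omega=\{(1:\omega:1),(1:1:\omega),(\omega:1:1)\}$, $\mathcal{P}_{\omega^2}=\{(1:1:\omega^2),(\omega^2:1:1),(1:\omega^2:1)\}$, $\mathcal{P}_\infty=\{(0:0:1),(0:1:0),(1:0:0)\}$. An ordinary multiple point of multiplicity $m$ is a point at which the curve has exactly $m$ smooth branches with pairwise distinct tangents; $m=1$ means that the curve passes through the point and is smooth there. *)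

(* Defs.v *)
From HB Require Import structures.
From mathcomp Require Import all_boot all_order all_algebra.
From mathcomp Require Import ring complex reals mpoly.
(* trigo is not imported: its notations are incompatible with those of mpoly *)
From mathcomp Require trigo.

Set Implicit Arguments.
Unset Strict Implicit.
Unset Printing Implicit Defensive.

Import GRing.Theory Num.Theory.

Local Open Scope ring_scope.
Local Open Scope complex_scope.

(* Eisenstein m n stands for m + n * omega. *)
Record eisenstein := Eisenstein { eis_re : int; eis_im : int }.

Definition eis_pair (z : eisenstein) := (eis_re z, eis_im z).
Definition pair_eis (z : int * int) := Eisenstein z.1 z.2.
Lemma eis_pairK : cancel eis_pair pair_eis. Proof. by case. Qed.

HB.instance Definition _ := Countable.copy eisenstein (can_type eis_pairK).

Lemma eisP (x y : eisenstein) :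
  eis_re x = eis_re y -> eis_im x = eis_im y -> x = y.
Proof. by case: x y => [a b] [c d] /= -> ->. Qed.

Definition eis_zero := Eisenstein 0 0.
Definition eis_one := Eisenstein 1 0.
Definition eis_omega := Eisenstein 0 1.
Definition eis_opp (x : eisenstein) := Eisenstein (- eis_re x) (- eis_im x).
Definition eis_add (x y : eisenstein) :=
  Eisenstein (eis_re x + eis_re y) (eis_im x + eis_im y).
(* from omega ^+ 2 = - 1 - omega *)
Definition eis_mul (x y : eisenstein) :=
  Eisenstein (eis_re x * eis_re y - eis_im x * eis_im y)
    (eis_re x * eis_im y + eis_im x * eis_re y - eis_im x * eis_im y).

Fact eis_addA : associative eis_add.
Proof. by move=> x y z; apply: eisP; rewrite /= addrA. Qed.
Fact eis_addC : commutative eis_add.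
Proof. by move=> x y; apply: eisP; rewrite /= addrC. Qed.
Fact eis_add0 : left_id eis_zero eis_add.
Proof. by move=> x; apply: eisP; rewrite /= add0r. Qed.
Fact eis_addN : left_inverse eis_zero eis_opp eis_add.
Proof. by move=> x; apply: eisP; rewrite /= addNr. Qed.

HB.instance Definition _ :=
  GRing.isZmodule.Build eisenstein eis_addA eis_addC eis_add0 eis_addN.

Fact eis_mulA : associative eis_mul.
Proof. by move=> x y z; apply: eisP => /=; ring. Qed.
Fact eis_mulC : commutative eis_mul.
Proof. by move=> x y; apply: eisP => /=; ring. Qed.
Fact eis_mul1 : left_id eis_one eis_mul.
Proof. by move=> x; apply: eisP => /=; ring. Qed.
Fact eis_mulDl : left_distributive eis_mul +%R.
Proof. by move=> x y z; apply: eisP => /=; ring. Qed.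
Fact eis_oner_neq0 : eis_one != 0.
Proof. by []. Qed.

HB.instance Definition _ :=
  GRing.Zmodule_isComNzRing.Build eisenstein
    eis_mulA eis_mulC eis_mul1 eis_mulDl eis_oner_neq0.

(* the integer inside the absolute value is nonnegative *)
Definition eis_norm (z : eisenstein) : nat :=
  `|(eis_im z ^+ 2 - eis_im z * eis_re z + eis_re z ^+ 2)%R|%N.

Definition eis_dvd (d z : eisenstein) : Prop := exists e, z = e * d.

Definition eis_coprime (p q : eisenstein) : Prop :=
  forall d, eis_dvd d p -> eis_dvd d q -> eis_dvd d 1.

Definition omega (R : realType) : R[i] :=
  trigo.cos (2 * trigo.pi / 3) +i* trigo.sin (2 * trigo.pi / 3).

Definition eis_val (R : realType) (z : eisenstein) : R[i] :=
  (eis_re z)%:~R + (eis_im z)%:~R * omega R.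

Definition slope (R : realType) (alpha : R[i]) : R[i] :=
  3^-1 * (1 + 2 * omega R) * (1 - alpha).

(* A point of the projective plane is given by a nonzero row vector of
   homogeneous coordinates, a curve by a homogeneous polynomial. *)

Definition row3 (K : fieldType) (a b c : K) : 'rV[K]_3 :=
  \row_(i < 3) [:: a; b; c]`_i.

Definition same_point (K : fieldType) (P Q : 'rV[K]_3) : Prop :=
  exists2 c, c != 0 & P = c *: Q.

Definition irreducible_mpoly (K : fieldType) (n : nat) (F : {mpoly K[n]}) :
    Prop :=
  [/\ F != 0, F \isn't a GRing.unit
    & forall G H, F = G * H -> G \is a GRing.unit \/ H \is a GRing.unit].

Definition irreducible_curve (K : fieldType) (F : {mpoly K[3]}) : Prop :=
  (exists d, F \is d.-homog) /\ irreducible_mpoly F.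

Definition singular_point (K : fieldType) (F : {mpoly K[3]}) (P : 'rV[K]_3) :
    Prop :=
  [/\ P != 0, F.@[P 0] = 0 & forall i, (F^`M(i)).@[P 0] = 0].

(* f i j is the coefficient of u ^ i v ^ j of the formal power series f(u, v). *)
Definition fps2 (K : fieldType) := nat -> nat -> K.

Definition fps2_mul (K : fieldType) (f g : fps2 K) : fps2 K :=
  fun i j => \sum_(k < i.+1) \sum_(l < j.+1) f k l * g (i - k)%N (j - l)%N.

Definition fps2_of_mpoly (K : fieldType) (f : {mpoly K[2]}) : fps2 K :=
  fun i j => f@_[multinom [tuple i; j]].

Definition smooth_branch (K : fieldType) (f : fps2 K) : Prop :=
  f 0%N 0%N = 0 /\ (f 1%N 0%N, f 0%N 1%N) != (0, 0).

Definition distinct_tangents (K : fieldType) (f g : fps2 K) : Prop :=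
  f 1%N 0%N * g 0%N 1%N != f 0%N 1%N * g 1%N 0%N.

(* The branches of the germ f = 0 at the origin are the irreducible factors
   of f as a formal power series; u is the remaining unit. *)
Definition has_ordinary_branches (K : fieldType) (f : fps2 K) (m : nat) :
    Prop :=
  exists (u : fps2 K) (b : 'I_m -> fps2 K),
    [/\ u 0%N 0%N != 0,
        f =2 foldr (@fps2_mul K) u [seq b i | i <- enum 'I_m],
        forall i, smooth_branch (b i)
      & forall i j, i != j -> distinct_tangents (b i) (b j)].

(* The equation of F = 0 in the affine chart where the k-th coordinate is 1,
   with the origin translated to P *)
Definition local_equation (K : fieldType) (F : {mpoly K[3]}) (P : 'rV[K]_3)
    (k : 'I_3) : {mpoly K[2]} :=
  F \mPo [tuple oapp (fun j : 'I_2 => 'X_j + (P 0 i / P 0 k)%:MP) 1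
            (unlift k i) | i < 3].

Definition ordinary_point (K : fieldType) (F : {mpoly K[3]}) (P : 'rV[K]_3)
    (m : nat) : Prop :=
  forall k, P 0 k != 0 ->
    has_ordinary_branches (fps2_of_mpoly (local_equation F P k)) m.

(* The foliation is the kernel of eta 0 dx + eta 1 dy + eta 2 dz; the curve
   F = 0 is invariant when F divides the coefficients of dF /\ eta. *)
Definition invariant_curve (K : fieldType) (eta : 'I_3 -> {mpoly K[3]})
    (F : {mpoly K[3]}) : Prop :=
  forall i j, exists G, F^`M(i) * eta j - F^`M(j) * eta i = G * F.

Definition F4 (K : fieldType) (alpha : K) : 'I_3 -> {mpoly K[3]} :=
  let x := 'X_(0%R : 'I_3) in
  let y := 'X_(1%R : 'I_3) in
  let z := 'X_(2%R : 'I_3) in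
  tnth [tuple (y ^+ 3 - z ^+ 3) * (y * z - alpha *: x ^+ 2);
              (z ^+ 3 - x ^+ 3) * (x * z - alpha *: y ^+ 2);
              (x ^+ 3 - y ^+ 3) * (x * y - alpha *: z ^+ 2)].

Definition points_1 (R : realType) : seq 'rV[R[i]]_3 :=
  let w := omega R in
  [:: row3 1 1 1; row3 1 w (w ^+ 2); row3 1 (w ^+ 2) w].
Definition points_omega (R : realType) : seq 'rV[R[i]]_3 :=
  let w := omega R in
  [:: row3 1 w 1; row3 1 1 w; row3 w 1 1].
Definition points_omega2 (R : realType) : seq 'rV[R[i]]_3 :=
  let w := omega R in
  [:: row3 1 1 (w ^+ 2); row3 (w ^+ 2) 1 1; row3 1 (w ^+ 2) 1].
Definition points_infty (R : realType) : seq 'rV[R[i]]_3 :=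
  [:: row3 0 0 1; row3 0 1 0; row3 1 0 0].
Definition points_dual_Hesse (R : realType) : seq 'rV[R[i]]_3 :=
  points_1 R ++ points_omega R ++ points_omega2 R ++ points_infty R.

(* A curve is a polynomial up to scalars, so finitely many curves are excepted
   by excepting the multiples of the members of a finite list. *)
Definition for_generic_curve (K : fieldType) (eta : 'I_3 -> {mpoly K[3]})
    (C : {mpoly K[3]} -> Prop) : Prop :=
  exists s : seq {mpoly K[3]}, forall F,
    irreducible_curve F -> invariant_curve eta F ->
    (forall (G : {mpoly K[3]}) (c : K), G \in s -> F <> c *: G) -> C F.

(* Main.v *)
(* With (s : t) = (q + theta p : q), theta = 1 + 2 omega, alpha = s / t. The claim
   for a coprime pair (p, q) is moved to other pairs by symmetries. The matrix
   diag(1, 1, omega) and the Fourier matrix permute the four groups of points and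
   map (p, q) to (p + omega^2 q, omega q) and to (-q, p). The quadratic involution
   (yz : xz : xy) maps it to (-p, q + theta p); it turns the multiplicity a at the
   vertices of the triangle xyz = 0 into b + c + e - a, where b, c, e are the
   multiplicities at the other groups. The transversality of the foliation to the
   sides of the triangle controls the new tangent cones.

   The four norms satisfy (a + b + c + e)^2 = 3 (a^2 + b^2 + c^2 + e^2). Hence either
   one of them is larger than a third of the sum, and moving it to the vertices and
   applying the involution decreases the sum, or one of them vanishes, and one is
   reduced to q = 0. There the curves are those of the pencil
   a x^3 + b y^3 + c z^3 = 0, a + b + c = 0: the product M of the conjugates of F under
   the cubic roots of unity acting on the coordinates is N(x^3, y^3, z^3) with N
   invariant by translations along (1, 1, 1), so that M is a product of members of
   the pencil, which are prime or split into three lines.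

   Finally a point at which the leading form is squarefree is ordinary, by a
   Hensel factorization of the local equation, one branch at a time. *)
Require Import Defs.
From HB Require Import structures.
From mathcomp Require Import all_boot all_order all_algebra.
From mathcomp Require Import ring lra zify complex reals mpoly.
From mathcomp Require boolp trigo.

Set Implicit Arguments.
Unset Strict Implicit.
Unset Printing Implicit Defensive.

Import GRing.Theory Num.Theory.

Local Open Scope ring_scope.
Local Open Scope complex_scope.

(** * Substitutions *)

(** No branch is constructed before the end: [Ord] only asks the leading form of a Taylor expansion
    to have simple zeros, and therefore passes through substitutions by the chain rule. The relation
    (s : t) = (q + theta p : q) is the slope formula solved for alpha by means of theta^2 = -3; the
    parameters are kept homogeneous because the descent ends at t = 0. The obstacle is that the
    involution is no local isomorphism on the triangle: it contracts the sides to the vertices. The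
    tangents of the new curve at a vertex are the points of the old one on a side, and conversely.
    Hence the induction carries the degree and the smoothness outside the twelve points. The
    delicate case is a branch tangent to a side at a vertex, where transversality says nothing and
    the next order of the invariance equation is needed. The quadric satisfied by the norms is
    Bezout's formula for two curves of degree a + b + c + e meeting only at the twelve points with
    these multiplicities. At t = 0 the form, written in the cubes of the coordinates, is that of the
    lines through (1 : 1 : 1), whence the translations along this vector. *)

Lemma mpoly_ring_ind n (R : comNzRingType) (P : {mpoly R[n]} -> Prop) :
    (forall c, P c%:MP) -> (forall i, P 'X_i) ->
    (forall p q, P p -> P q -> P (p + q)) ->
    (forall p q, P p -> P q -> P (p * q)) ->
  forall p, P p.
Proof.
move=> PC PX PD PM; apply: mpolyind => [|c m p _ _ Pp]; first exact: (PC 0).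
apply: PD Pp; rewrite -mul_mpolyC mpolyXE_id; apply: (PM) => //.
apply: big_ind => [||i _]; [exact: (PC 1)|exact: PM|].
elim: (m i) => [|k IHk]; first exact: (PC 1).
by rewrite exprS; apply: (PM).
Qed.

Lemma mmap_eq n (R S : nzRingType) (f g : R -> S) (u v : 'I_n -> S) p :
  f =1 g -> u =1 v -> mmap f u p = mmap g v p.
Proof.
move=> fg uv; apply: eq_bigr => m _; rewrite fg; congr (_ * _).
by apply: eq_bigr => i _; rewrite uv.
Qed.

Lemma rmorph_mmap n (R S T : comNzRingType) (f : {rmorphism R -> S})
    (g : {rmorphism S -> T}) (v : 'I_n -> S) p :
  g (mmap f v p) = mmap (g \o f) (g \o v) p.
Proof.
rewrite rmorph_sum; apply: eq_bigr => m _; rewrite rmorphM rmorph_prod /=.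
by congr (_ * _); apply: eq_bigr => i _; rewrite rmorphXn.
Qed.

Lemma mmap_X n (R : comNzRingType) (p : {mpoly R[n]}) :
  mmap (@mpolyC n R) (fun i => 'X_i) p = p.
Proof.
rewrite -[RHS]comp_mpoly_id; apply: mmap_eq => // i.
by rewrite tnth_mktuple.
Qed.

Lemma mmap_homogM n (R S : comNzRingType) (f : {rmorphism R -> S})
    (v : 'I_n -> S) c d p :
  p \is d.-homog -> mmap f (fun i => c * v i) p = c ^+ d * mmap f v p.
Proof.
move=> /dhomogP hp; rewrite mulr_sumr; rewrite /mmap !big_seq.
apply: eq_bigr => m /hp; rewrite /= mdegE => <-; rewrite mulrCA; congr (_ * _).
rewrite /mmap1 -prodrXr -big_split /=.
by apply: eq_bigr => i _; rewrite exprMn.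
Qed.

Definition vec3 (T : Type) (a b c : T) : 'I_3 -> T :=
  fun i => nth a [:: a; b; c] i.

(* Explicit indices: 2 : 'I_3 in ring notation does not reduce cheaply. *)
Notation i0 := (@Ordinal 3 0 isT).
Notation i1 := (@Ordinal 3 1 isT).
Notation i2 := (@Ordinal 3 2 isT).

Lemma ord3P (i : 'I_3) : [\/ i = i0, i = i1 | i = i2].
Proof.
case: i => [[|[|[|//]]]] h; [apply: Or31|apply: Or32|apply: Or33]; exact: val_inj.
Qed.

Lemma vec3E (T : Type) (a b c : T) :
  (vec3 a b c i0 = a) * (vec3 a b c i1 = b) * (vec3 a b c i2 = c).
Proof. by []. Qed.

Lemma sum3 (V : nmodType) (F : 'I_3 -> V) :
  \sum_i F i = F i0 + F i1 + F i2.
Proof.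
rewrite !big_ord_recl big_ord0 addr0 addrA.
by congr (F _ + F _ + F _); apply: val_inj.
Qed.

Section Pull.
Variable K : comNzRingType.
Implicit Types F G : {mpoly K[3]}.

(* Locked, as comparing unfolded compositions is expensive. *)
Fact pull_key : unit. Proof. by []. Qed.
Definition pull (phi : 'I_3 -> {mpoly K[3]}) : {mpoly K[3]} -> {mpoly K[3]} :=
  locked_with pull_key (mmap (@mpolyC 3 K) phi).

Lemma pullE phi F : pull phi F = mmap (@mpolyC 3 K) phi F.
Proof. by rewrite /pull unlock. Qed.

Fact pull_is_zmod_morphism phi : zmod_morphism (pull phi).
Proof. by move=> p q; rewrite !pullE rmorphB. Qed.

Fact pull_is_monoid_morphism phi : monoid_morphism (pull phi).
Proof. by split=> [|p q]; rewrite !pullE ?rmorph1 ?rmorphM. Qed.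

HB.instance Definition _ phi := GRing.isZmodMorphism.Build
  {mpoly K[3]} {mpoly K[3]} (pull phi) (pull_is_zmod_morphism phi).
HB.instance Definition _ phi := GRing.isMonoidMorphism.Build
  {mpoly K[3]} {mpoly K[3]} (pull phi) (pull_is_monoid_morphism phi).

Lemma pullC phi c : pull phi c%:MP = c%:MP.
Proof. by rewrite pullE mmapC. Qed.

Lemma pullX phi i : pull phi 'X_i = phi i.
Proof. by rewrite pullE mmapX mmap1U. Qed.

Lemma pullD phi F G : pull phi (F + G) = pull phi F + pull phi G.
Proof. exact: rmorphD. Qed.

Lemma pullB phi F G : pull phi (F - G) = pull phi F - pull phi G.
Proof. exact: rmorphB. Qed.

Lemma pullM phi F G : pull phi (F * G) = pull phi F * pull phi G.
Proof. exact: rmorphM. Qed.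

Lemma pullXn phi F k : pull phi (F ^+ k) = pull phi F ^+ k.
Proof. exact: rmorphXn. Qed.

Lemma pullZ phi c F : pull phi (c *: F) = c *: pull phi F.
Proof. by rewrite !pullE mmapZ mul_mpolyC. Qed.

Lemma mmap_pull (S : comNzRingType) (f : {rmorphism K -> S}) v phi F :
  mmap f v (pull phi F) = mmap f (fun i => mmap f v (phi i)) F.
Proof.
by rewrite pullE rmorph_mmap; apply: mmap_eq => // c /=; rewrite mmapC.
Qed.

Lemma meval_pull v phi F : (pull phi F).@[v] = F.@[fun i => (phi i).@[v]].
Proof. exact: (mmap_pull (idfun : {rmorphism K -> K})). Qed.

Lemma pull_comp phi psi F :
  pull psi (pull phi F) = pull (fun i => pull psi (phi i)) F.
Proof.
rewrite pullE [RHS]pullE (mmap_pull (@mpolyC 3 K)).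
by apply: mmap_eq => // i; rewrite pullE.
Qed.

Lemma pull_id F : pull (fun i => 'X_i) F = F.
Proof. by rewrite pullE mmap_X. Qed.

Lemma eq_pull phi psi F : phi =1 psi -> pull phi F = pull psi F.
Proof. by move=> e; rewrite !pullE; apply: mmap_eq. Qed.

Lemma mderiv_pull phi F k :
  (pull phi F)^`M(k) = \sum_i pull phi (F^`M(i)) * (phi i)^`M(k).
Proof.
elim/mpoly_ring_ind: F => [c|i|p q IHp IHq|p q IHp IHq].
- rewrite pullC mderivC big1 // => i _.
  by rewrite mderivC rmorph0 mul0r.
- rewrite pullX (bigD1 i) //= [X in _ + X]big1 => [|j ji].
    have -> : 'X_i^`M(i) = 1 :> {mpoly K[3]}.
      rewrite mderivX mnmE eqxx scale1r -mpolyX0; congr 'X_[_].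
      by apply/mnmP => j; rewrite mnmBE subnn mnm0E.
    by rewrite rmorph1 mul1r addr0.
  by rewrite mderivX mnmE eq_sym (negPf ji) scale0r rmorph0 mul0r.
- rewrite rmorphD /= !mderivD IHp IHq -big_split /=; apply: eq_bigr => i _.
  by rewrite mderivD rmorphD mulrDl.
- rewrite rmorphM /= !mderivM IHp IHq mulr_suml mulr_sumr -big_split /=.
  apply: eq_bigr => i _.
  rewrite mderivM rmorphD !rmorphM /=; ring.
Qed.

End Pull.

(** * Divisibility *)

Definition mdvd (R : comNzRingType) (G F : R) := exists H, F = H * G.

Lemma mdvd_mull (R : comNzRingType) (D A B : R) : mdvd D B -> mdvd D (A * B).
Proof. by case=> H ->; exists (A * H); rewrite mulrA. Qed.

Lemma mdvd_mulr (R : comNzRingType) (D A B : R) : mdvd D A -> mdvd D (A * B).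
Proof. by rewrite mulrC; apply: mdvd_mull. Qed.

Lemma mdvd_add (R : comNzRingType) (D A B : R) :
  mdvd D A -> mdvd D B -> mdvd D (A + B).
Proof. by case=> H -> [H' ->]; exists (H + H'); rewrite mulrDl. Qed.

Lemma mdvd_opp (R : comNzRingType) (D A : R) : mdvd D A -> mdvd D (- A).
Proof. by case=> H ->; exists (- H); rewrite mulNr. Qed.

Lemma mdvd_refl (R : comNzRingType) (D : R) : mdvd D D.
Proof. by exists 1; rewrite mul1r. Qed.

Lemma mdvd0 (R : comNzRingType) (D : R) : mdvd D 0.
Proof. by exists 0; rewrite mul0r. Qed.

Definition prime_elt (R : comNzRingType) (D : R) :=
  forall A B, mdvd D (A * B) -> mdvd D A \/ mdvd D B.

Section Divisibility.
Variable K : fieldType.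
Implicit Types F G D : {mpoly K[3]}.

Lemma mdvd_pull (phi psi : 'I_3 -> {mpoly K[3]}) D F :
  (forall i, mdvd D (phi i - psi i)) -> mdvd D (pull phi F - pull psi F).
Proof.
move=> h; elim/mpoly_ring_ind: F => [c|i|p q IHp IHq|p q IHp IHq].
- by rewrite !pullC subrr; apply: mdvd0.
- by rewrite !pullX.
- by rewrite !pullD opprD addrACA; apply: mdvd_add.
- have -> : pull phi (p * q) - pull psi (p * q) =
      (pull phi p - pull psi p) * pull phi q
        + pull psi p * (pull phi q - pull psi q) by rewrite !pullM; ring.
  by apply: mdvd_add; [apply: mdvd_mulr|apply: mdvd_mull].
Qed.

(** Here [pull psi] is a retraction of the polynomial ring whose kernel is the ideal of [D].
    Primality of [D] then comes from the target being a domain; this serves for coordinates and for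
    lines. *)
Lemma mdvd_retract (psi : 'I_3 -> {mpoly K[3]}) D F :
    (forall i, mdvd D ('X_i - psi i)) -> pull psi D = 0 ->
  mdvd D F <-> pull psi F = 0.
Proof.
move=> h D0; split=> [[H ->]|F0]; first by rewrite rmorphM /= D0 mulr0.
by rewrite -[F]subr0 -{1}[F]pull_id -F0; apply: mdvd_pull.
Qed.

Lemma prime_retract (psi : 'I_3 -> {mpoly K[3]}) D :
    (forall i, mdvd D ('X_i - psi i)) -> pull psi D = 0 -> prime_elt D.
Proof.
move=> h D0 A B /(mdvd_retract _ h D0)/eqP; rewrite rmorphM /= mulf_eq0.
by case/orP => /eqP/(mdvd_retract _ h D0); [left|right].
Qed.

Definition kill (i : 'I_3) : 'I_3 -> {mpoly K[3]} :=
  fun j => if j == i then 0 else 'X_j.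

Lemma kill_sub i j : mdvd 'X_i ('X_j - kill i j).
Proof.
rewrite /kill; case: eqP => [->|_]; rewrite ?subr0 ?subrr.
  exact: mdvd_refl.
exact: mdvd0.
Qed.

Lemma kill_X i : pull (kill i) 'X_i = 0.
Proof. by rewrite pullX /kill eqxx. Qed.

Lemma mdvdX i F : mdvd 'X_i F <-> pull (kill i) F = 0.
Proof. exact: mdvd_retract (kill_sub i) (kill_X i). Qed.

Lemma primeX i : prime_elt ('X_i : {mpoly K[3]}).
Proof. exact: prime_retract (kill_sub i) (kill_X i). Qed.

(** By [mdvdX], no coordinate divides [F]. This normalizes strict transforms under the involution,
    which are otherwise defined up to a monomial. *)
Definition undiv F := forall i, pull (kill i) F != 0.

Lemma mpolyX_neq0 m : 'X_[m] != 0 :> {mpoly K[3]}.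
Proof. by apply/eqP => /(congr1 (mcoeff m))/eqP; rewrite mcoeffX mcoeff0 eqxx oner_eq0. Qed.

Lemma mnm_split (m : 'X_{1..3}) i : m i != 0%N ->
  exists2 m', m = (U_(i) + m')%MM & (mdeg m).-1 = mdeg m'.
Proof.
rewrite -lep1mP => h; exists (m - U_(i))%MM.
  by rewrite addmC submK.
by rewrite -{1}(submK h) mdegD mdeg1 addn1.
Qed.

(** Each variable is prime and does not divide [A], so the monomial is removed from [B] one variable
    at a time. *)
Lemma mono_cancel A B C m : undiv A -> A * B = 'X_[m] * C ->
  exists2 B', B = 'X_[m] * B' & A * B' = C.
Proof.
move=> uA; have [n] := ubnP (mdeg m); elim: n m B C => // n IHn m B C.
have [/eqP|] := altP (m =P 0%MM).
  by move=> /eqP-> _; rewrite mpolyX0 mul1r => <-; exists B; rewrite ?mul1r.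
move=> m0 hm; have [i mi] : exists i, m i != 0%N.
  apply/existsP; apply: contra_neqT m0; rewrite negb_exists => /forallP h.
  by apply/mnmP => i; rewrite mnm0E; apply/eqP; rewrite -[_ == _]negbK.
have [m' def_m dm'] := mnm_split mi.
rewrite def_m mpolyXD -mulrA => e.
have := @primeX i A B; rewrite e.
case=> [|/mdvdX/eqP|[B1 def_B]]; first by apply: mdvd_mulr; apply: mdvd_refl.
  by rewrite (negPf (uA i)).
have [||B' eB1 eB'] := IHn m' B1 C.
- rewrite -dm' ; case: (mdeg m) (mdeg_eq0 m) hm => [|k]; first by rewrite (negPf m0).
  by rewrite ltnS.
- apply: (mulfI (mpolyX_neq0 U_(i))); rewrite -e def_B; ring.
by exists B'; rewrite // def_B eB1; ring.
Qed.

Lemma strip F : F != 0 -> exists m G, F = 'X_[m] * G /\ undiv G.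
Proof.
have [n] := ubnP (msize F); elim: n F => // n IHn F hF F0.
have [/forallP uF|/forallPn[j]] := boolP [forall j, pull (kill j) F != 0].
  by exists 0%MM, F; rewrite mpolyX0 mul1r.
rewrite negbK => /eqP/mdvdX[F1 def_F].
have F10 : F1 != 0 by apply: contraNneq F0 => e; rewrite def_F e mul0r.
have hF1 : (msize F1 < n)%N.
  move: hF; rewrite def_F msizeM ?mpolyX_neq0 // msizeX mdeg1 addn2 /=.
  by rewrite ltnS.
have [m [G [eF1 uG]]] := IHn F1 hF1 F10.
by exists (U_(j) + m)%MM, G; split=> //; rewrite mpolyXD def_F eF1; ring.
Qed.

Lemma unit_mpolyP n (F : {mpoly K[n]}) :
  reflect (exists2 c, c != 0 & F = c%:MP) (F \is a GRing.unit).
Proof.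
apply: (iffP andP) => /= [[/eqP e]|[c c0 ->]].
  by rewrite unitfE => h; exists F@_0.
by rewrite mcoeffC eqxx mulr1 unitfE c0.
Qed.

Lemma mono_assoc m m' A B : undiv A -> undiv B ->
  'X_[m] * A = 'X_[m'] * B -> m = m' /\ A = B.
Proof.
move=> uA uB e; have [C eC CA] := mono_cancel uA (etrans (mulrC _ _) e).
have [D eD DB] := mono_cancel uB (etrans (mulrC _ _) (esym e)).
have DC : D * C = 1.
  apply: (mulfI (mpolyX_neq0 m)); rewrite mulrA -eD -eC mulr1 //.
have /unit_mpolyP[c c0 Cc] : C \is a GRing.unit by apply/unitrPr; exists D; rewrite mulrC.
have hm : m = m'.
  have [//|/negPf ne] := eqVneq m m'.
  move/(congr1 (mcoeff m))/eqP: eC; rewrite Cc mulrC mul_mpolyC mcoeffZ !mcoeffX.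
  by rewrite eqxx (eq_sym m') ne mulr0 oner_eq0.
split=> //; move: e; rewrite hm => /mulfI; apply; exact: mpolyX_neq0.
Qed.

Lemma undiv_mono A m c : undiv A -> mdvd A ('X_[m] * c%:MP) -> c != 0 ->
  A \is a GRing.unit.
Proof.
move=> uA [H e] c0; have [B _ eB] := mono_cancel uA (etrans (mulrC _ _) (esym e)).
apply/unitrPr; exists (B * (c^-1)%:MP).
by rewrite mulrA eB -mpolyCM divff // mpolyC1.
Qed.

Lemma undivM A B : undiv A -> undiv B -> undiv (A * B).
Proof. by move=> uA uB i; rewrite rmorphM mulf_neq0 ?uA ?uB. Qed.

Lemma undivMl A B : undiv (A * B) -> undiv A.
Proof. by move=> u i; have := u i; rewrite rmorphM /= mulf_eq0 negb_or => /andP[]. Qed.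

Lemma undiv_neq0 A : undiv A -> A != 0.
Proof. by move=> u; apply: contraNneq (u i0) => ->; rewrite rmorph0. Qed.

End Divisibility.

(** * Invariant curves *)

(** Once the powers of ['X] are taken out, both factors have a nonzero constant term; comparing
    lowest terms shows that their product is constant, hence so are they. *)
Lemma poly_mul_monomial (S : idomainType) (p q : {poly S}) d c :
  p * q = c *: 'X^d -> c != 0 -> exists e, p = p`_e *: 'X^e.
Proof.
move=> e c0; have pq0 : p * q != 0 by rewrite e scale_poly_eq0 negb_or c0 monic_neq0 ?monicXn.
have [p0 q0] : p != 0 /\ q != 0 by apply/andP; rewrite -negb_or -mulf_eq0.
have split_X (r : {poly S}) : r != 0 -> exists k r', r = r' * 'X^k /\ r'`_0 != 0.
  move=> r0; have [k [r' h ->]] := multiplicity_XsubC r 0.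
  exists k, r'; rewrite polyC0 subr0; split=> //.
  by move: h; rewrite r0 /= /root horner_coef0.
have [i [p' [def_p p'0]]] := split_X p p0.
have [j [q' [def_q q'0]]] := split_X q q0.
have pq' : p' * q' * 'X^(i + j) = c *: 'X^d by rewrite -e def_p def_q exprD; ring.
have ij : (i + j = d)%N.
  have /(congr1 (fun r : {poly S} => r`_(i + j))) := pq'.
  rewrite coefMXn ltnn subnn coefZ coefXn coefM big_ord1 subn0.
  by case: eqP => // _ /eqP; rewrite mulr0 mulf_eq0 (negPf p'0) (negPf q'0).
have /eqP : p' * q' = c%:P.
  apply: (mulIf (x := 'X^d)); first by rewrite monic_neq0 ?monicXn.
  by rewrite mul_polyC -pq' ij.
have p'n : p' != 0 by apply: contraNneq p'0 => ->; rewrite coef0.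
have q'n : q' != 0 by apply: contraNneq q'0 => ->; rewrite coef0.
move/eqP/(congr1 (fun r : {poly S} => size r)); rewrite size_mul // size_polyC c0.
move=> hs; have /size_poly1P[a a0 def_a] : size p' == 1%N.
  move: hs p'n q'n; rewrite -!size_poly_gt0.
  by case: (size p') (size q') => [|[|k]] [|l] //=; rewrite addnS.
exists i; rewrite def_p def_a mul_polyC coefZ coefXn eqxx mulr1 //.
Qed.

Section Homogeneous.
Variable K : fieldType.
Implicit Types F G H : {mpoly K[3]}.

(* The homogeneous component of degree e of F is the coefficient of 'X^e. *)
Definition grade F : {poly {mpoly K[3]}} :=
  mmap (polyC \o @mpolyC 3 K) (fun i => 'X * ('X_i)%:P) F.

Lemma mmap_polyC F :
  mmap (polyC \o @mpolyC 3 K) (fun i => ('X_i)%:P) F = F%:P.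
Proof. by rewrite -[in RHS](mmap_X F) rmorph_mmap. Qed.

Lemma grade_homog d F : F \is d.-homog -> grade F = F *: 'X^d.
Proof. by move=> hF; rewrite /grade (mmap_homogM _ _ _ hF) mmap_polyC mulrC mul_polyC. Qed.

Lemma coef_grade F k m : ((grade F)`_k)@_m = F@_m *+ (mdeg m == k).
Proof.
have gX m' : mmap1 (fun i : 'I_3 => 'X * ('X_i)%:P) m' = ('X_[m'] : {mpoly K[3]}) *: 'X^(mdeg m').
  rewrite mdegE -prodrXr -mul_polyC mpolyXE_id rmorph_prod -big_split /=.
  by apply: eq_bigr => i _; rewrite exprMn rmorphXn mulrC.
rewrite /grade /mmap coef_sum raddf_sum /=.
rewrite (eq_bigr (fun m' => (F@_m' *+ (mdeg m == k)) * (m' == m)%:R)) => [|m' _]; last first.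
  rewrite gX mul_polyC scalerA coefZ coefXn mulr_natr mcoeffMn mul_mpolyC.
  rewrite mcoeffZ mcoeffX.
  by have [->|_] := eqVneq m' m; rewrite ?mulr0 ?mul0rn // !mulr1 eq_sym.
have [mF|mF] := boolP (m \in msupp F); last first.
  rewrite (memN_msupp_eq0 mF) mul0rn big1_seq // => m' /= hm'.
  have [e|] := eqVneq m' m; last by rewrite mulr0.
  by rewrite -e hm' in mF.
rewrite (bigD1_seq m) ?msupp_uniq //= eqxx mulr1 big1 ?addr0 //.
by move=> m' /negPf->; rewrite mulr0.
Qed.

Lemma homog_grade F e : grade F = (grade F)`_e *: 'X^e -> F \is e.-homog.
Proof.
move=> h; apply/dhomogP => m; rewrite mcoeff_msupp => Fm; apply/eqP.
have := coef_grade F (mdeg m) m; rewrite eqxx mulr1n h coefZ coefXn.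
have [//|_] := eqVneq; rewrite mulr0 mcoeff0 => e0.
by rewrite -e0 eqxx in Fm.
Qed.

(** [grade] is multiplicative and turns homogeneous polynomials into monomials in ['X], whose
    factors are monomials. *)
Lemma homog_factor F G H d : F != 0 -> F \is d.-homog -> F = G * H ->
  exists e, G \is e.-homog.
Proof.
move=> F0 hF e; have := grade_homog hF.
rewrite {1}e /grade rmorphM => /poly_mul_monomial/(_ F0)[k].
by move/homog_grade; exists k.
Qed.

End Homogeneous.

(** The coefficients of the 2-form dF /\ eta. *)
Definition dvec (K : comNzRingType) (eta : 'I_3 -> {mpoly K[3]}) (F : {mpoly K[3]}) i j :=
  F^`M(i) * eta j - F^`M(j) * eta i.

Section Pullback.
Variable K : fieldType.
Implicit Types F G H : {mpoly K[3]}.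

Lemma invariantP eta F :
  invariant_curve eta F <-> forall i j, mdvd F (dvec eta F i j).
Proof. by []. Qed.

Lemma dvecM eta F G i j :
  dvec eta (F * G) i j = F * dvec eta G i j + G * dvec eta F i j.
Proof. rewrite /dvec !mderivM; ring. Qed.

(** Pullback commutes with d and with the exterior product. The factor [mu] cannot be removed in
    general, as it may share factors with [pull phi F]. *)
Lemma invariant_pull eta eta' mu phi F :
    (forall k, \sum_i pull phi (eta i) * (phi i)^`M(k) = mu * eta' k) ->
    invariant_curve eta F ->
  forall k l, mdvd (pull phi F) (mu * dvec eta' (pull phi F) k l).
Proof.
move=> h /invariantP inv k l.
have dv i j (c : {mpoly K[3]}) : mdvd (pull phi F) (pull phi (dvec eta F i j) * c).
  by apply: mdvd_mulr; have [G ->] := inv i j; rewrite rmorphM; exists (pull phi G).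
rewrite (_ : mu * _ = (pull phi F)^`M(k) * (mu * eta' l) - (pull phi F)^`M(l) * (mu * eta' k)).
  rewrite -!h !mderiv_pull !sum3.
  (* The coefficients of a 2-form are pulled back through the 2x2 minors of the Jacobian of
     [phi]. *)
  rewrite (_ : _ - _ =
    pull phi (dvec eta F i0 i1) * ((phi i0)^`M(k) * (phi i1)^`M(l) - (phi i0)^`M(l) * (phi
      i1)^`M(k))
    + pull phi (dvec eta F i0 i2) * ((phi i0)^`M(k) * (phi i2)^`M(l) - (phi i0)^`M(l) * (phi
      i2)^`M(k))
    + pull phi (dvec eta F i1 i2) * ((phi i1)^`M(k) * (phi i2)^`M(l) - (phi i1)^`M(l) * (phi
      i2)^`M(k))).
    by do 2 apply: mdvd_add => //.
  rewrite /dvec !pullB !pullM; ring.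
rewrite /dvec; ring.
Qed.

(* t times the form of F^4_alpha for alpha = s / t; t = 0 is needed in the descent. *)
Definition form4 (s t : K) : 'I_3 -> {mpoly K[3]} :=
  let x := 'X_i0 in let y := 'X_i1 in let z := 'X_i2 in
  vec3 ((y ^+ 3 - z ^+ 3) * (t%:MP * (y * z) - s%:MP * x ^+ 2))
       ((z ^+ 3 - x ^+ 3) * (t%:MP * (x * z) - s%:MP * y ^+ 2))
       ((x ^+ 3 - y ^+ 3) * (t%:MP * (x * y) - s%:MP * z ^+ 2)).

Definition sigma : 'I_3 -> {mpoly K[3]} :=
  let x := 'X_i0 in let y := 'X_i1 in let z := 'X_i2 in
  vec3 (y * z) (x * z) (x * y).

Lemma mderivXi (i k : 'I_3) : 'X_i^`M(k) = (i == k)%:R :> {mpoly K[3]}.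
Proof.
rewrite mderivX mnmE; have [<-|_] := eqVneq; last by rewrite scale0r.
rewrite scale1r -mpolyX0; congr 'X_[_].
by apply/mnmP => j; rewrite mnmBE subnn mnm0E.
Qed.

(** The involution replaces alpha = s / t by its inverse. *)
Lemma sigma_form s t k :
  \sum_i pull sigma (form4 s t i) * (sigma i)^`M(k)
    = - ('X_i0 * 'X_i1 * 'X_i2) ^+ 2 * form4 t s k.
Proof.
rewrite sum3 /form4 !vec3E !(pullXn, pullB, pullM) !pullX !pullC.
by case: (ord3P k) => ->; rewrite /sigma !vec3E !mderivM !mderivXi /=; ring.
Qed.

End Pullback.

(** * Taylor expansions and ordinary points *)

Section Taylor.
Variable K : fieldType.
Implicit Types F G : {mpoly K[3]}.
Implicit Types Q v : 'I_3 -> K.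

(* F(Q + 'X V), where V is the vector of the variables of {mpoly K[3]} *)
Definition tay F Q : {poly {mpoly K[3]}} :=
  locked (mmap (polyC \o @mpolyC 3 K) (fun i => ((Q i)%:MP)%:P + 'X * ('X_i)%:P)) F.

Lemma tayE F Q : tay F Q =
  mmap (polyC \o @mpolyC 3 K) (fun i => ((Q i)%:MP)%:P + 'X * ('X_i)%:P) F.
Proof. by rewrite /tay -lock. Qed.

Lemma eq_tay F Q Q' : Q =1 Q' -> tay F Q = tay F Q'.
Proof. by move=> e; rewrite !tayE; apply: mmap_eq => [//|i]; rewrite e. Qed.

(** The single expansion [tay] governs all arcs Q + 'X Y through [Q], where Y may itself depend on
    ['X]. The next lemmas read off the lowest coefficient along such an arc, which involves only the
    constant term of Y. *)
Lemma mmap_tay (S : comNzRingType) (f : {rmorphism K -> S}) Q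
    (Y : 'I_3 -> {poly S}) F :
  mmap (polyC \o f) (fun i => (f (Q i))%:P + 'X * Y i) F =
  \sum_(k < size (tay F Q)) 'X^k * mmap (polyC \o f) Y (tay F Q)`_k.
Proof.
pose g : {rmorphism {mpoly K[3]} -> {poly S}} := mmap (polyC \o f) Y.
transitivity (horner_eval 'X (map_poly g (tay F Q))).
  have -> : horner_eval 'X (map_poly g (tay F Q)) =
      (horner_eval 'X \o map_poly g) (tay F Q) by [].
  rewrite tayE rmorph_mmap; apply: mmap_eq => [c|i] /=.
    by rewrite /horner_eval map_polyC hornerC /= /g /= mmapC.
  rewrite /horner_eval rmorphD rmorphM /= map_polyX !map_polyC /= /g /=.
  by rewrite mmapC mmapX mmap1U !hornerE.
rewrite /horner_eval /map_poly horner_poly.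
by apply: eq_bigr => k _; rewrite mulrC.
Qed.

Lemma coef0_mmap (S : comNzRingType) (f : {rmorphism K -> S})
    (Y : 'I_3 -> {poly S}) F :
  (mmap (polyC \o f) Y F)`_0 = mmap f (fun i => (Y i)`_0) F.
Proof.
have -> : (mmap (polyC \o f) Y F)`_0 = coefp 0 (mmap (polyC \o f) Y F) by [].
by rewrite rmorph_mmap; apply: mmap_eq => [c|i] /=; rewrite ?coefC.
Qed.

Lemma coef_arc_lt (S : comNzRingType) (f : {rmorphism K -> S}) Q
    (Y : 'I_3 -> {poly S}) F m :
    (forall k, (k < m)%N -> (tay F Q)`_k = 0) ->
  forall k, (k < m)%N ->
    (mmap (polyC \o f) (fun i => (f (Q i))%:P + 'X * Y i) F)`_k = 0.
Proof.
move=> h k km; rewrite mmap_tay coef_sum big1 // => i _; rewrite coefXnM.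
case: ltnP => // ik; rewrite h ?mmap0 ?coef0 //.
exact: leq_ltn_trans ik km.
Qed.

Lemma coef_arc_lead (S : comNzRingType) (f : {rmorphism K -> S}) Q
    (Y : 'I_3 -> {poly S}) F m :
    (forall k, (k < m)%N -> (tay F Q)`_k = 0) ->
  (mmap (polyC \o f) (fun i => (f (Q i))%:P + 'X * Y i) F)`_m =
  mmap f (fun i => (Y i)`_0) (tay F Q)`_m.
Proof.
move=> h; rewrite mmap_tay coef_sum -coef0_mmap.
have z (i : nat) : i != m -> ('X^i * mmap (polyC \o f) Y (tay F Q)`_i)`_m = 0.
  move=> im; rewrite coefXnM; case: ltnP => // mi.
  by rewrite h ?mmap0 ?coef0 // ltn_neqAle im.
have [ms|sm] := ltnP m (size (tay F Q)).
  rewrite (bigD1 (Ordinal ms)) //= coefXnM ltnn subnn big1 ?addr0 // => i im.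
  by apply: z; apply: contra im => /eqP e; apply/eqP/val_inj.
have -> : (tay F Q)`_m = 0 by rewrite nth_default.
rewrite mmap0 coef0 big1 // => i _; apply: z.
by rewrite neq_ltn (leq_trans (ltn_ord i)).
Qed.

Lemma coef_line (S : comNzRingType) (f : {rmorphism K -> S}) Q (y : 'I_3 -> S) F k :
  (mmap (polyC \o f) (fun i => (f (Q i))%:P + 'X * (y i)%:P) F)`_k =
  mmap f y (tay F Q)`_k.
Proof.
have e G : mmap (polyC \o f) (polyC \o y) G = (mmap f y G)%:P.
  by rewrite rmorph_mmap.
rewrite mmap_tay coef_sum.
rewrite (eq_bigr (fun i : 'I_(size (tay F Q)) => (mmap f y (tay F Q)`_i) *+ (k == i))).
  have [ks|sk] := ltnP k (size (tay F Q)).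
    rewrite (bigD1 (Ordinal ks)) //= eqxx big1 ?addr0 // => i /negPf ik.
    by rewrite -[k]/(val (Ordinal ks)) val_eqE eq_sym ik.
  have -> : (tay F Q)`_k = 0 by rewrite nth_default.
  rewrite mmap0 big1 // => i _.
  by rewrite gtn_eqF // (leq_trans (ltn_ord i)).
move=> i _; rewrite (_ : mmap _ _ _ = (mmap f y (tay F Q)`_i)%:P) ?e //.
by rewrite coefMC coefXn mulr_natl.
Qed.

Lemma tay0 F Q : (tay F Q)`_0 = (F.@[Q])%:MP.
Proof.
rewrite tayE coef0_mmap /meval rmorph_mmap; apply: mmap_eq => [//|i].
by rewrite coefD coefC coefXM addr0.
Qed.

Lemma tayM F G Q : tay (F * G) Q = tay F Q * tay G Q.
Proof. by rewrite !tayE rmorphM. Qed.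

Lemma tayD F G Q : tay (F + G) Q = tay F Q + tay G Q.
Proof. by rewrite !tayE rmorphD. Qed.

Lemma tayC c Q : tay c%:MP Q = (c%:MP)%:P.
Proof. by rewrite !tayE mmapC. Qed.

Lemma tay_0 Q : tay 0 Q = 0.
Proof. by rewrite tayE mmap0. Qed.

Lemma tayX i Q : tay 'X_i Q = ((Q i)%:MP)%:P + 'X * ('X_i)%:P.
Proof. by rewrite !tayE mmapX mmap1U. Qed.

Lemma tay1 F Q : (tay F Q)`_1 = \sum_k (F^`M(k).@[Q])%:MP * 'X_k.
Proof.
elim/mpoly_ring_ind: F => [c|i|p q IHp IHq|p q IHp IHq].
- rewrite tayC coefC big1 // => k _; by rewrite mderivC meval0 mul0r.
- rewrite tayX coefD coefC add0r coefXM coefC /= (bigD1 i) //= big1 => [|j ji].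
    by rewrite addr0 mderivXi eqxx meval1 mul1r.
  by rewrite mderivXi eq_sym (negPf ji) meval0 mul0r.
- rewrite tayD coefD IHp IHq -big_split.
  by apply: eq_bigr => k _; rewrite mderivD mevalD mpolyCD mulrDl.
- rewrite tayM coefM big_ord_recl big_ord1 /= !tay0 /bump /= IHp IHq.
  rewrite mulr_suml mulr_sumr -big_split /=. apply: eq_bigr => k _.
  rewrite mderivM mevalD !mevalM mpolyCD !mpolyCM /=; ring.
Qed.

Lemma deriv_tay F Q i k : ((tay F Q)`_k.+1)^`M(i) = (tay F^`M(i) Q)`_k.
Proof.
elim/mpoly_ring_ind: F k => [c|j|p q IHp IHq|p q IHp IHq] k.
- by rewrite tayC coefC mderiv0 mderivC tay_0 coef0.
- rewrite tayX mderivXi coefD coefC add0r coefXM coefC /= -mpolyC_nat tayC coefC.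
  by case: k => [|k] /=; rewrite ?mderivXi ?mpolyC_nat ?mderiv0.
- by rewrite mderivD !tayD !coefD mderivD IHp IHq.
- rewrite mderivM tayD !tayM coefD !coefM raddf_sum /=.
  rewrite (eq_bigr (fun j : 'I_k.+2 => ((tay p Q)`_j)^`M(i) * (tay q Q)`_(k.+1 - j)
     + (tay p Q)`_j * ((tay q Q)`_(k.+1 - j))^`M(i))); last by move=> j _; rewrite mderivM.
  rewrite big_split /= [X in X + _]big_ord_recl [X in _ + X]big_ord_recr /=.
  rewrite subnn !tay0 !mderivC mul0r mulr0 addr0 add0r; congr (_ + _).
    by apply: eq_bigr => j _; rewrite /bump /= add1n subSS IHp.
  by apply: eq_bigr => j _; rewrite subSn ?IHq // -ltnS.
Qed.

(** In characteristic 0 a leading form at [Q] does not vary in the direction of [Q], and from degree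
    2 on it is singular along the line K Q; these zeros are exempted. The zero polynomial is
    excluded, as [simple_zeros_neq0] shows. *)
Definition simple_zeros (L : {mpoly K[3]}) Q := forall v, L.@[v] = 0 ->
  (forall i, L^`M(i).@[v] = 0) -> exists c, forall i, v i = c * Q i.

(* F has an ordinary point of multiplicity m at Q: its leading form there,
   which lives on K^3 / K Q, has only simple zeros. *)
Definition Ord F Q m := (forall k, (k < m)%N -> (tay F Q)`_k = 0) /\
  simple_zeros (tay F Q)`_m Q.

Lemma Ord_eq F Q Q' m : Q =1 Q' -> Ord F Q m -> Ord F Q' m.
Proof.
move=> e []; rewrite (eq_tay F e) => h nd; split=> // v L0 dL0.
by have [c hc] := nd v L0 dL0; exists c => i; rewrite hc e.
Qed.

Lemma tay_pull phi F Q :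
  tay (pull phi F) Q = mmap (polyC \o @mpolyC 3 K)
    (fun i => (((phi i).@[Q])%:MP)%:P + 'X * drop_poly 1 (tay (phi i) Q)) F.
Proof.
rewrite tayE (mmap_pull (polyC \o @mpolyC 3 K)); apply: mmap_eq => [//|i].
rewrite -tayE -tay0 -{1}[tay _ _](poly_take_drop 1) expr1 mulrC.
congr (_ + _); apply/polyP => k; rewrite coef_take_poly coefC.
by case: k.
Qed.

(** The leading form of the pullback is that of [F] composed with the Jacobian J of [phi] at [Q].
    The first hypothesis is the injectivity of the transpose of J, so that a singular zero v gives a
    singular zero J v; the second is the injectivity of J from K^3 / K Q to K^3 / K phi(Q). *)
Lemma Ord_pull phi F Q m :
    (forall g : 'I_3 -> K, (forall k, \sum_i g i * (phi i)^`M(k).@[Q] = 0) ->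
       forall i, g i = 0) ->
    (forall (v : 'I_3 -> K) c,
       (forall i, \sum_k (phi i)^`M(k).@[Q] * v k = c * (phi i).@[Q]) ->
       exists c', forall i, v i = c' * Q i) ->
  Ord F (fun i => (phi i).@[Q]) m -> Ord (pull phi F) Q m.
Proof.
move=> H1 H2 [lt_m nd]; split=> [k km|v].
  by rewrite tay_pull (coef_arc_lt _ _ lt_m).
set L := (tay F _)`_m in nd *.
pose J i : {mpoly K[3]} := \sum_k ((phi i)^`M(k).@[Q])%:MP * 'X_k.
have Jv i : (J i).@[v] = \sum_k (phi i)^`M(k).@[Q] * v k.
  by rewrite raddf_sum; apply: eq_bigr => k _; rewrite /= mevalM mevalC mevalXU.
have -> : (tay (pull phi F) Q)`_m = pull J L.
  rewrite tay_pull (coef_arc_lead _ _ lt_m) pullE; apply: mmap_eq => [//|i].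
  by rewrite coef_drop_poly add0n tay1.
rewrite meval_pull => L0 dL0.
have [|c hc] := nd _ L0; last first.
  by apply: (H2 v c) => i; rewrite -Jv hc.
apply: H1 => k; apply: etrans (dL0 k); rewrite mderiv_pull raddf_sum /=.
apply: eq_bigr => i _; rewrite mevalM meval_pull; congr (_ * _).
rewrite /J (raddf_sum (mderiv k)) (raddf_sum (meval v)) (bigD1 k) //= big1 => [|j jk].
  by rewrite mderivM mderivC mderivXi eqxx mul0r add0r mulr1 mevalC addr0.
by rewrite mderivM mderivC mderivXi (negPf jk) mul0r add0r mulr0 meval0.
Qed.

(** A factor that is a unit at [Q] only multiplies the lowest term by the constant G(Q). *)
Lemma Ord_div G F Q m : G.@[Q] != 0 -> Ord (G * F) Q m -> Ord F Q m.
Proof.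
move=> G0; rewrite /Ord tayM => -[lt_m nd].
have lt_F k : (k < m)%N -> (tay F Q)`_k = 0.
  have [n] := ubnP k; elim: n k => // n IHn k kn km.
  have := lt_m k km; rewrite coefM big_ord_recl subn0 big1 => [|i _].
    rewrite addr0 tay0 => /eqP; rewrite mulf_eq0 mpolyC_eq0 (negPf G0) /=.
    by move/eqP.
  have h : (k - lift ord0 i < k)%N.
    by rewrite ltn_subrL /= (leq_ltn_trans (leq0n i)).
  by rewrite IHn ?mulr0 //; [exact: leq_trans h kn|exact: ltn_trans h km].
have lead : (tay G Q * tay F Q)`_m = G.@[Q]%:MP * (tay F Q)`_m.
  rewrite coefM big_ord_recl subn0 tay0 big1 ?addr0 // => i _.
  by rewrite lt_F ?mulr0 // ltn_subrL /= (leq_ltn_trans (leq0n i)).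
split=> // v L0 dL0; apply: nd => [|i]; rewrite lead.
  by rewrite mevalM L0 mulr0.
by rewrite mderiv_mulC mevalM dL0 mulr0.
Qed.

End Taylor.

(** * Linear symmetries *)

Section Linear.
Variable K : fieldType.
Implicit Types (F G : {mpoly K[3]}) (A B : 'M[K]_3) (v P Q : 'I_3 -> K).

Definition lin A i : {mpoly K[3]} := \sum_k (A i k)%:MP * 'X_k.
Definition mulv A v i : K := \sum_k A i k * v k.

Lemma mderiv_lin A i k : (lin A i)^`M(k) = (A i k)%:MP.
Proof.
rewrite /lin (raddf_sum (mderiv k)) (bigD1 k) //= big1 => [|j jk].
  by rewrite mderivM mderivC mderivXi eqxx mul0r add0r mulr1 addr0.
by rewrite mderivM mderivC mderivXi (negPf jk) mul0r add0r mulr0.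
Qed.

Lemma meval_lin A i v : (lin A i).@[v] = mulv A v i.
Proof.
rewrite /lin (raddf_sum (meval v)); apply: eq_bigr => k _.
by rewrite /= mevalM mevalC mevalXU.
Qed.

Lemma pull_lin A phi i : pull phi (lin A i) = \sum_k (A i k)%:MP * phi k.
Proof.
by rewrite /lin (raddf_sum (pull phi)); apply: eq_bigr => k _; rewrite /= pullM pullC pullX.
Qed.

Lemma lin_comp A B F : pull (lin B) (pull (lin A) F) = pull (lin (A *m B)) F.
Proof.
rewrite pull_comp; apply: eq_pull => i; rewrite pull_lin.
rewrite (eq_bigr (fun k => \sum_j (A i k * B k j)%:MP * 'X_j)) => [|k _].
  rewrite exchange_big; apply: eq_bigr => j _.
  by rewrite mxE (raddf_sum (@mpolyC 3 K)) mulr_suml.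
by rewrite mulr_sumr; apply: eq_bigr => j _; rewrite mpolyCM mulrA.
Qed.

Lemma lin1 F : pull (lin 1%:M) F = F.
Proof.
rewrite -[RHS]pull_id; apply: eq_pull => i.
rewrite /lin (bigD1 i) //= big1 => [|j ji]; first by rewrite mxE eqxx mul1r addr0.
by rewrite mxE eq_sym (negPf ji) mul0r.
Qed.

Lemma lin_K A F : A \in unitmx -> pull (lin (invmx A)) (pull (lin A) F) = F.
Proof. by move=> uA; rewrite lin_comp mulmxV // lin1. Qed.

Lemma mulv_comp A B v : mulv A (mulv B v) =1 mulv (A *m B) v.
Proof.
move=> i; rewrite /mulv (eq_bigr (fun k => \sum_j A i k * B k j * v j)) => [|k _].
  by rewrite exchange_big; apply: eq_bigr => j _; rewrite mxE mulr_suml.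
by rewrite mulr_sumr; apply: eq_bigr => j _; rewrite mulrA.
Qed.

Lemma mulv1 v : mulv 1%:M v =1 v.
Proof.
move=> i; rewrite /mulv (bigD1 i) //= big1 => [|j ji]; first by rewrite mxE eqxx mul1r addr0.
by rewrite mxE eq_sym (negPf ji) mul0r.
Qed.

Lemma eq_mulv A v v' : v =1 v' -> mulv A v =1 mulv A v'.
Proof. by move=> e i; apply: eq_bigr => k _; rewrite e. Qed.

Lemma mulv_K A v : A \in unitmx -> mulv (invmx A) (mulv A v) =1 v.
Proof. by move=> uA i; rewrite mulv_comp mulVmx // mulv1. Qed.

Lemma mulv_VK A v : A \in unitmx -> mulv A (mulv (invmx A) v) =1 v.
Proof. by move=> uA i; rewrite mulv_comp mulmxV // mulv1. Qed.

Lemma mulvZ A c v i : mulv A (fun j => c * v j) i = c * mulv A v i.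
Proof. by rewrite /mulv mulr_sumr; apply: eq_bigr => k _; rewrite mulrCA. Qed.

Lemma Ord_lin A F Q m : A \in unitmx -> Ord F (mulv A Q) m -> Ord (pull (lin A) F) Q m.
Proof.
move=> uA oF; apply: Ord_pull => [g hg|v c hv|]; last first.
- by apply: Ord_eq oF => i; rewrite meval_lin.
- exists c => i; rewrite -(mulv_K v uA) -[in RHS](mulv_K Q uA) -mulvZ.
  apply: eq_mulv => j; rewrite -[mulv A Q j]meval_lin -hv; apply: eq_bigr => k _.
  by rewrite mderiv_lin mevalC.
- have e : (\row_i g i) *m A = 0.
    apply/rowP => k; rewrite !mxE; apply: etrans (hg k); apply: eq_bigr => i _.
    by rewrite mxE mderiv_lin mevalC.
  move=> i; have := congr1 (fun M : 'rV_3 => (M *m invmx A) 0 i) e.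
  by rewrite mulmxK // mul0mx !mxE.
Qed.

Lemma Ord_linE A F Q m : A \in unitmx -> Ord (pull (lin A) F) Q m -> Ord F (mulv A Q) m.
Proof.
move=> uA oF; rewrite -(lin_K F uA).
have uV : invmx A \in unitmx by rewrite unitmx_inv.
by apply: (Ord_lin uV); apply: Ord_eq oF => i; rewrite (mulv_K Q uA).
Qed.

Lemma homog_pull phi d e F : (forall i, phi i \is e.-homog) -> F \is d.-homog ->
  pull phi F \is (e * d).-homog.
Proof.
move=> hphi hF.
have g : grade (pull phi F) = pull phi F *: 'X^(e * d).
  rewrite /grade (mmap_pull (polyC \o @mpolyC 3 K)).
  rewrite (mmap_eq (g := polyC \o @mpolyC 3 K) (v := fun i => 'X^e * (phi i)%:P) _ (fun=> erefl)).
    rewrite (mmap_homogM (polyC \o @mpolyC 3 K) _ _ hF) -exprM.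
    rewrite (_ : mmap _ _ _ = (pull phi F)%:P) 1?mulrC ?mul_polyC //.
    by rewrite pullE rmorph_mmap.
  by move=> i; rewrite -[LHS]/(grade (phi i)) (grade_homog (hphi i)) -mul_polyC mulrC.
apply: homog_grade; rewrite g; congr (_ *: _).
by rewrite coefZ coefXn eqxx mulr1.
Qed.

Lemma homog_lin A i : lin A i \is 1.-homog.
Proof.
apply: rpred_sum => k _; rewrite mul_mpolyC; apply: rpredZ.
by rewrite dhomogX /= mdeg1.
Qed.

Lemma homog_pull_lin A d F : F \is d.-homog -> pull (lin A) F \is d.-homog.
Proof. by move=> hF; have := homog_pull (homog_lin A) hF; rewrite mul1n. Qed.

Lemma unit_pull phi G : G \is a GRing.unit -> pull phi G \is a GRing.unit.
Proof. by move/(rmorph_unit (pull phi)). Qed.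

Lemma unit_pull_lin A G : A \in unitmx ->
  (pull (lin A) G \is a GRing.unit) = (G \is a GRing.unit).
Proof.
move=> uA; apply/idP/idP; last exact: unit_pull.
by move/(unit_pull (lin (invmx A))); rewrite lin_K.
Qed.

Lemma pull_lin_eq0 A G : A \in unitmx -> (pull (lin A) G == 0) = (G == 0).
Proof.
move=> uA; apply/eqP/eqP => [e|->]; last by rewrite rmorph0.
by rewrite -(lin_K G uA) e rmorph0.
Qed.

Lemma irreducible_lin A F : A \in unitmx -> irreducible_curve F ->
  irreducible_curve (pull (lin A) F).
Proof.
move=> uA [[d hF] [F0 nuF irr]]; split; first by exists d; apply: homog_pull_lin.
split; rewrite ?pull_lin_eq0 ?unit_pull_lin // => G H e.
have uV : invmx A \in unitmx by rewrite unitmx_inv.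
have := irr (pull (lin (invmx A)) G) (pull (lin (invmx A)) H).
by rewrite !unit_pull_lin //; apply; rewrite -rmorphM -e /= lin_K.
Qed.

Lemma invariant_lin A F s t s' t' mu : mu != 0 ->
    (forall k, \sum_i pull (lin A) (form4 s t i) * (lin A i)^`M(k) = mu%:MP * form4 s' t' k) ->
  invariant_curve (form4 s t) F -> invariant_curve (form4 s' t') (pull (lin A) F).
Proof.
move=> mu0 h inv i j; have [H e] := invariant_pull h inv i j.
exists ((mu^-1)%:MP * H); rewrite -mulrA -e mulrA -mpolyCM mulVf // mul1r //.
Qed.

Definition smooth F P := F.@[P] = 0 -> exists i, F^`M(i).@[P] != 0.

Lemma simple_zeros_neq0 L Q : simple_zeros L Q -> L != 0.
Proof.
move=> nd; apply/eqP => L0.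
have h v : exists c, forall i, v i = c * Q i.
  by apply: nd => [|i]; rewrite L0 ?mderiv0 meval0.
have [c hc] := h (vec3 1 0 0); have [c' hc'] := h (vec3 0 1 0).
have /eqP := hc i1; rewrite !vec3E eq_sym mulf_eq0 => /orP[] /eqP e.
  by have /eqP := hc i0; rewrite !vec3E e mul0r oner_eq0.
by have /eqP := hc' i1; rewrite !vec3E e mulr0 oner_eq0.
Qed.

(** Smoothness, which includes the case of a curve missing the point, is multiplicity at most 1.
    With its converse below, this lets smoothness travel with the lemmas on [Ord]. *)
Lemma smooth_Ord F P : smooth F P -> exists2 m, (m <= 1)%N & Ord F P m.
Proof.
move=> sF; have [F0|F0] := eqVneq F.@[P] 0.
  have [i di] := sF F0; exists 1%N => //; split=> [[]//|v _ dv].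
    by rewrite tay0 F0.
  by move: di; have := dv i; rewrite deriv_tay tay0 mevalC => ->; rewrite eqxx.
exists 0%N => //; split=> // v; rewrite tay0 mevalC => e.
by rewrite e eqxx in F0.
Qed.

Lemma Ord_smooth F P m : (m <= 1)%N -> Ord F P m -> smooth F P.
Proof.
case: m => [|[|//]] _ [lt_m /simple_zeros_neq0].
  by rewrite tay0 mpolyC_eq0 => /eqP F0 /F0.
move=> L0 _; apply/existsP; apply: contraNT L0; rewrite negb_exists => /forallP h.
rewrite tay1 big1 // => k _.
by have /negPn/eqP-> := h k; rewrite mul0r.
Qed.

(** Independence of the homogeneous coordinates: the homothety of ratio 1/c multiplies a form of
    degree d by a constant. *)
Lemma Ord_scale F P m c d : c != 0 -> F \is d.-homog -> Ord F P m ->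
  Ord F (fun i => c * P i) m.
Proof.
move=> c0 hF oF.
have uA : (c^-1)%:M \in (@unitmx K 3) by rewrite unitmxE det_scalar unitrX ?unitfE ?invr_eq0.
have mulc v i : mulv (c^-1)%:M v i = c^-1 * v i.
  rewrite /mulv (bigD1 i) //= big1 => [|j ji]; first by rewrite mxE eqxx mulr1n addr0.
  by rewrite mxE eq_sym (negPf ji) mulr0n mul0r.
apply: (@Ord_div _ (c^-1 ^+ d)%:MP); first by rewrite mevalC expf_neq0 ?invr_eq0.
have -> : (c^-1 ^+ d)%:MP * F = pull (lin (c^-1)%:M) F.
  rewrite rmorphXn /= -[in LHS](mmap_X F) pullE -(mmap_homogM _ _ _ hF); apply: mmap_eq => [//|i].
  rewrite /lin (bigD1 i) //= big1 => [|j ji]; first by rewrite mxE eqxx mulr1n addr0.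
  by rewrite mxE eq_sym (negPf ji) mulr0n mul0r.
apply: (Ord_lin uA); apply: Ord_eq oF => i.
by rewrite (mulc (fun j => c * P j)) mulKf.
Qed.

End Linear.

(** * The four groups of points and the linear maps permuting them *)

Section Configuration.
Variables (K : fieldType) (w : K).
Hypothesis w2 : w ^+ 2 = - w - 1.
Hypothesis three_neq0 : 3%:R != 0 :> K.
Implicit Types (F G : {mpoly K[3]}) (P Q : 'I_3 -> K).

Definition nz P := exists i, P i != 0.

(** Each of the four triples of points is cut out by a net of conics. With equations in place of
    lists of points, the effect of a symmetry is a matter of linear combinations of these equations,
    for any homogeneous coordinates. *)
Definition vertex P := [/\ P i1 * P i2 = 0, P i0 * P i2 = 0 & P i0 * P i1 = 0].

(* For zeta = 1, omega, omega^2 these are the points of P_1, P_omega, P_omega^2. *)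
Definition triangle (zeta : K) P := [/\ P i1 * P i2 = zeta * P i0 ^+ 2,
  P i0 * P i2 = zeta * P i1 ^+ 2 & P i0 * P i1 = zeta * P i2 ^+ 2].

Definition special P :=
  vertex P \/ [\/ triangle 1 P, triangle w P | triangle (w ^+ 2) P].

Definition type_at (a b c e : nat) F P :=
  [/\ vertex P -> Ord F P a, triangle 1 P -> Ord F P b, triangle w P -> Ord F P c,
      triangle (w ^+ 2) P -> Ord F P e & ~ special P -> smooth F P].

(** The degree is recorded because it determines the multiplicities after the involution: a side
    through two vertices of multiplicity a leaves room for only (a + b + c + e) - 2 a further
    intersections. *)
Definition nice a b c e F :=
  F \is (a + b + c + e).-homog /\ forall P, nz P -> type_at a b c e F P.

(* a, b, c, e are the multiplicities at P_infty, P_1, P_omega, P_omega^2. *)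
Definition Good s t a b c e := exists S : seq {mpoly K[3]}, forall F,
  irreducible_curve F -> invariant_curve (form4 s t) F ->
  (forall G (k : K), G \in S -> F <> k *: G) -> nice a b c e F.

Lemma smooth_eq F P P' : P =1 P' -> smooth F P -> smooth F P'.
Proof.
move=> e; rewrite /smooth (meval_eq _ e) => h /h[i hi].
by exists i; rewrite -(meval_eq _ e).
Qed.

Lemma type_at_eq a b c e F P P' : P =1 P' -> type_at a b c e F P -> type_at a b c e F P'.
Proof.
move=> eP; rewrite /type_at /special /vertex /triangle !eP => -[h1 h2 h3 h4 h5].
by split; move=> *; apply: (Ord_eq eP) || apply: (smooth_eq eP); auto.
Qed.

(** The excepted curves for (s, t) are those for (s', t') moved back by the inverse of [A]. *)
Lemma Good_lin A s t s' t' mu a b c e a' b' c' e' :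
    A \in unitmx -> mu != 0 ->
    (forall k, \sum_i pull (lin A) (form4 s t i) * (lin A i)^`M(k) = mu%:MP * form4 s' t' k) ->
    (a + b + c + e = a' + b' + c' + e')%N ->
    (forall F P, type_at a' b' c' e' (pull (lin A) F) P -> type_at a b c e F (mulv A P)) ->
  Good s' t' a' b' c' e' -> Good s t a b c e.
Proof.
move=> uA mu0 hmu hsum hloc [S hS].
exists (map (pull (lin (invmx A))) S) => F irrF invF nF.
have [||G k GS eG|hF loc] := hS (pull (lin A) F).
- exact: irreducible_lin.
- exact: invariant_lin mu0 hmu invF.
- apply: (nF (pull (lin (invmx A)) G) k); first exact: (map_f (pull (lin (invmx A)))).
  by rewrite -(lin_K F uA) eG pullZ.
split.
  case: irrF => -[d hd] [F0 _ _].
  have := dhomog_uniq _ (homog_pull_lin A hd) hF; rewrite pull_lin_eq0 // => /(_ F0) ed.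
  by rewrite hsum -ed.
move=> P [i Pi].
apply: type_at_eq (mulv_VK P uA) _; apply: hloc; apply: loc.
apply/existsP; apply: contraNT Pi; rewrite negb_exists => /forallP h.
rewrite -(mulv_VK P uA); apply/eqP; apply: big1 => k _.
by have /negPn/eqP-> := h k; rewrite mulr0.
Qed.

Definition diag_w : 'M[K]_3 :=
  \matrix_(i, j) vec3 (vec3 1 0 0 j) (vec3 0 1 0 j) (vec3 0 0 w j) i.

Definition fourier : 'M[K]_3 :=
  \matrix_(i, j) vec3 (vec3 1 1 1 j) (vec3 1 w (w ^+ 2) j) (vec3 1 (w ^+ 2) w j) i.

Definition fourierV : 'M[K]_3 :=
  \matrix_(i, j) vec3 (vec3 1 1 1 j) (vec3 1 (w ^+ 2) w j) (vec3 1 w (w ^+ 2) j) i.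

Lemma w3 : w ^+ 3 = 1.
Proof. ring: w2. Qed.

Lemma w_neq0 : w != 0.
Proof.
apply/eqP => e; have := w3; rewrite e expr0n /= => /eqP.
by rewrite eq_sym oner_eq0.
Qed.

Lemma diag_w_unit : diag_w \in unitmx.
Proof.
have := @mulmx1_unit _ _ diag_w (\matrix_(i, j) vec3 (vec3 1 0 0 j) (vec3 0 1 0 j) (vec3 0 0 (w
  ^+ 2) j) i).
case=> //; apply/matrixP => i j; rewrite !mxE sum3 !mxE.
by case: (ord3P i) => ->; case: (ord3P j) => ->; rewrite !vec3E /=; ring: w2.
Qed.

Lemma fourier_unit : fourier \in unitmx.
Proof.
have := @mulmx1_unit _ _ fourier (3%:R^-1 *: fourierV).
case=> //; rewrite -scalemxAr.
have -> : fourier *m fourierV = 3%:R *: 1%:M.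
  apply/matrixP => i j; rewrite !mxE sum3 !mxE.
  by case: (ord3P i) => ->; case: (ord3P j) => ->; rewrite !vec3E /=; ring: w2.
by rewrite scalerA mulVf // scale1r.
Qed.

Lemma diag_w_form s t k :
  \sum_i pull (lin diag_w) (form4 s t i) * (lin diag_w i)^`M(k) = 1%:MP * form4 s (w * t) k.
Proof.
have W2 : w%:MP_[3] ^+ 2 = - w%:MP_[3] - 1 by rewrite -rmorphXn w2 rmorphB rmorphN rmorph1.
rewrite sum3 /form4 !vec3E !(pullXn, pullB, pullM) !pullX !pullC !mderiv_lin.
rewrite /lin !sum3 !mxE.
by case: (ord3P k) => ->; rewrite !vec3E ?mpolyC0 ?mpolyC1 ?mpolyCM; ring: W2.
Qed.

Lemma fourier_form s t k :
  \sum_i pull (lin fourier) (form4 s t i) * (lin fourier i)^`M(k)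
  = (- 9%:R * (1 + 2%:R * w))%:MP * form4 (s + 2%:R * t) (s - t) k.
Proof.
have W2 : w%:MP_[3] ^+ 2 = - w%:MP_[3] - 1 by rewrite -rmorphXn w2 rmorphB rmorphN rmorph1.
rewrite sum3 /form4 !vec3E !(pullXn, pullB, pullM) !pullX !pullC !mderiv_lin.
have WW : (w ^+ 2)%:MP_[3] = w%:MP_[3] ^+ 2 by rewrite rmorphXn.
rewrite /lin !sum3 !mxE.
case: (ord3P k) => ->; rewrite !vec3E ?mpolyC0 ?mpolyC1.
all: rewrite ?WW ?mpolyCM ?mpolyCN ?mpolyCB ?mpolyCD ?mpolyCM ?mpolyC1 ?mpolyC_nat.
all: ring: W2.
Qed.

End Configuration.

Section Symmetries.
Variables (K : fieldType) (w : K).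
Hypothesis w2 : w ^+ 2 = - w - 1.
Hypothesis three_neq0 : 3%:R != 0 :> K.
Implicit Types (F G : {mpoly K[3]}) (P Q : 'I_3 -> K).

Lemma mulv_diag P : [/\ mulv (diag_w w) P i0 = P i0, mulv (diag_w w) P i1 = P i1 &
  mulv (diag_w w) P i2 = w * P i2].
Proof.
by split; rewrite /mulv sum3 !mxE !vec3E !mul0r ?mul1r ?addr0 ?add0r.
Qed.

Lemma mulv_fourier P : [/\ mulv (fourier w) P i0 = P i0 + P i1 + P i2,
  mulv (fourier w) P i1 = P i0 + w * P i1 + w ^+ 2 * P i2 &
  mulv (fourier w) P i2 = P i0 + w ^+ 2 * P i1 + w * P i2].
Proof. by split; rewrite /mulv sum3 !mxE !vec3E !mul1r. Qed.

Lemma vertex_diag P : vertex (mulv (diag_w w) P) <-> vertex P.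
Proof.
rewrite /vertex; have [-> -> ->] := mulv_diag P.
split=> -[h1 h2 h3]; split=> //.
- transitivity (w ^+ 2 * (P i1 * (w * P i2))); first by ring: w2.
  by rewrite h1 mulr0.
- transitivity (w ^+ 2 * (P i0 * (w * P i2))); first by ring: w2.
  by rewrite h2 mulr0.
- by rewrite mulrCA h1 mulr0.
- by rewrite mulrCA h2 mulr0.
Qed.

Lemma triangle_diag z P : triangle z (mulv (diag_w w) P) <-> triangle (w ^+ 2 * z) P.
Proof.
rewrite /triangle; have [-> -> ->] := mulv_diag P.
split=> -[h1 h2 h3]; split.
- transitivity (w ^+ 2 * (P i1 * (w * P i2))); first by ring: w2.
  by rewrite h1 mulrA.
- transitivity (w ^+ 2 * (P i0 * (w * P i2))); first by ring: w2.
  by rewrite h2 mulrA.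
- by rewrite h3; ring.
- by rewrite mulrCA h1; ring: w2.
- by rewrite mulrCA h2; ring: w2.
- by rewrite h3; ring.
Qed.

Let nine_neq0 : 9%:R != 0 :> K.
Proof.
have -> : 9%:R = 3%:R * 3%:R :> K by ring.
by rewrite mulf_neq0.
Qed.

Let div9 (a b : K) : 9%:R * (a - b) = 0 -> a = b.
Proof.
by move/eqP; rewrite mulf_eq0 (negPf nine_neq0) /= subr_eq0 => /eqP.
Qed.

Let sub0 (a b : K) : a = b -> a - b = 0. Proof. by move->; rewrite subrr. Qed.
Let eqs0 (a b : K) : a - b = 0 -> a = b. Proof. by move/eqP; rewrite subr_eq0 => /eqP. Qed.

(** [fourier] exchanges the two nets of conics: each equation on one side is a combination of those
    on the other, up to a common factor with powers of [w] as coefficients. Recovering the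
    coordinates of [P] from its image costs a factor 3 for each of them, hence the 9 for conics. *)
Lemma vertex_fourier P : vertex (mulv (fourier w) P) <-> triangle 1 P.
Proof.
rewrite /vertex /triangle; have [-> -> ->] := mulv_fourier P.
set X := P i0 + P i1 + P i2; set Y := P i0 + w * P i1 + _; set Z := P i0 + w ^+ 2 * P i1 + _.
split=> [[h1 h2 h3]|[/sub0 h1 /sub0 h2 /sub0 h3]]; split.
- apply: div9; transitivity (- 3%:R * (X * Y + X * Z + Y * Z)).
    by rewrite /X /Y /Z; ring: w2.
  by rewrite h1 h2 h3 !addr0 mulr0.
- apply: div9; transitivity (- 3%:R * (w ^+ 2 * (X * Y) + w * (X * Z) + Y * Z)).
    by rewrite /X /Y /Z; ring: w2.
  by rewrite h1 h2 h3 !mulr0 !addr0 mulr0.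
- apply: div9; transitivity (- 3%:R * (w * (X * Y) + w ^+ 2 * (X * Z) + Y * Z)).
    by rewrite /X /Y /Z; ring: w2.
  by rewrite h1 h2 h3 !mulr0 !addr0 mulr0.
- transitivity (- ((P i1 * P i2 - 1 * P i0 ^+ 2) + (P i0 * P i2 - 1 * P i1 ^+ 2) + (P i0 * P i1 -
  1 * P i2 ^+ 2))).
    by rewrite /Y /Z; ring: w2.
  by rewrite h1 h2 h3 !addr0 oppr0.
- transitivity (- ((P i1 * P i2 - 1 * P i0 ^+ 2) + w ^+ 2 * (P i0 * P i2 - 1 * P i1 ^+ 2) + w *
  (P i0 * P i1 - 1 * P i2 ^+ 2))).
    by rewrite /X /Z; ring: w2.
  by rewrite h1 h2 h3 !mulr0 !addr0 oppr0.
- transitivity (- ((P i1 * P i2 - 1 * P i0 ^+ 2) + w * (P i0 * P i2 - 1 * P i1 ^+ 2) + w ^+ 2 *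
  (P i0 * P i1 - 1 * P i2 ^+ 2))).
    by rewrite /X /Y; ring: w2.
  by rewrite h1 h2 h3 !mulr0 !addr0 oppr0.
Qed.

Lemma triangle1_fourier P : triangle 1 (mulv (fourier w) P) <-> vertex P.
Proof.
rewrite /vertex /triangle; have [-> -> ->] := mulv_fourier P.
set X := P i0 + P i1 + P i2; set Y := P i0 + w * P i1 + _; set Z := P i0 + w ^+ 2 * P i1 + _.
split=> [[/sub0 h1 /sub0 h2 /sub0 h3]|[h1 h2 h3]]; split.
- apply: div9; transitivity (- ((Y * Z - 1 * X ^+ 2) + (X * Z - 1 * Y ^+ 2) + (X * Y - 1 * Z ^+
  2))).
    by rewrite /X /Y /Z; ring: w2.
  by rewrite h1 h2 h3 !addr0 oppr0.
- apply: div9; transitivity (- ((Y * Z - 1 * X ^+ 2) + w * (X * Z - 1 * Y ^+ 2) + w ^+ 2 * (X * Y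
  - 1 * Z ^+ 2))).
    by rewrite /X /Y /Z; ring: w2.
  by rewrite h1 h2 h3 !mulr0 !addr0 oppr0.
- apply: div9; transitivity (- ((Y * Z - 1 * X ^+ 2) + w ^+ 2 * (X * Z - 1 * Y ^+ 2) + w * (X * Y
  - 1 * Z ^+ 2))).
    by rewrite /X /Y /Z; ring: w2.
  by rewrite h1 h2 h3 !mulr0 !addr0 oppr0.
- apply: eqs0; transitivity (- 3%:R * (P i0 * P i1 + P i0 * P i2 + P i1 * P i2)).
    by rewrite /X /Y /Z; ring: w2.
  by rewrite h1 h2 h3 !addr0 mulr0.
- apply: eqs0; transitivity (- 3%:R * (w * (P i0 * P i1) + w ^+ 2 * (P i0 * P i2) + P i1 * P i2)).
    by rewrite /X /Y /Z; ring: w2.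
  by rewrite h1 h2 h3 !mulr0 !addr0 mulr0.
- apply: eqs0; transitivity (- 3%:R * (w ^+ 2 * (P i0 * P i1) + w * (P i0 * P i2) + P i1 * P i2)).
    by rewrite /X /Y /Z; ring: w2.
  by rewrite h1 h2 h3 !mulr0 !addr0 mulr0.
Qed.

Lemma trianglew_fourier P : triangle w (mulv (fourier w) P) <-> triangle (w ^+ 2) P.
Proof.
rewrite /triangle; have [-> -> ->] := mulv_fourier P.
set X := P i0 + P i1 + P i2; set Y := P i0 + w * P i1 + _; set Z := P i0 + w ^+ 2 * P i1 + _.
(* These are the two square roots of -3. *)
pose c := - (1 + 2%:R * w ^+ 2); pose c' := - (1 + 2%:R * w).
split=> [[/sub0 h1 /sub0 h2 /sub0 h3]|[/sub0 h1 /sub0 h2 /sub0 h3]]; split.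
- apply: div9; transitivity (c * ((Y * Z - w * X ^+ 2) + (X * Z - w * Y ^+ 2) + (X * Y - w * Z ^+
  2))).
    by rewrite /c /X /Y /Z; ring: w2.
  by rewrite h1 h2 h3 !addr0 mulr0.
- apply: div9; transitivity (c * ((Y * Z - w * X ^+ 2) + w * (X * Z - w * Y ^+ 2) + w ^+ 2 * (X *
  Y - w * Z ^+ 2))).
    by rewrite /c /X /Y /Z; ring: w2.
  by rewrite h1 h2 h3 !mulr0 !addr0 mulr0.
- apply: div9; transitivity (c * ((Y * Z - w * X ^+ 2) + w ^+ 2 * (X * Z - w * Y ^+ 2) + w * (X *
  Y - w * Z ^+ 2))).
    by rewrite /c /X /Y /Z; ring: w2.
  by rewrite h1 h2 h3 !mulr0 !addr0 mulr0.
- apply: eqs0; transitivity (c' * ((P i1 * P i2 - w ^+ 2 * P i0 ^+ 2) + (P i0 * P i2 - w ^+ 2 * P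
  i1 ^+ 2) + (P i0 * P i1 - w ^+ 2 * P i2 ^+ 2))).
    by rewrite /c' /X /Y /Z; ring: w2.
  by rewrite h1 h2 h3 !addr0 mulr0.
- apply: eqs0; transitivity (c' * ((P i1 * P i2 - w ^+ 2 * P i0 ^+ 2) + w ^+ 2 * (P i0 * P i2 - w
  ^+ 2 * P i1 ^+ 2) + w * (P i0 * P i1 - w ^+ 2 * P i2 ^+ 2))).
    by rewrite /c' /X /Y /Z; ring: w2.
  by rewrite h1 h2 h3 !mulr0 !addr0 mulr0.
- apply: eqs0; transitivity (c' * ((P i1 * P i2 - w ^+ 2 * P i0 ^+ 2) + w * (P i0 * P i2 - w ^+ 2
  * P i1 ^+ 2) + w ^+ 2 * (P i0 * P i1 - w ^+ 2 * P i2 ^+ 2))).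
    by rewrite /c' /X /Y /Z; ring: w2.
  by rewrite h1 h2 h3 !mulr0 !addr0 mulr0.
Qed.

Lemma trianglew2_fourier P : triangle (w ^+ 2) (mulv (fourier w) P) <-> triangle w P.
Proof.
rewrite /triangle; have [-> -> ->] := mulv_fourier P.
set X := P i0 + P i1 + P i2; set Y := P i0 + w * P i1 + _; set Z := P i0 + w ^+ 2 * P i1 + _.
pose c := - (1 + 2%:R * w ^+ 2); pose c' := - (1 + 2%:R * w).
split=> [[/sub0 h1 /sub0 h2 /sub0 h3]|[/sub0 h1 /sub0 h2 /sub0 h3]]; split.
- apply: div9; transitivity (c' * ((Y * Z - w ^+ 2 * X ^+ 2) + (X * Z - w ^+ 2 * Y ^+ 2) + (X * Y
  - w ^+ 2 * Z ^+ 2))).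
    by rewrite /c' /X /Y /Z; ring: w2.
  by rewrite h1 h2 h3 !addr0 mulr0.
- apply: div9; transitivity (c' * ((Y * Z - w ^+ 2 * X ^+ 2) + w * (X * Z - w ^+ 2 * Y ^+ 2) + w
  ^+ 2 * (X * Y - w ^+ 2 * Z ^+ 2))).
    by rewrite /c' /X /Y /Z; ring: w2.
  by rewrite h1 h2 h3 !mulr0 !addr0 mulr0.
- apply: div9; transitivity (c' * ((Y * Z - w ^+ 2 * X ^+ 2) + w ^+ 2 * (X * Z - w ^+ 2 * Y ^+ 2)
  + w * (X * Y - w ^+ 2 * Z ^+ 2))).
    by rewrite /c' /X /Y /Z; ring: w2.
  by rewrite h1 h2 h3 !mulr0 !addr0 mulr0.
- apply: eqs0; transitivity (c * ((P i1 * P i2 - w * P i0 ^+ 2) + (P i0 * P i2 - w * P i1 ^+ 2) +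
  (P i0 * P i1 - w * P i2 ^+ 2))).
    by rewrite /c /X /Y /Z; ring: w2.
  by rewrite h1 h2 h3 !addr0 mulr0.
- apply: eqs0; transitivity (c * ((P i1 * P i2 - w * P i0 ^+ 2) + w ^+ 2 * (P i0 * P i2 - w * P
  i1 ^+ 2) + w * (P i0 * P i1 - w * P i2 ^+ 2))).
    by rewrite /c /X /Y /Z; ring: w2.
  by rewrite h1 h2 h3 !mulr0 !addr0 mulr0.
- apply: eqs0; transitivity (c * ((P i1 * P i2 - w * P i0 ^+ 2) + w * (P i0 * P i2 - w * P i1 ^+
  2) + w ^+ 2 * (P i0 * P i1 - w * P i2 ^+ 2))).
    by rewrite /c /X /Y /Z; ring: w2.
  by rewrite h1 h2 h3 !mulr0 !addr0 mulr0.
Qed.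

Lemma smooth_linE A F Q : A \in unitmx -> smooth (pull (lin A) F) Q -> smooth F (mulv A Q).
Proof.
by move=> uA /smooth_Ord[m m1] /(Ord_linE uA); apply: Ord_smooth.
Qed.

Lemma Good_diag s t a b c e : Good w s (w * t) a c e b -> Good w s t a b c e.
Proof.
have uA := diag_w_unit w2; have W3 := w3 w2.
apply: (Good_lin uA (oner_neq0 _) (diag_w_form w2 s t)); first by rewrite -!addnA (addnC b) !addnA.
move=> F P [h1 h2 h3 h4 h5].
have e1 : triangle 1 (mulv (diag_w w) P) <-> triangle (w ^+ 2) P by rewrite triangle_diag mulr1.
have e2 : triangle w (mulv (diag_w w) P) <-> triangle 1 P by rewrite triangle_diag -exprSr W3.
have e3 : triangle (w ^+ 2) (mulv (diag_w w) P) <-> triangle w P.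
  by rewrite triangle_diag -exprD exprSr W3 mul1r.
split.
- by move/vertex_diag/h1; apply: Ord_linE.
- by move/e1/h4; apply: Ord_linE.
- by move/e2/h2; apply: Ord_linE.
- by move/e3/h3; apply: Ord_linE.
- move=> ns; apply: (smooth_linE uA); apply: h5 => -[/vertex_diag|[/e2|/e3|/e1]] ?; apply: ns.
  + by left.
  + by right; apply: Or32.
  + by right; apply: Or33.
  + by right; apply: Or31.
Qed.

Lemma Good_fourier s t a b c e :
  Good w (s + 2%:R * t) (s - t) b a e c -> Good w s t a b c e.
Proof.
have uA := fourier_unit w2 three_neq0.
have mu0 : - 9%:R * (1 + 2%:R * w) != 0.
  rewrite mulf_neq0 ?oppr_eq0 //.
  apply: contraNneq three_neq0 => e0.
  have -> : 3%:R = - (1 + 2%:R * w) * (1 + 2%:R * w) by ring: w2.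
  by rewrite e0 mulr0.
apply: (Good_lin uA mu0 (fourier_form w2 s t)); first by rewrite (addnC b) addnAC.
move=> F P [h1 h2 h3 h4 h5]; split.
- by move/vertex_fourier/h2; apply: Ord_linE.
- by move/triangle1_fourier/h1; apply: Ord_linE.
- by move/trianglew_fourier/h4; apply: Ord_linE.
- by move/trianglew2_fourier/h3; apply: Ord_linE.
- move=> ns; apply: (smooth_linE uA).
  apply: h5 => -[/triangle1_fourier|[/vertex_fourier|/trianglew2_fourier|/trianglew_fourier]] ?;
    apply: ns.
  + by right; apply: Or31.
  + by left.
  + by right; apply: Or33.
  + by right; apply: Or32.
Qed.

End Symmetries.

(** * Leading forms of invariant curves *)

Lemma coef_affineM (R : comNzRingType) (a b : R) (p : {poly R}) k :
  ((a%:P + 'X * b%:P) * p)`_k = a * p`_k + b * (if k == 0%N then 0 else p`_k.-1).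
Proof.
rewrite mulrDl coefD coefCM -mulrA coefXM coefCM.
by case: k => //=; rewrite mulr0.
Qed.

(** The coefficients of dx and dz in [form4] vanish to first order at (0 : 1 : 0); up to sign and
    names of variables, [p] is their expansion there divided by ['X]. *)
Lemma coef_form_expansion (R : comNzRingType) (a b x y z : R) :
  let p := (('X * x%:P) ^+ 3 - (1 + 'X * y%:P) ^+ 3) *
    (a%:P * (x%:P * (1 + 'X * y%:P)) - b%:P * ('X * z%:P ^+ 2)) in
  p`_0 = - (a * x) /\ p`_1 = b * z ^+ 2 - (a * x * y) *+ 4.
Proof.
set c := a%:P * x%:P * y%:P - b%:P * z%:P ^+ 2.
set q := - 3%:R * y%:P ^+ 2 * (a%:P * x%:P) - 3%:R * y%:P * c
  + 'X * ((x%:P ^+ 3 - y%:P ^+ 3) * (a%:P * x%:P) - 3%:R * y%:P ^+ 2 * c)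
  + 'X ^+ 2 * ((x%:P ^+ 3 - y%:P ^+ 3) * c).
move=> p.
have -> : p = (- (a * x))%:P + 'X * ((b * z ^+ 2 - (a * x * y) *+ 4)%:P + 'X * q).
  rewrite !(polyCN, polyCB, polyCMn, polyCM, polyC_exp) /p /q /c; ring.
by split; rewrite coefD coefC coefXM /= ?addr0 // add0r coefD coefC coefXM addr0.
Qed.

Section LeadingForm.
Variable K : fieldType.
Implicit Types (F G : {mpoly K[3]}) (P Q v : 'I_3 -> K).

Lemma mul_mderivX (i : 'I_3) m : 'X_i * ('X_[m])^`M(i) = (m i)%:R *: 'X_[m] :> {mpoly K[3]}.
Proof.
rewrite mderivX -scalerAr -mpolyXD.
have [->|mi] := eqVneq (m i) 0%N; first by rewrite !scale0r.
by rewrite addmC submK ?lep1mP.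
Qed.

Lemma euler F d : F \is d.-homog -> \sum_i 'X_i * F^`M(i) = d%:R *: F.
Proof.
move=> /dhomogP hF; rewrite {1 2}[F]mpolyE.
rewrite (eq_bigr (fun i => \sum_(m <- msupp F) F@_m *: ('X_i * ('X_[m])^`M(i)))) => [|i _].
  rewrite exchange_big /= scaler_sumr !big_seq; apply: eq_bigr => m /hF /= <-.
  rewrite (eq_bigr (fun i => F@_m *: ((m i)%:R *: 'X_[m]))) => [|i _]; last by rewrite mul_mderivX.
  by rewrite -scaler_sumr -scaler_suml -natr_sum -mdegE !scalerA mulrC.
rewrite (raddf_sum (mderiv i)) mulr_sumr; apply: eq_bigr => m _.
by rewrite /= mderivZ scalerAr.
Qed.

Lemma euler_eval F d v : F \is d.-homog -> \sum_i v i * F^`M(i).@[v] = d%:R * F.@[v].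
Proof.
move=> /euler/(congr1 (meval v)); rewrite mevalZ (raddf_sum (meval v)) => <-.
by apply: eq_bigr => i _; rewrite /= mevalM mevalXU.
Qed.

Lemma homog_tay F Q k : (tay F Q)`_k \is k.-homog.
Proof.
elim/mpoly_ring_ind: F k => [c|i|p q IHp IHq|p q IHp IHq] k.
- rewrite tayC coefC; case: k => [|k] /=; last exact: dhomog0.
  by rewrite -[c%:MP]mulr1 mul_mpolyC; apply/rpredZ/dhomog1.
- rewrite tayX coefD coefC coefXM coefC; case: k => [|[|k]] /=.
  + by rewrite addr0 -[_%:MP]mulr1 mul_mpolyC; apply/rpredZ/dhomog1.
  + by rewrite add0r dhomogX /= mdeg1.
  + by rewrite addr0; apply: dhomog0.
- by rewrite tayD coefD; apply: rpredD.
- rewrite tayM coefM; apply: rpred_sum => j _.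
  by have := dhomogM (IHp j) (IHq (k - j)%N); rewrite subnKC // -ltnS.
Qed.

(* At Q the leading form is a form on K^3 / K Q. *)
Lemma lead_form_dir F Q d m : F \is d.-homog ->
    (forall k, (k < m)%N -> (tay F Q)`_k = 0) ->
  \sum_i (Q i)%:MP * ((tay F Q)`_m)^`M(i) = 0.
Proof.
move=> hF lt_m; case: m lt_m => [|m] lt_m.
  by rewrite big1 // => i _; rewrite tay0 mderivC mulr0.
have := congr1 (fun G => (tay G Q)`_m) (euler hF).
rewrite -mul_mpolyC tayM tayC coefCM lt_m // mulr0 => e.
apply: etrans e.
have -> : tay (\sum_i 'X_i * F^`M(i)) Q = \sum_i tay ('X_i * F^`M(i)) Q.
  by rewrite !sum3 !tayD.
rewrite coef_sum; apply: eq_bigr => i _.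
rewrite tayM tayX coef_affineM -deriv_tay.
case: m lt_m => [|m] lt_m /=; first by rewrite mulr0 addr0.
by rewrite -deriv_tay lt_m // mderiv0 mulr0 addr0.
Qed.

End LeadingForm.

(** * Contact of an invariant curve with a side at a vertex *)

Section LineOrder.
Variables (K : fieldType) (s t : K).
Implicit Types (F G : {mpoly K[3]}) (P Q v : 'I_3 -> K).
Hypothesis s0 : s != 0.

(* A branch at (0 : 1 : 0) tangent to the line x = 0 has a simple contact with
   it: this follows from the next order term of the invariance equation. *)
Lemma line_order1 F d m : F \is d.-homog ->
    invariant_curve (form4 s t) F -> Ord F (vec3 0 1 0) m ->
  let u : 'I_3 -> K := vec3 0 0 1 in
  ((tay F (vec3 0 1 0))`_m).@[u] = 0 -> ((tay F (vec3 0 1 0))`_m.+1).@[u] != 0.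
Proof.
set Q := vec3 0 1 0 => hF invF [lt_m sz] u.
have T0 := simple_zeros_neq0 sz.
case: m lt_m sz T0 => [|n] lt_m sz T0.
  by rewrite tay0 mevalC => e; move: T0; rewrite tay0 e mpolyC0 eqxx.
set T := (tay F Q)`_n.+1 in sz T0 *; set T' := (tay F Q)`_n.+2 => Tu.
have hT : T \is (n.+1).-homog by apply: homog_tay.
have hT' : T' \is (n.+2).-homog by apply: homog_tay.
have d1T : T^`M(i1) = 0.
  have := lead_form_dir hF lt_m; rewrite sum3 /Q !vec3E mpolyC0 mpolyC1.
  by rewrite !mul0r add0r addr0 mul1r.
have d2 (p : {mpoly K[3]}) k : p \is k.-homog -> p^`M(i2).@[u] = k%:R * p.@[u].
  move/(euler_eval u) => <-; rewrite sum3 /u !vec3E; ring.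
pose X i : {poly {mpoly K[3]}} := ('X_i)%:P.
pose cst (c : K) : {poly {mpoly K[3]}} := (c%:MP)%:P.
have tX0 : tay 'X_i0 Q = 'X * X i0.
  rewrite tayX /Q vec3E mpolyC0 polyC0 add0r; exact: erefl.
have tX1 : tay 'X_i1 Q = 1 + 'X * X i1.
  rewrite tayX /Q vec3E mpolyC1 polyC1; exact: erefl.
have tX2 : tay 'X_i2 Q = 'X * X i2.
  rewrite tayX /Q vec3E mpolyC0 polyC0 add0r; exact: erefl.
have tB A B : tay (A - B) Q = tay A Q - tay B Q by rewrite !tayE raddfB.
have tP A k : tay (A ^+ k) Q = tay A Q ^+ k by rewrite !tayE rmorphXn.
pose A := (('X * X i0) ^+ 3 - (1 + 'X * X i1) ^+ 3) *
  (cst t * (X i0 * (1 + 'X * X i1)) - cst s * ('X * X i2 ^+ 2)).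
pose B := ((1 + 'X * X i1) ^+ 3 - ('X * X i2) ^+ 3) *
  (cst t * ((1 + 'X * X i1) * X i2) - cst s * ('X * X i0 ^+ 2)).
have tA : tay (form4 s t i2) Q = 'X * A.
  by rewrite /form4 vec3E tayM !tB !tayM tX0 tX1 tX2 !tayC /A /cst; ring.
have tBB : tay (form4 s t i0) Q = 'X * B.
  by rewrite /form4 vec3E tayM !tB !tayM tX0 tX1 tX2 !tayC /B /cst; ring.
have [G eG] := invF i0 i2.
have {}eG : 'X * (tay F^`M(i0) Q * A - tay F^`M(i2) Q * B) = tay G Q * tay F Q.
  rewrite -[in RHS]tayM -eG tB (tayM F^`M(i0)) (tayM F^`M(i2)) tA tBB; ring.
have [A0 A1] : A`_0 = - (t%:MP * 'X_i0) /\ (A`_1).@[u] = s.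
  have [e0 e1] := coef_form_expansion t%:MP_[3] s%:MP_[3] 'X_i0 'X_i1 'X_i2.
  split; first exact: e0.
  have -> : A`_1 = _ := e1.
  by rewrite mevalB mevalMn !mevalM !mevalXU !mevalC /u !vec3E; ring.
have [B0 B1] : B`_0 = t%:MP * 'X_i2 /\ (B`_1).@[u] = 0.
  have -> : B = - ((('X * X i2) ^+ 3 - (1 + 'X * X i1) ^+ 3) *
      (cst t * (X i2 * (1 + 'X * X i1)) - cst s * ('X * X i0 ^+ 2))) by rewrite /B; ring.
  have [e0 e1] := coef_form_expansion t%:MP_[3] s%:MP_[3] 'X_i2 'X_i1 'X_i0.
  rewrite !coefN /X /cst; split; first by rewrite e0 opprK.
  by rewrite e1 mevalN mevalB mevalMn !mevalM !mevalXU !mevalC /u !vec3E; ring.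
clearbody A B.
have dlt i k : (k < n)%N -> (tay F^`M(i) Q)`_k = 0.
  by move=> kn; rewrite -deriv_tay lt_m ?mderiv0.
have low (p q : {poly {mpoly K[3]}}) k : (forall j, (j < k)%N -> p`_j = 0) ->
    (p * q)`_k = p`_k * q`_0 /\ (p * q)`_k.+1 = p`_k * q`_1 + p`_k.+1 * q`_0.
  move=> h; split.
    rewrite coefM big_ord_recr /= subnn big1 ?add0r // => i _.
    by rewrite h // mul0r.
  rewrite coefM !big_ord_recr /= subnn subSnn big1 ?add0r // => i _.
  by rewrite h // mul0r.
have [l0 l1] := low _ A _ (dlt i0); have [m0 m1] := low _ B _ (dlt i2).
have [r0 r1] := low _ (tay G Q) _ lt_m.
rewrite (mulrC (tay G Q)) in eG.
move: r0 r1; rewrite -/T -/T' => r0 r1.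
have eT i : (tay F^`M(i) Q)`_n = T^`M(i) by rewrite -deriv_tay.
have eT' i : (tay F^`M(i) Q)`_n.+1 = T'^`M(i) by rewrite -deriv_tay.
have c0 : T^`M(i0) * A`_0 - T^`M(i2) * B`_0 = T * (tay G Q)`_0.
  have := congr1 (fun p : {poly {mpoly K[3]}} => p`_n.+1) eG.
  rewrite r0.
  rewrite coefXM.
  rewrite [X in X -> _]/=.
  by rewrite coefB l0 m0 !eT.
(* At the lowest order, Euler's relation for T determines the constant term of the cofactor [G]. *)
have G0 : (tay G Q)`_0 = - (n.+1%:R * t)%:MP.
  apply: (mulfI T0); rewrite -c0 A0 B0.
  have := euler hT; rewrite sum3 d1T mulr0 addr0 -mul_mpolyC => e.
  transitivity (- t%:MP * ('X_i0 * T^`M(i0) + 'X_i2 * T^`M(i2))); first by ring.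
  by rewrite e mpolyCM; ring.
have c1 : T^`M(i0) * A`_1 + T'^`M(i0) * A`_0 - (T^`M(i2) * B`_1 + T'^`M(i2) * B`_0)
    = T * (tay G Q)`_1 + T' * (tay G Q)`_0.
  have := congr1 (fun p : {poly {mpoly K[3]}} => p`_n.+2) eG.
  rewrite r1 coefXM [X in X -> _]/=.
  by rewrite coefB l1 m1 !eT !eT'.
(* At [u] the next order reads s T_x(u) = t T'(u): Euler's relation for T' contributes (n + 2) t
   T'(u), the cofactor (n + 1) t T'(u). If T'(u) vanished, [u] would be a singular zero of T that is
   not proportional to [Q]. *)
have := congr1 (meval u) c1.
rewrite G0 A0 B0 !(mevalB, mevalD, mevalM, mevalN, mevalC, mevalXU) A1 B1 (d2 _ _ hT') Tu.
rewrite /u !vec3E => e; apply/eqP => T'u.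
have dT0 : T^`M(i0).@[u] = 0.
  by apply: (mulIf s0); rewrite mul0r; move: e; rewrite T'u !(mulr0, mul0r, addr0, subr0, oppr0).
have [|i|c hc] := sz u; first exact: Tu.
  by case: (ord3P i) => ->; rewrite ?dT0 ?d1T ?meval0 // (d2 _ _ hT) Tu mulr0.
by have /eqP := hc i2; rewrite /u /Q !vec3E mulr0 oner_eq0.
Qed.

End LineOrder.

(** * The quadratic transformation *)

Lemma prod3 (R : comNzRingType) (F : 'I_3 -> R) : \prod_i F i = F i0 * F i1 * F i2.
Proof.
rewrite !big_ord_recl big_ord0 mulr1 mulrA.
by congr (F _ * F _ * F _); apply: val_inj.
Qed.

(** * Permutations of the coordinates *)

Section Permutations.
Variable K : fieldType.
Implicit Types (F G : {mpoly K[3]}) (P Q v : 'I_3 -> K).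

Definition permM (p : 'I_3 -> 'I_3) : 'M[K]_3 := \matrix_(i, j) (j == p i)%:R.

Lemma permM_unit p p' : cancel p p' -> permM p \in unitmx.
Proof.
move=> pK; have := @mulmx1_unit _ _ (permM p) (permM p'); case=> //.
apply/matrixP => i j; rewrite !mxE (bigD1 (p i)) //= !mxE eqxx mul1r pK eq_sym.
by rewrite big1 ?addr0 // => k /negPf kp; rewrite !mxE kp mul0r.
Qed.

Lemma lin_permM p i : lin (permM p) i = 'X_(p i).
Proof.
rewrite /lin (bigD1 (p i)) //= mxE eqxx mul1r big1 ?addr0 // => k /negPf kp.
by rewrite mxE kp mul0r.
Qed.

Lemma mulv_permM p v i : mulv (permM p) v i = v (p i).
Proof.
rewrite /mulv (bigD1 (p i)) //= mxE eqxx mul1r big1 ?addr0 // => k /negPf kp.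
by rewrite mxE kp mul0r.
Qed.

Definition cyc : 'I_3 -> 'I_3 := vec3 i1 i2 i0.
Definition cycV : 'I_3 -> 'I_3 := vec3 i2 i0 i1.
Definition swap : 'I_3 -> 'I_3 := vec3 i0 i2 i1.

Lemma cycK : cancel cyc cycV.
Proof. by move=> i; case: (ord3P i) => ->. Qed.

Lemma cycVK : cancel cycV cyc.
Proof. by move=> i; case: (ord3P i) => ->. Qed.

Lemma swapK : cancel swap swap.
Proof. by move=> i; case: (ord3P i) => ->. Qed.

Lemma cyc_form s t k :
  \sum_i pull (lin (permM cyc)) (form4 s t i) * (lin (permM cyc) i)^`M(k)
    = 1%:MP * form4 s t k.
Proof.
rewrite sum3 !lin_permM !mderivXi /form4 !vec3E !(pullXn, pullB, pullM) !pullX !pullC.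
rewrite !lin_permM /cyc !vec3E.
by case: (ord3P k) => ->; rewrite !vec3E mpolyC1 /=; ring.
Qed.

Lemma swap_form s t k :
  \sum_i pull (lin (permM swap)) (form4 s t i) * (lin (permM swap) i)^`M(k)
    = (- 1)%:MP * form4 s t k.
Proof.
rewrite sum3 !lin_permM !mderivXi /form4 !vec3E !(pullXn, pullB, pullM) !pullX !pullC.
rewrite !lin_permM /swap !vec3E mpolyCN mpolyC1.
by case: (ord3P k) => ->; rewrite !vec3E /=; ring.
Qed.

Lemma sigma_cyc F : pull (@sigma K) (pull (lin (permM cyc)) F) =
  pull (lin (permM cyc)) (pull (@sigma K) F).
Proof.
rewrite !pull_comp; apply: eq_pull => i; rewrite lin_permM pullX.
by case: (ord3P i) => ->; rewrite /sigma /cyc !vec3E pullM !pullX !lin_permM /cyc !vec3E // mulrC.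
Qed.

Lemma undiv_cyc F : undiv F -> undiv (pull (lin (permM cyc)) F).
Proof.
move=> uF i; have e : pull (kill K i) (pull (lin (permM cyc)) F) =
    pull (lin (permM cyc)) (pull (kill K (cycV i)) F).
  rewrite !pull_comp; apply: eq_pull => j; rewrite lin_permM pullX /kill.
  rewrite (can2_eq cycK cycVK); case: eqP => [_|_]; first by rewrite rmorph0.
  by rewrite pullX lin_permM.
by rewrite e pull_lin_eq0 // (permM_unit cycK).
Qed.

Lemma pull_cycX m : exists2 m', pull (lin (permM cyc)) 'X_[m] = 'X_[m'] :> {mpoly K[3]} &
  forall i, m' i = m (cycV i).
Proof.
exists [multinom m (cycV i) | i < 3] => [|i]; last by rewrite mnmE.
rewrite !mpolyXE_id !prod3 !pullM !pullXn !pullX !lin_permM !mnmE /cyc /cycV !vec3E.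
ring.
Qed.

End Permutations.

Lemma coef_div_lt (R : idomainType) (A B : {poly R}) m : A`_0 != 0 ->
    (forall k, (k < m)%N -> (A * B)`_k = 0) ->
  (forall k, (k < m)%N -> B`_k = 0) /\ (A * B)`_m = A`_0 * B`_m.
Proof.
move=> A0 lt_m.
have lt_B k : (k < m)%N -> B`_k = 0.
  have [n] := ubnP k; elim: n k => // n IHn k kn km.
  have := lt_m k km; rewrite coefM big_ord_recl subn0 big1 => [|i _].
    by rewrite addr0 => /eqP; rewrite mulf_eq0 (negPf A0) /= => /eqP.
  have h : (k - lift ord0 i < k)%N.
    by rewrite ltn_subrL /= (leq_ltn_trans (leq0n i)).
  by rewrite IHn ?mulr0 //; [exact: leq_trans h kn|exact: ltn_trans h km].
split=> //; rewrite coefM big_ord_recl subn0 big1 ?addr0 // => i _.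
by rewrite lt_B ?mulr0 // ltn_subrL /= (leq_ltn_trans (leq0n i)).
Qed.

Section Slices.
Variable K : fieldType.
Implicit Types (F G : {mpoly K[3]}) (P Q v : 'I_3 -> K).

Definition vtx0 : 'I_3 -> K := vec3 1 0 0.

(** A form of degree d is the sum of the x^(d-k) F_k(y, z), where F_k is its k-th Taylor coefficient
    at (1 : 0 : 0). *)
Lemma slice (S : comNzRingType) (f : {rmorphism K -> S}) d F c e y z :
    F \is d.-homog ->
  mmap f (vec3 c (e * y) (e * z)) F =
  \sum_(k < d.+1) c ^+ (d - k) * e ^+ k * mmap f (vec3 0 y z) (tay F vtx0)`_k.
Proof.
move=> /dhomogP hF.
have mono k : mmap f (vec3 0 y z) (tay F vtx0)`_k =
    \sum_(m <- msupp F) f F@_m * (y ^+ m i1 * z ^+ m i2) *+ (k == m i1 + m i2)%N.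
  rewrite -coef_line /mmap coef_sum; apply: eq_bigr => m _.
  rewrite /mmap1 prod3 /vtx0 !vec3E rmorph1 rmorph0 polyC0 polyC1 mulr0 addr0 !add0r expr1n mul1r.
  rewrite !exprMn -!polyC_exp /= coefCM.
  have -> : 'X ^+ m i1 * (y ^+ m i1)%:P * ('X ^+ m i2 * (z ^+ m i2)%:P) =
    (y ^+ m i1 * z ^+ m i2)%:P * 'X^(m i1 + m i2) by rewrite polyCM exprD; ring.
  by rewrite coefCM coefXn -mulrnAr mulr_natr.
rewrite (eq_bigr (fun k : 'I_d.+1 => \sum_(m <- msupp F)
    c ^+ (d - k) * e ^+ k * (f F@_m * (y ^+ m i1 * z ^+ m i2) *+ (val k == m i1 + m i2)%N)));
      last first.
  by move=> k _; rewrite mono mulr_sumr.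
rewrite exchange_big /= /mmap !big_seq; apply: eq_bigr => m /hF /=.
rewrite mdegE sum3 => dmR; have dm : (m i0 + m i1 + m i2 = d)%N := dmR.
have kd : (m i1 + m i2 < d.+1)%N by rewrite ltnS -dm -addnA leq_addl.
rewrite (bigD1 (Ordinal kd)) //= eqxx big1 ?addr0 => [|k kn].
  have -> : (d - (m i1 + m i2) = m i0)%N by rewrite -dm -addnA addnK.
  rewrite /mmap1 prod3 !vec3E !exprMn exprD mulrb; ring.
by rewrite -val_eqE in kn; rewrite (negPf kn) mulr0n mulr0.
Qed.

End Slices.

Lemma sum_mulrn_eq (V : nmodType) (X : nat -> V) d (k : nat) :
  \sum_(j < d.+1) X j *+ (k == j :> nat) = X k *+ (k <= d)%N.
Proof.
have [kd|dk] := leqP k d.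
  rewrite (bigD1 (Ordinal (kd : (k < d.+1)%N))) //= big1 ?addr0 => [|j jk].
    by rewrite eqxx.
  by have /negPf-> : k != j by apply: contra jk => /eqP e; apply/eqP/val_inj.
by rewrite big1 // => j _; rewrite gtn_eqF // (leq_trans (ltn_ord j)).
Qed.

(** * Multiplicities at the vertices and restrictions to the sides *)

Section Restriction.
Variable K : fieldType.
Hypothesis char0 : forall n, n.+1%:R != 0 :> K.
Implicit Types (F G : {mpoly K[3]}) (P Q v : 'I_3 -> K).

Lemma kill_mderiv i F : F^`M(i) = 0 -> pull (kill K i) F = F.
Proof.
move=> dF; apply: esym; rewrite {2}[F]mpolyE (raddf_sum (pull (kill K i))) {1}[F]mpolyE.
rewrite !big_seq; apply: eq_bigr => m mF.
rewrite /= pullZ; congr (_ *: _); have mi : m i = 0%N.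
  apply/eqP; apply: contraTT mF => mi; have [m' def_m _] := mnm_split mi.
  have := congr1 (mcoeff m') dF; rewrite mcoeff_deriv mcoeff0 addmC -def_m => /eqP.
  by rewrite -mulr_natr mulf_eq0 (negPf (char0 _)) orbF mcoeff_eq0.
rewrite pullE mmapX mpolyXE_id; apply: eq_bigr => j _; rewrite /kill.
by case: eqP => // ->; rewrite mi !expr0.
Qed.

Definition face : 'I_3 -> {mpoly K[3]} := vec3 0 'X_i1 'X_i2.
Definition flip : 'I_3 -> {mpoly K[3]} := vec3 0 'X_i2 'X_i1.

Lemma kill_face F : pull (kill K i0) F = pull face F.
Proof. by apply: eq_pull => i; case: (ord3P i) => ->; rewrite /face vec3E. Qed.

Lemma flipK F : pull flip (pull flip F) = pull face F.
Proof.
rewrite pull_comp; apply: eq_pull => i.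
by case: (ord3P i) => ->; rewrite /flip /face !vec3E ?rmorph0 // pullX !vec3E.
Qed.

Variables (d : nat) (m : 'X_{1..3}) (F' F : {mpoly K[3]}).
Hypothesis hF' : F' \is d.-homog.
Hypothesis sF' : pull (@sigma K) F' = 'X_[m] * F.

Let f : {rmorphism K -> {poly {mpoly K[3]}}} := polyC \o @mpolyC 3 K.

(** Both sides are the coefficient of ['X^k] in F'(yz, 'X z, 'X y), expanded by [slice] on the left.
    For k > d it is zero although the truncated exponent d - k does not show it, hence the boolean
    factor. *)
Lemma restriction k :
  ((k <= d)%N)%:R * (('X_i1 * 'X_i2) ^+ (d - k) * pull flip (tay F' (vtx0 K))`_k) =
  ('X^(m i0) * (('X_i1 ^+ m i1 * 'X_i2 ^+ m i2)%:P *
     mmap f (vec3 'X ('X_i1)%:P ('X_i2)%:P) F))`_k.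
Proof.
pose c : {poly {mpoly K[3]}} := ('X_i1 * 'X_i2)%:P.
have e1 : mmap f (vec3 'X ('X_i1)%:P ('X_i2)%:P) (pull (@sigma K) F') =
    mmap f (vec3 c ('X * ('X_i2)%:P) ('X * ('X_i1)%:P)) F'.
  rewrite mmap_pull; apply: mmap_eq => [//|i].
  case: (ord3P i) => ->; rewrite /sigma !vec3E rmorphM /= !mmapX !mmap1U !vec3E //.
  by rewrite /c polyCM.
have e2 : mmap f (vec3 'X ('X_i1)%:P ('X_i2)%:P) 'X_[m] =
    'X^(m i0) * ('X_i1 ^+ m i1 * 'X_i2 ^+ m i2)%:P.
  by rewrite mmapX /mmap1 prod3 !vec3E polyCM !polyC_exp mulrA.
rewrite [in RHS]mulrA -e2 -rmorphM /= -sF' e1 (slice _ _ _ _ _ hF') coef_sum.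
have gk j : mmap f (vec3 0 ('X_i2)%:P ('X_i1)%:P) (tay F' (vtx0 K))`_j =
    (pull flip (tay F' (vtx0 K))`_j)%:P.
  rewrite pullE rmorph_mmap; apply: mmap_eq => [//|i].
  by case: (ord3P i) => ->; rewrite /flip /= !vec3E ?polyC0.
have ck j : (c ^+ (d - j) * 'X ^+ j * mmap f (vec3 0 ('X_i2)%:P ('X_i1)%:P) (tay F' (vtx0
  K))`_j)`_k =
    (('X_i1 * 'X_i2) ^+ (d - j) * pull flip (tay F' (vtx0 K))`_j) *+ (k == j).
  rewrite gk -polyC_exp mulrAC -polyCM coefCM coefXn mulr_natr //.
rewrite (eq_bigr (fun j : 'I_d.+1 => (('X_i1 * 'X_i2) ^+ (d - j) *
  pull flip (tay F' (vtx0 K))`_j) *+ (k == j :> nat)) (fun j _ => ck j)).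
rewrite (sum_mulrn_eq (fun j => ('X_i1 * 'X_i2) ^+ (d - j) * pull flip (tay F' (vtx0 K))`_j)).
exact: mulr_natl.
Qed.

Lemma coef0_restriction (p := mmap f (vec3 'X ('X_i1)%:P ('X_i2)%:P) F) :
  p`_0 = pull face F.
Proof.
rewrite /p (coef0_mmap (@mpolyC 3 K)) pullE; apply: mmap_eq => [//|i].
by case: (ord3P i) => ->; rewrite /face !vec3E ?coefX ?coefC.
Qed.

Variable a' : nat.
Hypothesis oF' : Ord F' (vtx0 K) a'.
Hypothesis uF : undiv F.

Let T := (tay F' (vtx0 K))`_a'.

Lemma lead_face : pull face T = T.
Proof.
rewrite -kill_face kill_mderiv //; case: oF' => lt_a' _.
by have := lead_form_dir hF' lt_a'; rewrite sum3 /vtx0 !vec3E mpolyC0 mpolyC1 mul1r !mul0r !addr0.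
Qed.

Lemma flip_lead_neq0 : pull flip T != 0.
Proof.
have [_ /simple_zeros_neq0] := oF'; apply: contraNneq => h.
by rewrite -/T -lead_face -flipK h rmorph0.
Qed.

(** The lowest coefficient in x of F'(yz, xz, xy) comes from the leading form of [F'] at (1 : 0 :
    0), while [F] is not divisible by x. *)
Lemma sigma_mult : m i0 = a'.
Proof.
have [lt_a' _] := oF'; have uF0 : pull face F != 0 by rewrite -kill_face uF.
have X12 i j : 'X_i1 ^+ i * 'X_i2 ^+ j != 0 :> {mpoly K[3]} by rewrite mulf_neq0 // expf_neq0 //
  mpolyX_neq0.
have cm : ('X^(m i0) * (('X_i1 ^+ m i1 * 'X_i2 ^+ m i2)%:P *
     mmap f (vec3 'X ('X_i1)%:P ('X_i2)%:P) F))`_(m i0) != 0.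
  by rewrite coefXnM ltnn subnn coefCM coef0_restriction mulf_neq0.
apply/eqP; rewrite eqn_leq; apply/andP; split; rewrite leqNgt; apply/negP => h.
  have := restriction a'; rewrite coefXnM h => /eqP.
  rewrite !mulf_eq0 (negPf flip_lead_neq0) orbF expf_eq0 mulf_eq0 !(negPf (mpolyX_neq0 _ _))
    andbF orbF.
  move=> /eqP da; move: cm; rewrite -restriction.
  have -> : (m i0 <= d)%N = false; last by rewrite mul0r eqxx.
  apply/negP => md; move: da; rewrite (leq_trans (ltnW h) md) => /eqP.
  by rewrite oner_eq0.
by move: cm; rewrite -restriction lt_a' // rmorph0 !mulr0 eqxx.
Qed.

Lemma restriction_lead : (a' <= d)%N ->
  ('X_i1 * 'X_i2) ^+ (d - a') * pull flip T = 'X_i1 ^+ m i1 * 'X_i2 ^+ m i2 * pull face F.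
Proof.
move=> ad; have := restriction a'; rewrite ad mul1r => ->.
by rewrite -sigma_mult coefXnM ltnn subnn coefCM coef0_restriction.
Qed.

End Restriction.

Lemma coef0_affine (R : nzRingType) (a : R) (p : {poly R}) : (a%:P + 'X * p)`_0 = a.
Proof. by rewrite coefD coefC coefXM addr0. Qed.

Section SigmaVertex.
Variable K : fieldType.
Hypothesis char0 : forall n, n.+1%:R != 0 :> K.
Implicit Types (F G : {mpoly K[3]}) (P Q v : 'I_3 -> K).

Variables (s t : K) (d a a' : nat) (F' F : {mpoly K[3]}).
Hypothesis s0 : s != 0.
Hypothesis hF' : F' \is d.-homog.
Hypothesis def_d : d = (a + a'.*2)%N.
Hypothesis sF' : pull (@sigma K) F' = ('X_i0 * 'X_i1 * 'X_i2) ^+ a' * F.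
Hypothesis invF' : invariant_curve (form4 s t) F'.
Hypothesis oF0 : Ord F' (vec3 1 0 0) a'.
Hypothesis oF1 : Ord F' (vec3 0 1 0) a'.
Hypothesis oF2 : Ord F' (vec3 0 0 1) a'.
Hypothesis uF : undiv F.

Let x : {mpoly K[3]} := 'X_i0.
Let y : {mpoly K[3]} := 'X_i1.
Let z : {mpoly K[3]} := 'X_i2.

(** The involution contracts the side x = 0 to (1 : 0 : 0), and the points of [F] on this side are
    the tangents of [F'] at that vertex. *)
Lemma face_lead : pull (face K) F = (y * z) ^+ a * pull (flip K) (tay F' (vtx0 K))`_a'.
Proof.
pose m : 'X_{1..3} := [multinom a' | i < 3].
have mE i : m i = a' by rewrite mnmE.
have sF : pull (@sigma K) F' = 'X_[m] * F.
  by rewrite sF' [in RHS]mpolyXE_id prod3 !mE !exprMn.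
have := restriction_lead char0 hF' sF oF0 uF; rewrite !mE def_d => /(_ _)/esym h.
have yz0 : (y * z) ^+ a' != 0 by rewrite expf_neq0 // mulf_neq0 ?mpolyX_neq0.
apply: (mulfI yz0); rewrite [in LHS]exprMn h; last first.
  by rewrite (leq_trans _ (leq_addl _ _)) // -addnn leq_addr.
by rewrite mulrA -exprD -addnn addnA addnK addnC.
Qed.

Lemma meval_face G P : P i0 = 0 -> (pull (face K) G).@[P] = G.@[P].
Proof.
move=> P0; rewrite meval_pull; apply: meval_eq => i.
by case: (ord3P i) => ->; rewrite /face !vec3E ?meval0 ?mevalXU ?P0.
Qed.

Lemma meval_flip G P : (pull (flip K) G).@[P] = G.@[vec3 0 (P i2) (P i1)].
Proof.
rewrite meval_pull; apply: meval_eq => i.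
by case: (ord3P i) => ->; rewrite /flip !vec3E ?meval0 ?mevalXU.
Qed.

Lemma mderiv_face G i : i != i0 -> (pull (face K) G)^`M(i) = pull (face K) G^`M(i).
Proof.
rewrite mderiv_pull sum3 /face !vec3E mderiv0 !mderivXi mulr0 add0r.
by case: (ord3P i) => -> // _; rewrite /= ?mulr1 ?mulr0 ?addr0 ?add0r.
Qed.

Lemma mderiv_flip G i : i != i0 ->
  (pull (flip K) G)^`M(i) = pull (flip K) G^`M(vec3 i0 i2 i1 i).
Proof.
rewrite mderiv_pull sum3 /flip !vec3E mderiv0 !mderivXi mulr0 add0r.
by case: (ord3P i) => -> // _; rewrite !vec3E /= ?mulr1 ?mulr0 ?addr0 ?add0r.
Qed.

(** The leading form of [F'] has simple zeros, so by [face_lead] the curve [F] crosses the side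
    transversally at such points. *)
Lemma smooth_face P : P i0 = 0 -> P i1 != 0 -> P i2 != 0 -> smooth F P.
Proof.
move=> P0 P1 P2 FP; have [lt_a' sz] := oF0.
set T := (tay F' (vtx0 K))`_a' in sz; pose v := vec3 0 (P i2) (P i1).
have fl := face_lead; rewrite -/T in fl.
have yz0 : ((y * z) ^+ a).@[P] != 0.
  by rewrite rmorphXn /= mevalM !mevalXU expf_neq0 // mulf_neq0.
have Tv : T.@[v] = 0.
  have := congr1 (meval P) fl; rewrite meval_face // FP mevalM meval_flip => /esym/eqP.
  by rewrite mulf_eq0 (negPf yz0) => /eqP.
have dF i : i != i0 -> F^`M(i).@[P] = ((y * z) ^+ a).@[P] * (T^`M(vec3 i0 i2 i1 i)).@[v].
  move=> ni; rewrite -meval_face // -mderiv_face // fl mderivM mevalD !mevalM.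
  by rewrite meval_flip Tv mulr0 add0r mderiv_flip // meval_flip.
have [/eqP d1|] := boolP (F^`M(i1).@[P] == 0); last by exists i1.
have [/eqP d2|] := boolP (F^`M(i2).@[P] == 0); last by exists i2.
have T0 : T^`M(i0) = 0.
  by have := lead_form_dir hF' lt_a'; rewrite sum3 !vec3E mpolyC0 mpolyC1 mul1r !mul0r !addr0.
have [//|i|c hc] := sz v.
  have := dF i1 isT; have := dF i2 isT; rewrite d1 d2 !vec3E.
  move=> /esym/eqP; rewrite mulf_eq0 (negPf yz0) /= => /eqP T1.
  move=> /esym/eqP; rewrite mulf_eq0 (negPf yz0) /= => /eqP T2.
  by case: (ord3P i) => ->; rewrite ?T0 ?meval0.
by have /eqP := hc i2; rewrite /v !vec3E mulr0 (negPf P1).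
Qed.

(** The converse correspondence: the tangents of [F] at (1 : 0 : 0) are the points of [F'] on the
    side x = 0, the factor (yz)^a' accounting for the two vertices on this side. *)
Lemma vertex_lead : (forall k, (k < a)%N -> (tay F (vtx0 K))`_k = 0) /\
  (y * z) ^+ a' * (tay F (vtx0 K))`_a = pull (flip K) F'.
Proof.
pose f : {rmorphism K -> {poly {mpoly K[3]}}} := polyC \o @mpolyC 3 K.
pose u : {poly {mpoly K[3]}} := 1%:P + 'X * x%:P.
(* The image under [sigma] of the point (1, 0, 0) + 'X (x, y, z) is 'X W. *)
pose W : 'I_3 -> {poly {mpoly K[3]}} := vec3 ('X * (y * z)%:P) (u * z%:P) (u * y%:P).
have tx : tay 'X_i0 (vtx0 K) = u.
  rewrite tayX /vtx0 vec3E mpolyC1; exact: erefl.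
have ty : tay 'X_i1 (vtx0 K) = 'X * y%:P.
  rewrite tayX /vtx0 vec3E mpolyC0 polyC0 add0r; exact: erefl.
have tz : tay 'X_i2 (vtx0 K) = 'X * z%:P.
  rewrite tayX /vtx0 vec3E mpolyC0 polyC0 add0r; exact: erefl.
have e1 : tay (pull (@sigma K) F') (vtx0 K) = 'X ^+ d * mmap f W F'.
  rewrite -(mmap_homogM _ _ _ hF') tayE mmap_pull; apply: mmap_eq => [//|i].
  rewrite -tayE; case: (ord3P i) => ->; rewrite /sigma /W !vec3E tayM ?tx ?ty ?tz ?polyCM; ring.
pose U : {poly {mpoly K[3]}} := (u * (y * z)%:P) ^+ a'.
have tP A k : tay (A ^+ k) (vtx0 K) = tay A (vtx0 K) ^+ k by rewrite !tayE rmorphXn.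
have e2 : tay (pull (@sigma K) F') (vtx0 K) = 'X ^+ a'.*2 * (U * tay F (vtx0 K)).
  rewrite sF' tayM tP !tayM tx ty tz /U mulrA; congr (_ * _).
  by rewrite -mul2n exprM -exprMn polyCM; congr (_ ^+ _); ring.
have e3 : U * tay F (vtx0 K) = 'X ^+ a * mmap f W F'.
  apply: (mulfI (x := 'X ^+ a'.*2)); first by rewrite monic_neq0 ?monicXn.
  by rewrite -e2 e1 def_d exprD; ring.
have u0 : u`_0 = 1 := coef0_affine 1 x%:P.
have W0 : (mmap f W F')`_0 = pull (flip K) F'.
  rewrite (coef0_mmap (@mpolyC 3 K)) pullE; apply: mmap_eq => [//|i].
  case: (ord3P i) => ->; rewrite /W /flip !vec3E.
  - rewrite coefXM; exact: erefl.
  - by rewrite coefMC u0 mul1r.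
  - by rewrite coefMC u0 mul1r.
have U0 : U`_0 = (y * z) ^+ a'.
  by rewrite -[U`_0]/(coefp 0 U) rmorphXn /= coef0M u0 coefC mul1r.
have yz0 : U`_0 != 0 by rewrite U0 expf_neq0 // mulf_neq0 ?mpolyX_neq0.
have [k ka|ltF eF] := coef_div_lt (B := tay F (vtx0 K)) (m := a) yz0.
  by rewrite e3 coefXnM ka.
by split=> //; rewrite -U0 -eF e3 coefXnM ltnn subnn W0.
Qed.

End SigmaVertex.

Section VertexOrd.
Variable K : fieldType.
Hypothesis char0 : forall n, n.+1%:R != 0 :> K.
Implicit Types (F G : {mpoly K[3]}) (P Q v : 'I_3 -> K).

Lemma line_coef F (Q u : 'I_3 -> K) k :
  ((tay F Q)`_k).@[u] = (mmap polyC (fun i => (Q i)%:P + 'X * (u i)%:P) F)`_k.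
Proof. by rewrite -[LHS](coef_line (idfun : {rmorphism K -> K})). Qed.

Lemma invariant_swap s t F : invariant_curve (form4 s t) F ->
  invariant_curve (form4 s t) (pull (lin (permM K swap)) F).
Proof.
by apply: (invariant_lin (mu := -1)) => [|k]; rewrite ?oppr_eq0 ?oner_eq0 ?swap_form.
Qed.

Lemma line_order2 s t F d m : s != 0 -> F \is d.-homog ->
    invariant_curve (form4 s t) F -> Ord F (vec3 0 0 1) m ->
  let u : 'I_3 -> K := vec3 0 1 0 in
  ((tay F (vec3 0 0 1))`_m).@[u] = 0 -> ((tay F (vec3 0 0 1))`_m.+1).@[u] != 0.
Proof.
move=> s0 hF invF oF u.
have oS : Ord (pull (lin (permM K swap)) F) (vec3 0 1 0) m.
  apply: (Ord_lin (permM_unit K swapK)); apply: Ord_eq oF => i.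
  by rewrite mulv_permM; case: (ord3P i) => ->.
have e k : ((tay F (vec3 0 0 1))`_k).@[u] =
    ((tay (pull (lin (permM K swap)) F) (vec3 0 1 0))`_k).@[vec3 0 0 1].
  rewrite !line_coef; congr ((polyseq _)`_k).
  rewrite (mmap_pull polyC); apply: mmap_eq => [//|i].
  by rewrite lin_permM mmapX mmap1U /u /swap; case: (ord3P i) => ->; rewrite !vec3E.
rewrite !e; exact: (line_order1 s0 (homog_pull_lin _ hF) (invariant_swap invF) oS).
Qed.

Variables (s t : K) (d a a' : nat) (F' F : {mpoly K[3]}).
Hypothesis s0 : s != 0.
Hypothesis hF' : F' \is d.-homog.
Hypothesis def_d : d = (a + a'.*2)%N.
Hypothesis sF' : pull (@sigma K) F' = ('X_i0 * 'X_i1 * 'X_i2) ^+ a' * F.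
Hypothesis invF' : invariant_curve (form4 s t) F'.
Hypothesis oF1 : Ord F' (vec3 0 1 0) a'.
Hypothesis oF2 : Ord F' (vec3 0 0 1) a'.
Hypothesis smF' : forall P, P i0 = 0 -> P i1 != 0 -> P i2 != 0 -> smooth F' P.

(** A double tangent v corresponds to a contact of [F'] with the side x = 0 at P = (0, v2, v1). Away
    from the vertices, the foliation is transverse to the side. At a vertex, a' of the contact is
    due to the factor (yz)^a', and [line_order1] or [line_order2] forbids an excess of 2. *)
Lemma vertex_Ord : Ord F (vtx0 K) a.
Proof.
have [lt_a eL] := vertex_lead hF' def_d sF'; split=> // v.
set L := (tay F (vtx0 K))`_a in eL * => Lv dLv.
pose A : {mpoly K[3]} := ('X_i1 * 'X_i2) ^+ a'.
have {}eL : A * L = pull (flip K) F' := eL.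
pose P : 'I_3 -> K := vec3 0 (v i2) (v i1).
have dF' i : i != i0 -> F'^`M(vec3 i0 i2 i1 i).@[P] = 0.
  move=> ni; rewrite -meval_flip -mderiv_flip // -eL mderivM mevalD !mevalM Lv dLv.
  by rewrite !mulr0 addr0.
have F'P : F'.@[P] = 0 by rewrite -meval_flip -eL mevalM Lv mulr0.
have line (u : 'I_3 -> K) k : mmap polyC (fun i => (v i)%:P + 'X * (u i)%:P) A *
    mmap polyC (fun i => (v i)%:P + 'X * (u i)%:P) L =
    mmap polyC (vec3 0 ((v i2)%:P + 'X * (u i2)%:P) ((v i1)%:P + 'X * (u i1)%:P)) F' /\
   ((mmap polyC (fun i => (v i)%:P + 'X * (u i)%:P) L)`_k) = ((tay L v)`_k).@[u].
  split; last by rewrite line_coef.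
  rewrite -rmorphM eL /= mmap_pull; apply: mmap_eq => [//|i].
  by case: (ord3P i) => ->; rewrite /flip !vec3E ?mmap0 // mmapX mmap1U.
have tayL (u : 'I_3 -> K) : ((tay L v)`_0).@[u] = 0 /\ ((tay L v)`_1).@[u] = 0.
  split; first by rewrite tay0 mevalC Lv.
  rewrite tay1 (raddf_sum (meval u)) big1 // => k _.
  by rewrite /= mevalM mevalC dLv mul0r.
(* On any line through v the form L has a double zero at v; if G is 'X^a' L on that line up to
   constants, its coefficients in degrees a' and a' + 1 vanish. *)
have finish (u : 'I_3 -> K) (G : {poly K}) (c1 c2 : K) : c1 != 0 -> c2 != 0 ->
    c1 *: 'X^a' * mmap polyC (fun i => (v i)%:P + 'X * (u i)%:P) L = c2 *: G ->
    G`_a' = 0 /\ G`_a'.+1 = 0.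
  move=> c10 c20 e; have [l0 l1] := tayL u.
  have Gk k : c2 * G`_k = c1 * ('X^a' * mmap polyC (fun i => (v i)%:P + 'X * (u i)%:P) L)`_k.
    by rewrite -coefZ -e -scalerAl coefZ.
  split; apply: (mulfI c20); rewrite Gk mulr0 coefXnM.
    by rewrite ltnn subnn -line_coef l0 mulr0.
  by rewrite ltnNge leqnSn subSnn -line_coef l1 mulr0.
have [y0|y0] := eqVneq (v i1) 0; have [z0|z0] := eqVneq (v i2) 0.
- by exists (v i0) => i; case: (ord3P i) => ->; rewrite /vtx0 !vec3E ?mulr1 ?mulr0.
(* With this direction the exchange of y and z sends v + 'X u to v2 (0, 1, 'X), a parametrization of
   the side starting at (0 : 1 : 0). *)
- pose u : 'I_3 -> K := vec3 0 (v i2) 0.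
  have [e _] := line u 0%N.
  have c10 : (v i2 * v i2) ^+ a' != 0 by rewrite expf_neq0 // mulf_neq0.
  have c20 : v i2 ^+ d != 0 by rewrite expf_neq0.
  have [|g0 g1] := finish u (mmap polyC (vec3 0 1 'X) F') _ _ c10 c20.
    transitivity (mmap polyC (fun i => (v i)%:P + 'X * (u i)%:P) A *
        mmap polyC (fun i => (v i)%:P + 'X * (u i)%:P) L).
      congr (_ * _); rewrite /A rmorphXn rmorphM /= !mmapX !mmap1U /u !vec3E y0.
      rewrite !polyC0 mulr0 addr0 add0r -mulrA -polyCM [in RHS]exprMn -polyC_exp -mul_polyC.
      exact: mulrC.
    rewrite e -mul_polyC polyC_exp -(mmap_homogM _ _ _ hF'); apply: mmap_eq => [//|i].
    rewrite /u !vec3E y0 !polyC0 mulr0 addr0 add0r.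
    by case: (ord3P i) => ->; rewrite !vec3E ?mulr0 ?mulr1 // mulrC.
  have eG k : ((tay F' (vec3 0 1 0))`_k).@[vec3 0 0 1] = (mmap polyC (vec3 0 1 'X) F')`_k.
    rewrite line_coef; congr ((polyseq _)`_k); apply: mmap_eq => [//|i].
    by case: (ord3P i) => ->; rewrite !vec3E !(polyC0, polyC1) ?mulr0 ?mulr1 ?addr0 ?add0r.
  by have := line_order1 s0 hF' invF' oF1 (etrans (eG _) g0); rewrite eG g1 eqxx.
- pose u : 'I_3 -> K := vec3 0 0 (v i1).
  have [e _] := line u 0%N.
  have c10 : (v i1 * v i1) ^+ a' != 0 by rewrite expf_neq0 // mulf_neq0.
  have c20 : v i1 ^+ d != 0 by rewrite expf_neq0.
  have [|g0 g1] := finish u (mmap polyC (vec3 0 'X 1) F') _ _ c10 c20.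
    transitivity (mmap polyC (fun i => (v i)%:P + 'X * (u i)%:P) A *
        mmap polyC (fun i => (v i)%:P + 'X * (u i)%:P) L).
      congr (_ * _); rewrite /A rmorphXn rmorphM /= !mmapX !mmap1U /u !vec3E z0.
      rewrite !polyC0 mulr0 addr0 add0r mulrCA -polyCM [in RHS]exprMn -polyC_exp -mul_polyC.
      exact: mulrC.
    rewrite e -mul_polyC polyC_exp -(mmap_homogM _ _ _ hF'); apply: mmap_eq => [//|i].
    rewrite /u !vec3E z0 !polyC0 mulr0 addr0 add0r.
    by case: (ord3P i) => ->; rewrite !vec3E ?mulr0 ?mulr1 // mulrC.
  have eG k : ((tay F' (vec3 0 0 1))`_k).@[vec3 0 1 0] = (mmap polyC (vec3 0 'X 1) F')`_k.
    rewrite line_coef; congr ((polyseq _)`_k); apply: mmap_eq => [//|i].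
    by case: (ord3P i) => ->; rewrite !vec3E !(polyC0, polyC1) ?mulr0 ?mulr1 ?addr0 ?add0r.
  by have := line_order2 s0 hF' invF' oF2 (etrans (eG _) g0); rewrite eG g1 eqxx.
(* Only the x-derivative of [F'] survives at P, so invariance would make the dy-coefficient of the
   form vanish there; its value is -s v1^3 v2^2. *)
- have [i di] := smF' (vec3E 0 (v i2) (v i1)).1.1 z0 y0 F'P.
  have di0 : F'^`M(i0).@[P] != 0.
    move: di; case: (ord3P i) => -> //; first by have /eqP := dF' i2 isT; rewrite !vec3E => ->.
    by have /eqP := dF' i1 isT; rewrite !vec3E => ->.
  have [G eG] := invF' i0 i1; have := congr1 (meval P) eG.
  have := dF' i2 isT; rewrite vec3E => d1.
  rewrite [RHS]mevalM F'P mulr0 mevalB (mevalM P F'^`M(i0)) (mevalM P F'^`M(i1)) d1 mul0r subr0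
    => /eqP.
  rewrite mulf_eq0 (negPf di0) orFb.
  have -> : (form4 s t i1).@[P] = - s * v i1 ^+ 3 * v i2 ^+ 2.
    rewrite /form4 vec3E mevalM !mevalB !mevalM !mevalXU !mevalC /P !vec3E.
    ring.
  by rewrite !mulf_eq0 oppr_eq0 (negPf y0) (negPf z0) (negPf s0).
Qed.

End VertexOrd.

Lemma seq_choice (T U : eqType) (R : T -> U -> Prop) (s : seq T) :
    (forall x, x \in s -> exists y, R x y) ->
  exists s' : seq U, forall x, x \in s -> exists2 y, y \in s' & R x y.
Proof.
elim: s => [|x s IHs] h; first by exists [::].
have [y Rxy] := h x (mem_head x s).
have [|s' hs'] := IHs; first by move=> z zs; apply: h; rewrite inE zs orbT.
exists (y :: s') => z; rewrite inE => /predU1P[->|/hs'[u us Rzu]].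
  by exists y; rewrite ?mem_head.
by exists u; rewrite // inE us orbT.
Qed.

(** * Strict transforms under the quadratic involution *)

Section SigmaTransform.
Variable K : fieldType.
Hypothesis char0 : forall n, n.+1%:R != 0 :> K.
Implicit Types (F G H : {mpoly K[3]}) (P Q v : 'I_3 -> K).

Definition mxyz n : 'X_{1..3} := [multinom n | i < 3].

Lemma mxyzE n : 'X_[mxyz n] = ('X_i0 * 'X_i1 * 'X_i2) ^+ n :> {mpoly K[3]}.
Proof. by rewrite mpolyXE_id prod3 !mnmE !exprMn. Qed.

Lemma homog_sigma i : sigma K i \is 2.-homog.
Proof.
have h j k : 'X_j * 'X_k \is [in K[3], 2.-homog].
  by rewrite -mpolyXD dhomogX /= mdegD !mdeg1.
by case: (ord3P i) => ->; rewrite /sigma !vec3E h.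
Qed.

Lemma sigma_sigma F d : F \is d.-homog ->
  pull (@sigma K) (pull (@sigma K) F) = 'X_[mxyz d] * F.
Proof.
move=> hF; rewrite mxyzE -[in RHS](mmap_X F) -(mmap_homogM _ _ _ hF) pull_comp pullE.
apply: mmap_eq => [//|i].
by case: (ord3P i) => ->; rewrite /sigma !vec3E pullM !pullX !vec3E; ring.
Qed.

Lemma pull_sigmaX m : exists m', pull (@sigma K) 'X_[m] = 'X_[m'] :> {mpoly K[3]}.
Proof.
exists [multinom vec3 (m i1 + m i2) (m i0 + m i2) (m i0 + m i1) i | i < 3]%N.
rewrite !mpolyXE_id !prod3 !pullM !pullXn !pullX /sigma !vec3E !mnmE !vec3E !exprMn !exprD.
ring.
Qed.

Lemma irreducible_undiv F : irreducible_mpoly F ->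
  (forall i (k : K), F <> k *: 'X_i) -> undiv F.
Proof.
move=> [F0 nuF irr] nX i; apply/eqP => /mdvdX[H e].
have [/unit_mpolyP[c _ eH]|/unit_mpolyP[c _ /(congr1 (mcoeff U_(i)))/eqP]] := irr _ _ e.
  by apply: (nX i c); rewrite e eH mul_mpolyC.
by rewrite mcoeffX eqxx mcoeffC mnm1_eq0 mulr0 oner_eq0.
Qed.

(* Since sigma is an involution, a factorization of F' gives one of F. *)
Lemma sigma_irreducible F F' m : irreducible_curve F -> undiv F ->
  pull (@sigma K) F = 'X_[m] * F' -> undiv F' -> irreducible_curve F'.
Proof.
move=> [[d hF] [F0 nuF irr]] uF e uF'.
have [m' em'] := pull_sigmaX m.
have ss := sigma_sigma hF; rewrite e pullM em' in ss.
have F'0 := undiv_neq0 uF'.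
split.
  apply: (homog_factor (F := pull (@sigma K) F) (H := 'X_[m]) (d := 2 * d)).
  - by rewrite e mulf_neq0 // mpolyX_neq0.
  - exact: homog_pull homog_sigma hF.
  - by rewrite mulrC.
split=> // [|G H eGH].
  apply/negP => /unit_mpolyP[c c0 F'c]; move/negP: nuF; apply.
  apply: (undiv_mono (m := m') (c := c)) => //.
  by exists 'X_[mxyz d]; rewrite -ss F'c pullC.
have uG : undiv G by apply: (@undivMl _ G H); rewrite -eGH.
have uH : undiv H by apply: (@undivMl _ H G); rewrite mulrC -eGH.
have sGH : pull (@sigma K) G * pull (@sigma K) H != 0.
  have : 'X_[m'] * pull (@sigma K) F' != 0 by rewrite ss mulf_neq0 // mpolyX_neq0.
  by rewrite eGH pullM mulf_eq0 negb_or => /andP[].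
have [sG sH] : pull (@sigma K) G != 0 /\ pull (@sigma K) H != 0.
  by apply/andP; move: sGH; rewrite mulf_eq0 negb_or.
have [mG [G1 [eG uG1]]] := strip sG; have [mH [H1 [eH uH1]]] := strip sH.
have eF : G1 * H1 = F.
  have := mono_assoc (m := (m' + mG + mH)%MM) (m' := mxyz d) (undivM uG1 uH1) uF.
  case=> //; rewrite -ss eGH pullM eG eH !mpolyXD; ring.
have unit_pull A A1 mA dA : undiv A -> pull (@sigma K) A = 'X_[mA] * A1 ->
    A \is dA.-homog -> A1 \is a GRing.unit -> A \is a GRing.unit.
  move=> uA eA hA /unit_mpolyP[c c0 A1c].
  have [mA' emA'] := pull_sigmaX mA.
  apply: (undiv_mono (m := mA') (c := c)) => //; exists 'X_[mxyz dA].
  by rewrite -(sigma_sigma hA) eA pullM emA' A1c pullC.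
have hF' : exists e', F' \is e'.-homog.
  apply: (homog_factor (F := pull (@sigma K) F) (H := 'X_[m]) (d := 2 * d)).
  - by rewrite e mulf_neq0 // mpolyX_neq0.
  - exact: homog_pull homog_sigma hF.
  - by rewrite mulrC.
have [d' hd'] := hF'.
have [dG hG] := homog_factor F'0 hd' eGH.
have [dH hH] := homog_factor F'0 hd' (etrans eGH (mulrC _ _)).
by case: (irr _ _ (esym eF)) => u1; [left; apply: unit_pull eG hG u1|right; apply: unit_pull eH
  hH u1].
Qed.

(** By the product rule [F'] divides a monomial multiple of dF' /\ eta, and the monomial cancels
    because no coordinate divides [F']. *)
Lemma sigma_invariant s t F F' m : invariant_curve (form4 s t) F ->
  pull (@sigma K) F = 'X_[m] * F' -> undiv F' -> invariant_curve (form4 t s) F'.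
Proof.
move=> inv e uF' i j; have [H] := invariant_pull (sigma_form s t) inv i j.
rewrite e dvecM -mxyzE => eH.
have [|B _ eB] := @mono_cancel _ F' (- ('X_[mxyz 2] * dvec (form4 t s) 'X_[m] i j) - H * 'X_[m])
  (dvec (form4 t s) F' i j) (mxyz 2 + m)%MM uF'.
  transitivity (- (H * ('X_[m] * F')) - 'X_[mxyz 2] * dvec (form4 t s) 'X_[m] i j * F'); first by
    ring.
  by rewrite -eH mpolyXD; ring.
by exists B; apply: etrans (esym eB) (mulrC _ _).
Qed.

Lemma triangle_sigma z P : z ^+ 3 = 1 -> triangle z P ->
  triangle (z ^+ 2) (fun i => (sigma K i).@[P]).
Proof.
move=> z3 [h1 h2 h3]; rewrite /triangle /sigma !vec3E !mevalM !mevalXU h1 h2 h3.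
split.
- transitivity (z * z * (P i1 * P i2) ^+ 2); first by ring.
  by rewrite h1 exprMn; ring: z3.
- transitivity (z * z * (P i0 * P i2) ^+ 2); first by ring.
  by rewrite h2 exprMn; ring: z3.
- transitivity (z * z * (P i0 * P i1) ^+ 2); first by ring.
  by rewrite h3 exprMn; ring: z3.
Qed.

(** Outside the triangle the involution is a local isomorphism: its Jacobian determinant is 2xyz. *)
Lemma Ord_sigma F P m : P i0 != 0 -> P i1 != 0 -> P i2 != 0 ->
  Ord F (fun i => (sigma K i).@[P]) m -> Ord (pull (@sigma K) F) P m.
Proof.
move=> x0 y0 z0; apply: Ord_pull => [g hg|v c hv].
  have := hg i0; have := hg i1; have := hg i2.
  rewrite !sum3 /sigma !vec3E !mderivM !mderivXi /= !(mevalD, mevalM, mevalXU, meval0, meval1).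
  rewrite !(mul0r, mulr0, mul1r, mulr1, addr0, add0r) => h2 h1 h0.
  have two := char0 1.
  have g0 : g i0 = 0.
    apply: (mulfI (mulf_neq0 two (mulf_neq0 y0 z0))); rewrite mulr0.
    transitivity (P i1 * (g i0 * P i2 + g i2 * P i0) + P i2 * (g i0 * P i1 + g i1 * P i0)
      - P i0 * (g i1 * P i2 + g i2 * P i1)); first by ring.
    by rewrite h0 h1 h2 !(mulr0, oppr0, addr0).
  move: h1 h2; rewrite g0 !mul0r !add0r => /eqP; rewrite mulf_eq0 (negPf x0) orbF => /eqP g2.
  move=> /eqP; rewrite mulf_eq0 (negPf x0) orbF => /eqP g1.
  by move=> i; case: (ord3P i) => ->.
have := hv i0; have := hv i1; have := hv i2.
rewrite !sum3 /sigma !vec3E !mderivM !mderivXi /= !(mevalD, mevalM, mevalXU, meval0, meval1).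
rewrite !(mul0r, mulr0, mul1r, mulr1, addr0, add0r) => h2 h1 h0.
have two := char0 1.
have xyz2 : 2%:R * (P i0 * P i1 * P i2) != 0 by rewrite !mulf_neq0.
exists (c / 2%:R) => i; apply: (mulfI xyz2).
have -> : 2%:R * (P i0 * P i1 * P i2) * (c / 2%:R * P i) = c * (P i0 * P i1 * P i2) * P i * (2%:R
  / 2%:R).
  by ring.
rewrite divff // mulr1; case: (ord3P i) => ->.
- transitivity (P i0 * (P i1 * (P i2 * v i0 + P i0 * v i2) + P i2 * (P i1 * v i0 + P i0 * v i1)
    - P i0 * (P i2 * v i1 + P i1 * v i2))); first by ring.
  by rewrite h0 h1 h2; ring.
- transitivity (P i1 * (P i0 * (P i2 * v i1 + P i1 * v i2) + P i2 * (P i1 * v i0 + P i0 * v i1)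
    - P i1 * (P i2 * v i0 + P i0 * v i2))); first by ring.
  by rewrite h0 h1 h2; ring.
- transitivity (P i2 * (P i0 * (P i2 * v i1 + P i1 * v i2) + P i1 * (P i2 * v i0 + P i0 * v i2)
    - P i2 * (P i1 * v i0 + P i0 * v i1))); first by ring.
  by rewrite h0 h1 h2; ring.
Qed.

End SigmaTransform.

Section SigmaFaces.
Variable K : fieldType.
Hypothesis char0 : forall n, n.+1%:R != 0 :> K.
Implicit Types (F G H : {mpoly K[3]}) (P Q v : 'I_3 -> K).

Definition vertex_mult F a := forall Q, nz Q -> vertex Q -> Ord F Q a.
Definition on_face Q := exists i, Q i = 0 /\ forall j, j != i -> Q j != 0.
Definition smooth_faces F := forall Q, on_face Q -> smooth F Q.

(** All that links [F'] to its transform [F], in a form stable under cyclic permutation of the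
    coordinates: only the vertex (1 : 0 : 0) and the side x = 0 remain to be treated. *)
Definition sigma_related s t d a a' F' F :=
  [/\ F' \is d.-homog, pull (@sigma K) F' = ('X_i0 * 'X_i1 * 'X_i2) ^+ a' * F,
      invariant_curve (form4 s t) F', undiv F & vertex_mult F' a'] /\
  [/\ d = (a + a'.*2)%N, smooth_faces F' & s != 0].

Let cycF F := pull (lin (permM K cyc)) F.

Lemma cyc_vertex_mult F a : vertex_mult F a -> vertex_mult (cycF F) a.
Proof.
move=> vF Q [i Qi] [h0 h1 h2]; apply: (Ord_lin (permM_unit K cycK)); apply: vF.
  by exists (cycV i); rewrite mulv_permM cycVK.
by split; rewrite !mulv_permM /cyc !vec3E // mulrC.
Qed.

Lemma cyc_smooth_faces F : smooth_faces F -> smooth_faces (cycF F).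
Proof.
move=> sF Q [i [Qi nQ]].
have /smooth_Ord[m m1 oF] : smooth F (mulv (permM K cyc) Q).
  apply: sF; exists (cycV i); split=> [|j ji]; rewrite mulv_permM ?cycVK //.
  by apply: nQ; apply: contraNneq ji => <-; rewrite cycK.
exact: Ord_smooth m1 (Ord_lin (permM_unit K cycK) oF).
Qed.

Lemma cyc_related s t d a a' F' F :
  sigma_related s t d a a' F' F -> sigma_related s t d a a' (cycF F') (cycF F).
Proof.
move=> [[hF' sF' inv uF vF] [def_d smF s0]]; split; split=> //.
- exact: homog_pull_lin.
- rewrite sigma_cyc sF' pullM pullXn !pullM !pullX !lin_permM /cyc !vec3E -/cyc.
  by congr (_ ^+ _ * _); ring.
- apply: (invariant_lin (mu := 1)) inv => [|k]; first exact: oner_neq0.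
  exact: cyc_form.
- exact: undiv_cyc.
- exact: cyc_vertex_mult.
- exact: cyc_smooth_faces.
Qed.

Lemma related_face0 s t d a a' F' F : sigma_related s t d a a' F' F ->
  Ord F (vtx0 K) a /\
  forall P, P i0 = 0 -> P i1 != 0 -> P i2 != 0 -> smooth F P.
Proof.
move=> [[hF' sF' inv uF vF] [def_d smF s0]].
have oF0 : Ord F' (vec3 1 0 0) a'.
  apply: vF; first by exists i0; rewrite vec3E oner_neq0.
  by rewrite /vertex !vec3E !mulr0.
have oF1 : Ord F' (vec3 0 1 0) a'.
  apply: vF; first by exists i1; rewrite vec3E oner_neq0.
  by rewrite /vertex !vec3E !(mulr0, mul0r).
have oF2 : Ord F' (vec3 0 0 1) a'.
  apply: vF; first by exists i2; rewrite vec3E oner_neq0.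
  by rewrite /vertex !vec3E !(mulr0, mul0r).
split; last by apply: (smooth_face char0 hF' def_d sF' oF0 uF).
apply: (vertex_Ord s0 hF' def_d sF' inv oF1 oF2) => P P0 P1 P2.
apply: smF; exists i0; split=> // j; by case: (ord3P j) => ->.
Qed.

Lemma related_faces s t d a a' F' F e : F \is e.-homog ->
  sigma_related s t d a a' F' F -> vertex_mult F a /\ smooth_faces F.
Proof.
move=> hF r0; have r1 := cyc_related r0; have r2 := cyc_related r1.
have [o0 s0] := related_face0 r0; have [o1 s1] := related_face0 r1.
have [o2 s2] := related_face0 r2.
have uR := permM_unit K cycK.
have {}o1 := Ord_linE uR o1; have {}o2 := Ord_linE uR (Ord_linE uR o2).
have {}s1 Q : Q i2 = 0 -> Q i0 != 0 -> Q i1 != 0 -> smooth F Q.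
  move=> h2 h0 h1; have := s1 (fun i => Q (cycV i)); rewrite /cycV !vec3E => /(_ h2 h0 h1).
  move=> /smooth_Ord[m m1 /(Ord_linE uR)/Ord_smooth h]; apply: smooth_eq (h m1) => i.
  by rewrite mulv_permM -/cycV cycK.
have {}s2 Q : Q i1 = 0 -> Q i2 != 0 -> Q i0 != 0 -> smooth F Q.
  move=> h1 h2 h0; have := s2 (fun i => Q (cycV (cycV i))); rewrite /cycV !vec3E => /(_ h1 h2 h0).
  move=> /smooth_Ord[m m1 /(Ord_linE uR)/(Ord_linE uR)/Ord_smooth h]; apply: smooth_eq (h m1) => i.
  by rewrite !mulv_permM -/cycV !cycK.
split=> [Q nzQ [h0 h1 h2]|Q [i [Qi nQ]]].
  have [x0|x0] := eqVneq (Q i0) 0; last first.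
    have y0 : Q i1 = 0 by apply/eqP; move/eqP: h2; rewrite mulf_eq0 (negPf x0).
    have z0 : Q i2 = 0 by apply/eqP; move/eqP: h1; rewrite mulf_eq0 (negPf x0).
    apply: Ord_eq (Ord_scale x0 hF o0) => i.
    by case: (ord3P i) => ->; rewrite /vtx0 !vec3E ?mulr1 ?mulr0.
  have [y0|y0] := eqVneq (Q i1) 0; last first.
    have z0 : Q i2 = 0 by apply/eqP; move/eqP: h0; rewrite mulf_eq0 (negPf y0).
    apply: Ord_eq (Ord_scale y0 hF o2) => i; rewrite !mulv_permM.
    by case: (ord3P i) => ->; rewrite /vtx0 /cyc !vec3E ?mulr1 ?mulr0.
  have z0 : Q i2 != 0 by case: nzQ => i; case: (ord3P i) => -> //; rewrite ?x0 ?y0 eqxx.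
  apply: Ord_eq (Ord_scale z0 hF o1) => i; rewrite !mulv_permM.
  by case: (ord3P i) => ->; rewrite /vtx0 /cyc !vec3E ?mulr1 ?mulr0.
move: Qi nQ; case: (ord3P i) => -> Qi nQ.
- by apply: s0 => //; apply: nQ.
- by apply: s2 => //; apply: nQ.
- by apply: s1 => //; apply: nQ.
Qed.

End SigmaFaces.

Section GoodSigma.
Variables (K : fieldType) (w : K).
Hypothesis char0 : forall n, n.+1%:R != 0 :> K.
Hypothesis w2 : w ^+ 2 = - w - 1.
Implicit Types (F G H : {mpoly K[3]}) (P Q v : 'I_3 -> K).

Let sg P i := (sigma K i).@[P].

Lemma sgE P : [/\ sg P i0 = P i1 * P i2, sg P i1 = P i0 * P i2 & sg P i2 = P i0 * P i1].
Proof. by rewrite /sg /sigma !vec3E !mevalM !mevalXU. Qed.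

Lemma triangle_scale z c P P' : c != 0 -> (forall i, P' i = c * P i) -> triangle z P' -> triangle
  z P.
Proof.
move=> c0 e; rewrite /triangle !e => -[h1 h2 h3].
have c20 : c ^+ 2 != 0 by rewrite expf_neq0.
split; apply: (mulfI c20).
- transitivity (c * P i1 * (c * P i2)); [by ring|rewrite h1; ring].
- transitivity (c * P i0 * (c * P i2)); [by ring|rewrite h2; ring].
- transitivity (c * P i0 * (c * P i1)); [by ring|rewrite h3; ring].
Qed.

Lemma triangle_sgV z P : z ^+ 3 = 1 -> P i0 != 0 -> P i1 != 0 -> P i2 != 0 ->
  triangle z (sg P) -> triangle (z ^+ 2) P.
Proof.
move=> z3 x0 y0 z0 /(triangle_sigma z3) tr.
apply: (@triangle_scale _ (P i0 * P i1 * P i2) _ (sg (sg P))) => [||//].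
  by rewrite !mulf_neq0.
have [a b c] := sgE P; have [a' b' c'] := sgE (sg P).
by move=> i; case: (ord3P i) => ->; rewrite ?a' ?b' ?c' ?a ?b ?c; ring.
Qed.

Lemma triangle_neq0 z P : nz P -> z != 0 -> triangle z P ->
  [/\ P i0 != 0, P i1 != 0 & P i2 != 0].
Proof.
move=> nzP z0 [h1 h2 h3].
have sq (a : K) : z * a ^+ 2 = 0 -> a = 0.
  by move/eqP; rewrite mulf_eq0 (negPf z0) expf_eq0 => /eqP.
split; apply/negP => /eqP e; case: nzP => i /negP[]; apply/eqP.
- have b : P i1 = 0 by apply: sq; rewrite -h2 e mul0r.
  have c : P i2 = 0 by apply: sq; rewrite -h3 e mul0r.
  by case: (ord3P i) => ->.
- have b : P i0 = 0 by apply: sq; rewrite -h1 e mul0r.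
  have c : P i2 = 0 by apply: sq; rewrite -h3 e mulr0.
  by case: (ord3P i) => ->.
- have b : P i0 = 0 by apply: sq; rewrite -h1 e mulr0.
  have c : P i1 = 0 by apply: sq; rewrite -h2 e mulr0.
  by case: (ord3P i) => ->.
Qed.

(** The triangle is covered by [related_faces]; elsewhere the local isomorphism [sigma] carries
    everything over, exchanging the groups of omega and omega^2. *)
Lemma related_nice s t d a b c e a' F' F dF : F \is dF.-homog -> F != 0 ->
    sigma_related s t d a a' F' F -> (a + a' = b + c + e)%N ->
  nice w a' b e c F' -> nice w a b c e F.
Proof.
move=> hF F0 rel sum_a [hF'2 loc].
have W3 := w3 w2; have w0 := w_neq0 w2.
have [vF sF] := related_faces char0 hF rel.
case: rel => -[hF' sF' inv uF vF'] [def_d smF s0].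
have F'0 : F' != 0.
  apply: contraNneq F0 => e0; move/eqP: sF'; rewrite e0 rmorph0 eq_sym mulf_eq0 expf_eq0.
  by rewrite !mulf_eq0 !(negPf (mpolyX_neq0 _ _)) andbF.
have hd : d = (a' + b + e + c)%N := dhomog_uniq F'0 hF' hF'2.
split.
  have h1 : pull (@sigma K) F' \is (2 * d).-homog := homog_pull (@homog_sigma K) hF'.
  have h2 : pull (@sigma K) F' \is (3 * a' + dF).-homog.
    rewrite sF' -mxyzE; apply: dhomogM => //.
    by rewrite dhomogX /= mdegE sum3 !mnmE; apply/eqP; rewrite -[LHS]/(a' + a' + a')%N !mulSn
      addn0 addnA.
  have sF'0 : pull (@sigma K) F' != 0.
    by rewrite sF' -mxyzE mulf_neq0 // mpolyX_neq0.
  have e2 := dhomog_uniq sF'0 h1 h2.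
  suff -> : (a + b + c + e = dF)%N by [].
  (* The degrees satisfy 2 d = 3 a' + dF. *)
  move: e2 def_d sum_a hd; clear; lia.
have gen P m : P i0 != 0 -> P i1 != 0 -> P i2 != 0 -> Ord F' (sg P) m -> Ord F P m.
  move=> x0 y0 z0 /(Ord_sigma char0 x0 y0 z0); rewrite sF'; apply: Ord_div.
  by rewrite rmorphXn /= !mevalM !mevalXU expf_neq0 // !mulf_neq0.
have nzs P : P i0 != 0 -> P i1 != 0 -> nz (sg P).
  by move=> x0 y0; exists i2; have [_ _ ->] := sgE P; rewrite mulf_neq0.
have W4 : (w ^+ 2) ^+ 2 = w by ring: w2.
have W6 : (w ^+ 2) ^+ 3 = 1 by ring: w2.
move=> P nzP; split.
- exact: vF.
- move=> tr; have [x0 y0 z0] := triangle_neq0 nzP (oner_neq0 _) tr.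
  have [_ h _ _ _] := loc (sg P) (nzs _ x0 y0).
  apply: gen => //; apply: h; rewrite -(expr1n _ 2); apply: triangle_sigma tr.
  by rewrite expr1n.
- move=> tr; have [x0 y0 z0] := triangle_neq0 nzP w0 tr.
  have [_ _ _ h _] := loc (sg P) (nzs _ x0 y0).
  by apply: gen => //; apply: h; apply: triangle_sigma tr.
- move=> tr; have [x0 y0 z0] := triangle_neq0 nzP (expf_neq0 2 w0) tr.
  have [_ _ h _ _] := loc (sg P) (nzs _ x0 y0).
  by apply: gen => //; apply: h; rewrite -W4; apply: triangle_sigma tr.
- move=> nsp; have nv : ~ vertex P by move=> v; apply: nsp; left.
  have [x0|x0] := eqVneq (P i0) 0.
    apply: sF; exists i0; split=> // j; case: (ord3P j) => -> // _; apply/eqP => e0; apply: nv.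
      by split; rewrite ?x0 ?e0 ?mulr0 ?mul0r.
    by split; rewrite ?x0 ?e0 ?mulr0 ?mul0r.
  have [y0|y0] := eqVneq (P i1) 0.
    apply: sF; exists i1; split=> // j; case: (ord3P j) => -> // _; apply/eqP => e0; apply: nv.
    by split; rewrite ?y0 ?e0 ?mulr0 ?mul0r.
  have [z0|z0] := eqVneq (P i2) 0.
    by apply: sF; exists i2; split=> // j; case: (ord3P j) => ->.
  have [_ _ _ _ h] := loc (sg P) (nzs _ x0 y0).
  have [|m m1 oF'] := smooth_Ord (h _); last by apply: Ord_smooth m1 (gen _ _ x0 y0 z0 oF').
  case=> [[h0 _ _]|[tr|tr|tr]].
  + have [_ bb cc] := sgE P; move/eqP: h0; rewrite bb cc !mulf_eq0.
    by rewrite (negPf x0) (negPf y0) (negPf z0).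
  + apply: nsp; right; apply: Or31; rewrite -(expr1n _ 2); apply: triangle_sgV tr => //.
    by rewrite expr1n.
  + by apply: nsp; right; apply: Or33; apply: triangle_sgV tr.
  + by apply: nsp; right; apply: Or32; rewrite -W4; apply: triangle_sgV tr.
Qed.

(** The involution is applied from [F] to [F'] and then back, since the local study deduces the
    properties of [F] from those of [F']. As [t] becomes the first parameter of the form for [F'],
    its nonvanishing is the transversality of that foliation to the sides. *)
Lemma Good_sigma s t a b c e a' : t != 0 -> (a + a' = b + c + e)%N ->
  Good w t s a' b e c -> Good w s t a b c e.
Proof.
move=> t0 sum_a [S hS].
(* [G0] is the strict transform of the excepted curve [G], with the default value 0 when the
   pullback vanishes. The sides of the triangle are excepted as well. *)
pose R G G0 := pull (@sigma K) G = 0 \/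
  exists m, pull (@sigma K) G = 'X_[m] * G0 /\ undiv G0.
have [|S0 hS0] := @seq_choice _ _ R S.
  move=> G _; have [e0|n0] := eqVneq (pull (@sigma K) G) 0.
    by exists 0; left.
  by have [m [G0 h]] := strip n0; exists G0; right; exists m.
exists ([:: 'X_i0; 'X_i1; 'X_i2] ++ S0) => F irrF invF nF.
have uF : undiv F.
  case: (irrF) => _ irr; apply: irreducible_undiv irr _ => i k; apply: nF.
  by rewrite mem_cat !inE; case: (ord3P i) => ->; rewrite eqxx ?orbT.
have [[dF hF] [F0 nuF _]] := irrF.
have ss := sigma_sigma hF.
have sF0 : pull (@sigma K) F != 0.
  apply/eqP => e0; move/eqP: ss; rewrite e0 rmorph0 eq_sym mulf_eq0 (negPf F0).
  by rewrite (negPf (mpolyX_neq0 _ _)).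
have [m [F' [eF' uF']]] := strip sF0.
have irrF' := sigma_irreducible irrF uF eF' uF'.
have invF' := sigma_invariant invF eF' uF'.
have [m' em'] := pull_sigmaX K m.
have ssF : 'X_[m'] * pull (@sigma K) F' = 'X_[mxyz dF] * F.
  by rewrite -ss eF' pullM em'.
have niceF' : nice w a' b e c F'.
  apply: hS => // G k GS eG.
  have k0 : k != 0 by apply: contraTneq (undiv_neq0 uF') => k0; rewrite eG k0 scale0r eqxx.
  have sG0 : pull (@sigma K) G != 0.
    apply: contraTneq (mulf_neq0 (mpolyX_neq0 K (mxyz dF)) F0) => e0.
    by rewrite -ssF eG pullZ e0 scaler0 mulr0 eqxx.
  have [G0 G0S [e0|[mG [eG0 uG0]]]] := hS0 G GS; first by rewrite e0 eqxx in sG0.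
  apply: (nF G0 k); first by rewrite mem_cat G0S orbT.
  have ukG0 : undiv (k *: G0).
    by move=> i; rewrite pullZ scaler_eq0 negb_or k0 uG0.
  have [] := @mono_assoc _ (m' + mG)%MM (mxyz dF) _ _ ukG0 uF; last by [].
  by rewrite -ssF eG pullZ eG0 mpolyXD -!scalerAr mulrA.
have [hF'd locF'] := niceF'.
have sF'0 : pull (@sigma K) F' != 0.
  apply: contraTneq (mulf_neq0 (mpolyX_neq0 K (mxyz dF)) F0) => e0.
  by rewrite -ssF e0 mulr0 eqxx.
have [n [F1 [eF1 uF1]]] := strip sF'0.
have FF1 : F1 = F.
  have [] := @mono_assoc _ (m' + n)%MM (mxyz dF) _ _ uF1 uF; last by [].
  by rewrite -ssF eF1 mpolyXD mulrA.
rewrite FF1 in eF1.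
have vF' : vertex_mult F' a' by move=> Q nzQ; have [h _ _ _ _] := locF' Q nzQ.
(* Only the exponent of the first coordinate is given by [sigma_mult]; cyclic permutations give the
   other two, so that the monomial factor is (xyz)^a'. *)
have mult0 G' G k : G' \is (a' + b + e + c).-homog -> pull (@sigma K) G' = 'X_[k] * G ->
    undiv G -> vertex_mult G' a' -> k i0 = a'.
  move=> hG' eG uG vG'; apply: (sigma_mult char0 hG' eG _ uG); apply: vG'.
    by exists i0; rewrite /vtx0 vec3E oner_neq0.
  by rewrite /vertex /vtx0 !vec3E !mulr0.
have cycs G' G k : pull (@sigma K) G' = 'X_[k] * G -> exists2 k',
    pull (@sigma K) (pull (lin (permM K cyc)) G') = 'X_[k'] * pull (lin (permM K cyc)) G &
    forall i, k' i = k (cycV i).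
  move=> eG; have [k' ek' hk'] := pull_cycX K k; exists k' => //.
  by rewrite sigma_cyc eG pullM ek'.
have [n1 en1 hn1] := cycs _ _ _ eF1; have [n2 en2 hn2] := cycs _ _ _ en1.
have n0a := mult0 _ _ _ hF'd eF1 uF vF'.
have n1a := mult0 _ _ _ (homog_pull_lin _ hF'd) en1 (undiv_cyc uF) (cyc_vertex_mult vF').
have n2a := mult0 _ _ _ (homog_pull_lin _ (homog_pull_lin _ hF'd)) en2
  (undiv_cyc (undiv_cyc uF)) (cyc_vertex_mult (cyc_vertex_mult vF')).
have nE : n = mxyz a'.
  apply/mnmP => i; rewrite mnmE; case: (ord3P i) => ->; first by [].
    by rewrite -n2a hn2 hn1.
  by rewrite -n1a hn1.
apply: (@related_nice t s (a' + b + e + c)%N a b c e a' F' F dF) => //.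
split; split=> //; first by rewrite eF1 nE mxyzE.
  by move: sum_a; rewrite -addnn; lia.
move=> Q [i [Qi nQ]].
have nzQ : nz Q.
  exists (cyc i); apply: nQ; by case: (ord3P i) => ->.
have [_ _ _ _ h] := locF' Q nzQ; apply: h => -[[h0 h1 h2]|tr].
  by move: (nQ (cyc i)) (nQ (cyc (cyc i))) h0 h1 h2; case: (ord3P i) => ->; rewrite /cyc !vec3E;
    move=> /(_ isT) q1 /(_ isT) q2 /eqP h0 /eqP h1 /eqP h2; move: h0 h1 h2; rewrite !mulf_eq0
    ?(negPf q1) ?(negPf q2).
have w0 := w_neq0 w2.
suff [x0 y0 z0] : [/\ Q i0 != 0, Q i1 != 0 & Q i2 != 0].
  by move: Qi; case: (ord3P i) => -> /eqP; apply/negP.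
by case: tr => /triangle_neq0; apply=> //; rewrite ?oner_neq0 ?expf_neq0.
Qed.

End GoodSigma.

(** * The foliation with q = 0 *)

Section CubicPrime.
Variable K : fieldType.
Implicit Types (A B C G H : {mpoly K[3]}).

Variables (l g' : {mpoly K[3]}).
Hypothesis size_l : msize l = 2%N.
Hypothesis prime_l : prime_elt l.
Hypothesis l_g' : ~ mdvd l g'.
Let g := l * g'.

(* The norm of A + B X + C X^2 modulo X^3 - g: as l divides g exactly once, its
   zeros are divisible by l indefinitely. *)
Let normp A B C := A ^+ 3 + g * B ^+ 3 + g ^+ 2 * C ^+ 3 - 3%:R * g * A * B * C.

Lemma l_neq0 : l != 0.
Proof. by apply: contra_eq_neq size_l => ->; rewrite msize0. Qed.

Lemma prime_cube A : mdvd l (A ^+ 3) -> mdvd l A.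
Proof. by rewrite !exprS expr0 mulr1 => /prime_l[//|/prime_l[]]. Qed.

Lemma norm_descent A B C : normp A B C = 0 ->
  exists A1 B1 C1, [/\ A = l * A1, B = l * B1, C = l * C1 & normp A1 B1 C1 = 0].
Proof.
have l0 := l_neq0; rewrite /normp => n0.
have [|A1 eA] := @prime_cube A.
  exists (- (g' * B ^+ 3 + l * g' ^+ 2 * C ^+ 3 - 3%:R * g' * A * B * C)).
  by apply/eqP; rewrite -subr_eq0; apply/eqP; rewrite -[RHS]n0 /g; ring.
have : mdvd l (g' * B ^+ 3).
  exists (- (l * A1 ^+ 3 + g' ^+ 2 * C ^+ 3 - 3%:R * g' * A1 * B * C)).
  apply: (mulfI l0); apply/eqP; rewrite -subr_eq0; apply/eqP.
  by rewrite -[RHS]n0 /g eA; ring.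
case/prime_l=> [/l_g'//|/prime_cube[B1 eB]].
have : mdvd l (g' ^+ 2 * C ^+ 3).
  exists (- (A1 ^+ 3 + l * g' * B1 ^+ 3 - 3%:R * g' * A1 * B1 * C)).
  apply: (mulfI (mulf_neq0 l0 l0)); apply/eqP; rewrite -subr_eq0; apply/eqP.
  by rewrite -[RHS]n0 /g eA eB; ring.
case/prime_l => [|/prime_cube[C1 eC]]; first by rewrite expr2 => /prime_l[] /l_g'.
exists A1, B1, C1; split; rewrite 1?mulrC //.
apply: (mulfI (expf_neq0 3 l0)); rewrite mulr0 -[RHS]n0 eA eB eC; ring.
Qed.

Lemma norm_eq0 A B C : normp A B C = 0 -> [/\ A = 0, B = 0 & C = 0].
Proof.
have [n] := ubnP (msize A + msize B + msize C); elim: n A B C => // n IHn A B C hn n0.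
have [A1 [B1 [C1 [eA eB eC n1]]]] := norm_descent n0.
have size_mul p : msize (l * p) = if p == 0 then 0%N else (msize p).+1.
  have [->|p0] := eqVneq p 0; first by rewrite mulr0 msize0.
  by rewrite msizeM ?l_neq0 // size_l.
have zero p : p = 0 -> l * p = 0 by move->; rewrite mulr0.
have [/and3P[/eqP a /eqP b /eqP c]|nz] := boolP [&& A1 == 0, B1 == 0 & C1 == 0].
  by rewrite eA eB eC !zero.
suff [a b c] : [/\ A1 = 0, B1 = 0 & C1 = 0] by rewrite eA eB eC !zero.
apply: IHn n1; move: hn nz; rewrite eA eB eC !size_mul.
by case: (eqVneq A1 0) => [->|_]; case: (eqVneq B1 0) => [->|_]; case: (eqVneq C1 0) => [->|_];
  rewrite ?msize0 //=; lia.
Qed.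

Let P : {poly {mpoly K[3]}} := 'X^3 - g%:P.

Lemma size_P : size P = 4%N.
Proof. by rewrite size_addl size_polyXn // size_opp (leq_ltn_trans (size_polyC_leq1 _)). Qed.

Lemma monic_P : P \is monic.
Proof.
rewrite monicE lead_coefE size_P coefB coefXn coefC /= subr0 //.
Qed.

Lemma const_mdvd (c : {mpoly K[3]}) : mdvd P c%:P -> c = 0.
Proof.
case=> H e; have [H0|H0] := eqVneq H 0.
  by move/eqP: e; rewrite H0 mul0r polyC_eq0 => /eqP.
have := size_polyC_leq1 c; rewrite e size_Mmonic ?monic_P // size_P.
by rewrite -size_poly_gt0 in H0; lia.
Qed.

(** If [P] divides G H, it divides the product of the norms of the two remainders. This product is
    constant in ['X], hence zero, and a remainder of zero norm is zero. Thus a hypothesis of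
    Eisenstein type yields primality, not just irreducibility. *)
Lemma prime_cubic : prime_elt P.
Proof.
move=> G H GH.
pose r (p : {poly {mpoly K[3]}}) := Pdiv.Ring.rmodp p P.
have r_eq p : p = Pdiv.Ring.rdivp p P * P + r p.
  by rewrite -(Pdiv.RingMonic.rdivp_eq monic_P).
have size_r p : (size (r p) <= 3)%N.
  rewrite -ltnS -size_P Pdiv.Ring.ltn_rmodpN0 //; exact: (monic_neq0 monic_P).
have r_exp p : r p = ((r p)`_0)%:P + ((r p)`_1)%:P * 'X + ((r p)`_2)%:P * 'X^2.
  apply/polyP => k; rewrite !coefD coefC !coefCM coefX coefXn.
  case: k => [|[|[|k]]] /=; rewrite ?mulr0 ?mulr1 ?addr0 ?add0r //.
  by rewrite nth_default // (leq_trans (size_r p)).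
pose n p := normp (r p)`_0 (r p)`_1 (r p)`_2.
(* The cofactor of the remainder in its norm, modulo 'X^3 = g. *)
pose adj p : {poly {mpoly K[3]}} := ((r p)`_0 ^+ 2 - g * (r p)`_1 * (r p)`_2)%:P
  + (g * (r p)`_2 ^+ 2 - (r p)`_0 * (r p)`_1)%:P * 'X
  + ((r p)`_1 ^+ 2 - (r p)`_0 * (r p)`_2)%:P * 'X^2.
have adjE p : mdvd P ((n p)%:P - r p * adj p).
  rewrite {1}r_exp /n /normp /adj.
  set a := (r p)`_0; set b := (r p)`_1; set c := (r p)`_2.
  exists (- (b%:P * (b ^+ 2 - a * c)%:P + c%:P * (g * c ^+ 2 - a * b)%:P + c%:P * (b ^+ 2 - a *
    c)%:P * 'X)).
  rewrite /P !(polyCB, polyCD, polyCM, polyC_exp, polyCN) polyC1.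
  ring.
have rr : mdvd P (r G * r H).
  have -> : r G * r H = G * H - Pdiv.Ring.rdivp G P * H * P - r G * Pdiv.Ring.rdivp H P * P.
    by rewrite {2}(r_eq G) {2 3}(r_eq H); ring.
  by do 2 (apply: mdvd_add; last by apply/mdvd_opp/mdvd_mull/mdvd_refl).
have nn : n G * n H = 0.
  apply: const_mdvd; rewrite polyCM.
  have e (u v x y x' y' : {poly {mpoly K[3]}}) : u * v = (u - x * y) * v +
    x * y * (v - x' * y') + (y * y') * (x * x') by ring.
  rewrite (e _ _ (r G) (adj G) (r H) (adj H)).
  apply: mdvd_add; first apply: mdvd_add.
  - exact: mdvd_mulr.
  - exact: mdvd_mull.
  - exact: mdvd_mull.
have fin p : n p = 0 -> mdvd P p.
  move/norm_eq0=> [a b c]; rewrite (r_eq p) r_exp a b c polyC0 !mul0r !addr0.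
  by apply/mdvd_mull/mdvd_refl.
by move/eqP: nn; rewrite mulf_eq0 => /orP[] /eqP /fin; [left|right].
Qed.

End CubicPrime.

Section Pencil.
Variable K : fieldType.
Hypothesis three_neq0 : 3%:R != 0 :> K.
Implicit Types (F G H : {mpoly K[3]}).

Definition fermat (a b c : K) : {mpoly K[3]} :=
  a%:MP * 'X_i0 ^+ 3 + b%:MP * 'X_i1 ^+ 3 + c%:MP * 'X_i2 ^+ 3.

Lemma prime_line (i j : 'I_3) (c : K) : i != j -> prime_elt ('X_i - c%:MP * 'X_j : {mpoly K[3]}).
Proof.
move=> ij; pose psi k : {mpoly K[3]} := if k == i then c%:MP * 'X_j else 'X_k.
apply: (@prime_retract _ psi) => [k|].
  rewrite /psi; case: eqP => [->|_]; first exact: mdvd_refl.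
  by rewrite subrr; apply: mdvd0.
by rewrite pullB pullM pullC !pullX /psi eqxx eq_sym (negPf ij) subrr.
Qed.

Lemma line_neq0 (i j : 'I_3) (c : K) : i != j -> 'X_i - c%:MP * 'X_j != 0 :> {mpoly K[3]}.
Proof.
move=> ij; apply/eqP => /(congr1 (meval (fun k => (k == i)%:R)))/eqP.
by rewrite meval0 mevalB mevalM mevalC !mevalXU eqxx (eq_sym j) (negPf ij) mulr0 subr0 oner_eq0.
Qed.

Lemma homog_line (i j : 'I_3) (c : K) : 'X_i - c%:MP * 'X_j \is 1.-homog.
Proof. by rewrite rpredB ?mul_mpolyC ?rpredZ // dhomogX /= mdeg1. Qed.

Lemma msize_homog F d : F != 0 -> F \is d.-homog -> msize F = d.+1.
Proof.
move=> F0 hF; have := dhomog_uniq F0 (dhomog_msize hF) hF.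
by have := F0; rewrite -msize_poly_eq0; case: (msize F) => //= k _ ->.
Qed.

(** As a cubic in x it is a ('X^3 - g), and y - r z divides g exactly once: the cofactor takes the
    value -3 b r^2 / a at (y, z) = (r, 1). *)
Lemma prime_fermat (a b c r : K) : a != 0 -> b != 0 -> c != 0 -> r ^+ 3 = - c / b ->
  prime_elt (fermat a b c).
Proof.
move=> a0 b0 c0 er.
have r0 : r != 0 by apply: contra_eq_neq er => ->; rewrite expr0n eq_sym mulf_neq0 ?oppr_eq0
  ?invr_eq0.
pose l : {mpoly K[3]} := 'X_i1 - r%:MP * 'X_i2.
pose g' : {mpoly K[3]} := (- b / a)%:MP * ('X_i1 ^+ 2 + r%:MP * 'X_i1 * 'X_i2 + r%:MP ^+ 2 *
  'X_i2 ^+ 2).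
have l_g' : ~ mdvd l g'.
  case=> H /(congr1 (meval (vec3 0 r 1)))/eqP.
  rewrite /g' /l !(mevalM, mevalB, mevalD, mevalC, mevalXU) !vec3E !mulr1 subrr mulr0.
  rewrite (_ : r * r + r * r + r * r = 3%:R * r ^+ 2); last by ring.
  by apply/negP; rewrite !mulf_neq0 ?invr_eq0 ?oppr_eq0 ?expf_neq0 //.
have Pprime := @prime_cubic _ l g' (msize_homog (line_neq0 r (isT : i1 != i2)) (homog_line _ _
  _)) (prime_line (isT : i1 != i2)) l_g'.
set P := 'X^3 - _ in Pprime.
pose f : {rmorphism K -> {poly {mpoly K[3]}}} := polyC \o @mpolyC 3 K.
pose v : 'I_3 -> {poly {mpoly K[3]}} := vec3 'X ('X_i1)%:P ('X_i2)%:P.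
have PhiX i : mmap f v 'X_i = v i by rewrite mmapX mmap1U.
have PhiC d : mmap f v d%:MP = (d%:MP)%:P by rewrite mmapC.
have ePhi : mmap f v (fermat a b c) = (a%:MP)%:P * P.
  rewrite /fermat !(rmorphD, rmorphM, rmorphXn) /= !PhiX !PhiC /v !vec3E /P /l /g'.
  rewrite (_ : c = - b * r ^+ 3); last by rewrite er; field; rewrite b0.
  rewrite !(polyCM, polyCB, polyCD, polyC_exp) mulrBr.
  rewrite mpolyCM mpolyCN rmorphXn /= polyCM polyC_exp polyCN.
  have -> : ((- b / a)%:MP)%:P = - (b%:MP_[3])%:P * ((a^-1)%:MP)%:P.
    by rewrite mpolyCM mpolyCN polyCM polyCN.
  have ea : (a%:MP_[3])%:P * ((a^-1)%:MP)%:P = 1 :> {poly _}.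
    by rewrite -polyCM -mpolyCM divff.
  ring: ea.
have back F : (mmap f v F).['X_i0] = F.
  have -> : (mmap f v F).['X_i0] = horner_eval 'X_i0 (mmap f v F) by [].
  rewrite rmorph_mmap -[RHS]mmap_X; apply: mmap_eq => [d|i] /=.
    by rewrite /horner_eval hornerC.
  by rewrite /horner_eval /v; case: (ord3P i) => ->; rewrite vec3E ?hornerX ?hornerC.
have ea : a%:MP_[3] * (a^-1)%:MP = 1 by rewrite -mpolyCM divff.
have eP : fermat a b c = a%:MP * P.['X_i0].
  by rewrite -[LHS]back ePhi hornerM hornerC.
have down F : mdvd P (mmap f v F) -> mdvd (fermat a b c) F.
  case=> H e; exists (H.['X_i0] * (a^-1)%:MP); rewrite -[LHS]back e hornerM eP.
  by rewrite mulrA -[_ * a%:MP]mulrA [_ * a%:MP]mulrC ea mulr1.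
move=> A B [H e].
have : mdvd P (mmap f v A * mmap f v B).
  by rewrite -rmorphM e rmorphM /= ePhi mulrA; exists (mmap f v H * (a%:MP)%:P).
by case/Pprime => /down; [left|right].
Qed.

End Pencil.

(** * Conjugates under the cubic roots of unity *)

Section CyclicNorm.
Variable K : fieldType.
Variable w : K.
Hypothesis w2 : w ^+ 2 = - w - 1.
Hypothesis three_neq0 : 3%:R != 0 :> K.
Hypothesis char0 : forall n, n.+1%:R != 0 :> K.
Implicit Types (F G H : {mpoly K[3]}).

Definition rotate (c i : 'I_3) : {mpoly K[3]} := (if i == c then w else 1)%:MP * 'X_i.

Let w3 := w3 w2.

Lemma rotate3 c F : pull (rotate c) (pull (rotate c) (pull (rotate c) F)) = F.
Proof.
rewrite !pull_comp -[RHS]pull_id; apply: eq_pull => i.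
rewrite /rotate !(pullM, pullC, pullX).
case: eqP => _; last by rewrite mpolyC1; ring.
have W : w%:MP_[3] ^+ 3 = 1 by rewrite -rmorphXn w3 rmorph1.
by ring: W.
Qed.

Lemma rotateC c c' F :
  pull (rotate c) (pull (rotate c') F) = pull (rotate c') (pull (rotate c) F).
Proof.
by rewrite !pull_comp; apply: eq_pull => i; rewrite /rotate !(pullM, pullC, pullX); ring.
Qed.

Lemma coef_rotate c F m : (pull (rotate c) F)@_m = w ^+ m c * F@_m.
Proof.
have rX k : pull (rotate c) 'X_[k] = (w ^+ k c)%:MP * 'X_[k] :> {mpoly K[3]}.
  rewrite pullE mmapX /mmap1 mpolyXE_id rmorphXn /= !prod3 /rotate.
  by rewrite !exprMn; case: (ord3P c) => -> /=; rewrite !mpolyC1 !expr1n; ring.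
elim/mpolyind: F => [|a k p _ _ IHp]; first by rewrite rmorph0 mcoeff0 mulr0.
rewrite pullD pullZ rX mcoeffD IHp mul_mpolyC scalerA mcoeffD !mcoeffZ mcoeffX.
have [->|_] := eqVneq k m; first by ring.
by rewrite !mulr0 !add0r.
Qed.

Definition nrm c F := F * (pull (rotate c) F * pull (rotate c) (pull (rotate c) F)).

Lemma nrm_fixed c F : pull (rotate c) (nrm c F) = nrm c F.
Proof. by rewrite /nrm !pullM rotate3; ring. Qed.

Lemma pull_nrm c c' F : pull (rotate c') (nrm c F) = nrm c (pull (rotate c') F).
Proof. by rewrite /nrm !pullM !(rotateC c'). Qed.

Lemma homog_rotate c F d : F \is d.-homog -> pull (rotate c) F \is d.-homog.
Proof.
move=> hF; have := @homog_pull _ (rotate c) d 1 F; rewrite mul1n; apply=> // i.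
by rewrite /rotate mul_mpolyC rpredZ // dhomogX /= mdeg1.
Qed.

Lemma homog_nrm c F d : F \is d.-homog -> nrm c F \is (d + (d + d)).-homog.
Proof. by move=> hF; rewrite /nrm !dhomogM ?homog_rotate. Qed.

Lemma undiv_rotate c F : undiv F -> undiv (pull (rotate c) F).
Proof.
move=> uF i; have -> : pull (kill K i) (pull (rotate c) F) = pull (rotate c) (pull (kill K i) F).
  rewrite !pull_comp; apply: eq_pull => j; rewrite /rotate /kill !(pullM, pullC, pullX).
  by case: (j == i); rewrite ?rmorph0 ?mulr0 // pullX.
apply: contra (uF i) => /eqP e.
by rewrite -(rotate3 c (pull (kill K i) F)) e !rmorph0.
Qed.

Lemma undiv_nrm c F : undiv F -> undiv (nrm c F).
Proof. by move=> uF; rewrite /nrm; do !apply: undivM => //; do !apply: undiv_rotate. Qed.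

Lemma invariantM eta F G : invariant_curve eta F -> invariant_curve eta G ->
  invariant_curve eta (F * G).
Proof.
move=> hF hG i j; have [A eA] := hF i j; have [B eB] := hG i j.
have := dvecM eta F G i j; rewrite /dvec => ->; rewrite eA eB.
by exists (A + B); ring.
Qed.

(** For t = 0 the form is a combination of x^2 dx, y^2 dy and z^2 dz with coefficients in the cubes,
    all fixed by [rotate]. *)
Lemma invariant_rotate s c F : invariant_curve (form4 s 0) F ->
  invariant_curve (form4 s 0) (pull (rotate c) F).
Proof.
move=> invF i j; have := @invariant_pull _ (form4 s 0) (form4 s 0) 1 (rotate c) F _ invF i j.
rewrite mul1r; apply=> k.
have W : w%:MP_[3] ^+ 3 = 1 by rewrite -rmorphXn w3 rmorph1.
have W' : w%:MP_[3] ^+ 2 = - w%:MP_[3] - 1 by rewrite -rmorphXn w2 rmorphB rmorphN rmorph1.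
rewrite sum3 /form4 !vec3E !(pullXn, pullB, pullM) !pullX !pullC mpolyC0 /rotate.
by case: (ord3P c) => ->; case: (ord3P k) => -> /=; rewrite !(mderivM, mderivC, mderivXi) /=
  ?vec3E; ring: W'.
Qed.

Lemma invariant_nrm s c F : invariant_curve (form4 s 0) F ->
  invariant_curve (form4 s 0) (nrm c F).
Proof. by move=> invF; rewrite /nrm; do !apply: invariantM => //; do !apply: invariant_rotate. Qed.

Definition cube (i : 'I_3) : {mpoly K[3]} := 'X_i ^+ 3.

Lemma pull_cubeX m : pull cube 'X_[m] = 'X_[(m *+ 3)%MM].
Proof.
rewrite pullE mmapX !mpolyXE_id; apply: eq_bigr => i _.
by rewrite /cube -exprM mulmnE mulnC.
Qed.

Lemma pull_cube_inj : injective (pull cube).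
Proof.
have coef F m : (pull cube F)@_(m *+ 3) = F@_m.
  elim/mpolyind: F => [|a k p _ _ IHp]; first by rewrite rmorph0 !mcoeff0.
  rewrite pullD pullZ pull_cubeX !mcoeffD IHp !mcoeffZ !mcoeffX.
  suff -> : (k *+ 3 == m *+ 3)%MM = (k == m) by [].
  apply/eqP/eqP => [e|->//]; apply/mnmP => i.
  by have := congr1 (fun h : 'X_{1..3} => h i) e; rewrite !mulmnE; lia.
by move=> F G e; apply/mpolyP => m; rewrite -coef e coef.
Qed.

(** The coefficient of a monomial is multiplied by a power of [w] given by one exponent; as [w] is a
    primitive cubic root of unity, all exponents that occur are multiples of 3. *)
Lemma cube_root_fixed F d : F \is (3 * d).-homog ->
    (forall c, pull (rotate c) F = F) ->
  exists2 N, F = pull cube N & N \is d.-homog.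
Proof.
move=> /dhomogP hF fixF.
have dvd m i : m \in msupp F -> (3 %| m i)%N.
  rewrite mcoeff_msupp => mF; have := coef_rotate i F m; rewrite fixF => /eqP.
  rewrite -subr_eq0 -{1}[F@_m]mul1r -mulrBl mulf_eq0 (negPf mF) orbF subr_eq0.
  rewrite {1}(divn_eq (m i) 3) exprD mulnC exprM w3 expr1n mul1r.
  have w1 : w != 1.
    apply: contra_neq three_neq0 => e; have := w2; rewrite e => e2.
    by transitivity (1 ^+ 2 + 1 + 1 : K); [ring|rewrite e2; ring].
  rewrite /dvdn; case: (m i %% 3)%N (ltn_pmod (m i) (isT : 0 < 3)%N) => [|[|[|//]]] _ //.
    by rewrite expr1 eq_sym (negPf w1).
  rewrite eq_sym => /eqP e; have /eqP := w3; rewrite exprS e mulr1.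
  by rewrite (negPf w1).
exists (\sum_(m <- msupp F) F@_m *: 'X_[[multinom (m i %/ 3)%N | i < 3]]).
  rewrite (raddf_sum (pull cube)) {1}[F]mpolyE !big_seq; apply: eq_bigr => m mF.
  rewrite /= pullZ pull_cubeX; congr (_ *: 'X_[_]); apply/mnmP => i.
  by rewrite mulmnE mnmE divnK // dvd.
rewrite big_seq; apply: rpred_sum => m mF; apply: rpredZ; rewrite dhomogX /=.
rewrite -(eqn_pmul2l (isT : (0 < 3)%N)); apply/eqP.
apply: etrans (hF m mF).
rewrite /= !mdegE big_distrr; apply: eq_bigr => i _.
by rewrite mnmE; apply: etrans (mulnC _ _) _; apply: divnK (dvd m i mF).
Qed.

End CyclicNorm.

(** * Splitting of binary forms and prime factors *)

Section BinaryForms.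
Variables (K : closedFieldType) (A B : {mpoly K[3]}).

Definition binary n (p : {poly K}) : {mpoly K[3]} :=
  \sum_(k < n.+1) p`_k *: (A ^+ (n - k) * B ^+ k).

Lemma binaryM n (p : {poly K}) r : (size p <= n.+1)%N ->
  binary n.+1 (('X - r%:P) * p) = (- r *: A + 1 *: B) * binary n p.
Proof.
move=> hp; rewrite /binary [RHS]mulrDl.
rewrite (eq_bigr (fun k : 'I_n.+2 => (if k == 0 :> nat then 0 else p`_k.-1) *: (A ^+ (n.+1 - k) *
  B ^+ k)
   + (- r * p`_k) *: (A ^+ (n.+1 - k) * B ^+ k))) => [|k _]; last first.
  by rewrite -scalerDl mulrBl coefB coefXM coefCM mulNr.
rewrite big_split /= [LHS]addrC; congr (_ + _).
  rewrite big_ord_recr /= nth_default // mulr0 scale0r addr0 mulr_sumr.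
  apply: eq_bigr => k _; rewrite subSn -1?ltnS // exprS -!scalerAr -!scalerAl scalerA mulrC.
  by rewrite mulrA.
rewrite big_ord_recl /= scale0r add0r mulr_sumr; apply: eq_bigr => k _.
by rewrite /bump /= add1n subSS scale1r -scalerAr exprS; congr (_ *: _); ring.
Qed.

(** The degree missing to n is that of the root at infinity, each occurrence of which gives a factor
    [A], coded by (1, 0). *)
Lemma binary_prod n rs : (size rs <= n)%N ->
  binary n (\prod_(z <- rs) ('X - z%:P)) =
  \prod_(x <- nseq (n - size rs) (1, 0) ++ [seq (- z, 1) | z <- rs]) (x.1 *: A + x.2 *: B).
Proof.
elim: rs n => [|z rs IHrs] n.
  rewrite big_nil subn0 cats0 big_nseq iter_mulr_1 scale1r scale0r addr0 /binary => _.
  rewrite big_ord_recl big1 ?addr0 => [|k _]; last by rewrite coefC scale0r.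
  by rewrite coefC scale1r subn0 mulr1.
case: n => // n hn; rewrite big_cons binaryM; last by rewrite size_prod_XsubC.
by rewrite IHrs // !big_cat /= big_cons subSS /=; ring.
Qed.

Lemma binary_split n (t : nat -> K) : \sum_(k < n.+1) t k *: (A ^+ (n - k) * B ^+ k) != 0 ->
  exists c (s : seq (K * K)), [/\ c != 0, all (fun x => x != (0, 0)) s &
    \sum_(k < n.+1) t k *: (A ^+ (n - k) * B ^+ k) = c *: \prod_(x <- s) (x.1 *: A + x.2 *: B)].
Proof.
pose p := \poly_(k < n.+1) t k.
have -> : \sum_(k < n.+1) t k *: (A ^+ (n - k) * B ^+ k) = binary n p.
  by apply: eq_bigr => k _; rewrite coef_poly ltn_ord.
have [rs def_p] := closed_field_poly_normal p.
move=> nz; have p0 : p != 0.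
  by apply: contraNneq nz => ->; apply/eqP; apply: big1 => k _; rewrite coef0 scale0r.
have hs : (size rs <= n)%N.
  have : (size p <= n.+1)%N by apply: size_poly.
  by rewrite {1}def_p size_scale ?lead_coef_eq0 // size_prod_XsubC.
exists (lead_coef p), (nseq (n - size rs) (1, 0) ++ [seq (- z, 1) | z <- rs]); split.
- by rewrite lead_coef_eq0.
- rewrite all_cat all_nseq all_map xpair_eqE oner_eq0 orbT; apply/allP => z _ /=.
  by rewrite xpair_eqE oner_eq0 andbF.
- rewrite -binary_prod // {1}def_p /binary scaler_sumr; apply: eq_bigr => k _.
  by rewrite coefZ scalerA.
Qed.

End BinaryForms.

Section PrimeFactors.
Variable K : fieldType.
Implicit Types F G H q : {mpoly K[3]}.

Definition prime_poly q := [/\ prime_elt q, q != 0 & q \isn't a GRing.unit].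

Lemma irreducible_factor (s : seq {mpoly K[3]}) F H c : c != 0 ->
    irreducible_mpoly F -> (forall q, q \in s -> prime_poly q) ->
  H * F = c *: \prod_(q <- s) q -> exists k q, q \in s /\ F = k *: q.
Proof.
move=> c0 [F0 nuF irr]; elim: s H => [|q s IHs] H hs.
  rewrite big_nil => e; case/negP: nuF; apply/unitrPr; exists (c^-1 *: H).
  by rewrite -scalerAr mulrC e scalerA mulVf // scale1r.
rewrite big_cons => e; have [pq q0 nuq] := hs q (mem_head _ _).
have : mdvd q (H * F) by rewrite e scalerAr; exists (c *: \prod_(j <- s) j); rewrite mulrC.
case/pq => [[H1 eH]|[F1 eF]].
  have [||k [q' [q's eF]]] := IHs H1.
  - by move=> q' q's; apply: hs; rewrite in_cons q's orbT.
  - by apply: (mulfI q0); rewrite -scalerAr -e eH; ring.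
  - by exists k, q'; rewrite in_cons q's orbT.
have [/unit_mpolyP[k _ eF1]|uq] := irr _ _ eF; last by rewrite uq in nuq.
by exists k, q; rewrite mem_head eF eF1 mul_mpolyC.
Qed.

End PrimeFactors.

(** * Curves of the cubic pencil *)

Section Base.
Variables (K : closedFieldType) (w : K).
Hypothesis w2 : w ^+ 2 = - w - 1.
Hypothesis three_neq0 : 3%:R != 0 :> K.
Hypothesis char0 : forall n, n.+1%:R != 0 :> K.
Implicit Types (F G H N q : {mpoly K[3]}).

Definition lines3 (i j : 'I_3) : seq {mpoly K[3]} :=
  [seq 'X_i - c%:MP * 'X_j | c <- [:: 1; w; w ^+ 2]].

Definition lines9 : seq {mpoly K[3]} := lines3 i0 i1 ++ lines3 i0 i2 ++ lines3 i1 i2.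

Lemma lines9_01 : {subset lines3 i0 i1 <= lines9}.
Proof. by move=> q; rewrite [q \in lines9]mem_cat => ->. Qed.

Lemma lines9_02 : {subset lines3 i0 i2 <= lines9}.
Proof. by move=> q h; rewrite mem_cat; apply/orP; right; rewrite mem_cat h. Qed.

Lemma lines9_12 : {subset lines3 i1 i2 <= lines9}.
Proof.
by move=> q h; rewrite mem_cat; apply/orP; right; rewrite mem_cat; apply/orP; right.
Qed.

Definition proper_fermat q := exists a b c : K,
  [/\ a != 0, b != 0, c != 0, a + b + c = 0 & q = fermat a b c].

Lemma prod_lines3 i j : \prod_(q <- lines3 i j) q = 'X_i ^+ 3 - 'X_j ^+ 3.
Proof.
have W : w%:MP_[3] ^+ 2 = - w%:MP_[3] - 1 by rewrite -rmorphXn w2 rmorphB rmorphN rmorph1.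
rewrite /lines3 !big_cons big_nil mpolyC1.
have -> : (w ^+ 2)%:MP_[3] = w%:MP_[3] ^+ 2 by rewrite rmorphXn.
by ring: W.
Qed.

Lemma prime_poly_homog q d : (0 < d)%N -> q \is d.-homog -> q != 0 -> prime_elt q -> prime_poly q.
Proof.
move=> d0 hq q0 pq; split=> //; apply/unit_mpolyP => -[c c0 e].
have := msize_homog q0 hq; rewrite e msizeC c0 => -[d1].
by rewrite -d1 in d0.
Qed.

Lemma prime_lines3 i j q : i != j -> q \in lines3 i j -> prime_poly q.
Proof.
move=> ij /mapP[c _ ->]; apply: (@prime_poly_homog _ 1) => //.
- exact: homog_line.
- exact: line_neq0.
- exact: prime_line.
Qed.

Lemma homog_X i : 'X_i \is [in K[3], 1.-homog].
Proof. by rewrite dhomogX /= mdeg1. Qed.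

Lemma homog_X3 i : 'X_i ^+ 3 \is [in K[3], 3.-homog].
Proof. exact: (dhomogM (homog_X i) (dhomogM (homog_X i) (homog_X i))). Qed.

Lemma homog_fermat (a b c : K) : fermat a b c \is 3.-homog.
Proof.
have h (k : K) (i : 'I_3) : k%:MP * 'X_i ^+ 3 \is 3.-homog.
  by rewrite mul_mpolyC rpredZ // homog_X3.
by rewrite /fermat !rpredD ?h.
Qed.

Lemma fermat_neq0 (a b c : K) : a != 0 -> fermat a b c != 0.
Proof.
move=> a0; apply/eqP => /(congr1 (meval (vec3 1 0 0)))/eqP.
rewrite meval0 /fermat !(mevalD, mevalM, mevalC, mevalXU) !vec3E.
by rewrite !(mulr0, mulr1, mul0r, addr0) (negPf a0).
Qed.

Lemma exists_root3 (x : K) : exists r, r ^+ 3 = x.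
Proof.
have [r er] := @solve_monicpoly K 3 (fun i => x *+ (i == 0%N)) isT.
by exists r; rewrite er !big_ord_recl big_ord0 /=; ring.
Qed.

Lemma prime_proper_fermat q : proper_fermat q -> prime_poly q.
Proof.
case=> a [b [c [a0 b0 c0 _ ->]]]; have [r er] := exists_root3 (- c / b).
apply: (@prime_poly_homog _ 3) => //.
- exact: homog_fermat.
- exact: fermat_neq0.
- exact: prime_fermat er.
Qed.

Definition component q := q \in lines9 \/ proper_fermat q.

Lemma prime_component q : component q -> prime_poly q.
Proof.
case; last exact: prime_proper_fermat.
by rewrite !mem_cat => /or3P[] /prime_lines3; apply.
Qed.

(** The member b x^3 + c y^3 - (b + c) z^3 is prime if its three coefficients are nonzero; otherwise
    it is a multiple of a difference of two cubes. *)
Lemma pencil_factor (x : K * K) : x != (0, 0) -> exists c (s : seq {mpoly K[3]}),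
  [/\ c != 0, forall q, q \in s -> component q &
    x.1 *: ('X_i0 ^+ 3 - 'X_i2 ^+ 3) + x.2 *: ('X_i1 ^+ 3 - 'X_i2 ^+ 3) = c *: \prod_(q <- s) q].
Proof.
case: x => b c; rewrite xpair_eqE negb_and /= => bc.
have [b0|b0] := eqVneq b 0.
  exists c, (lines3 i1 i2); split; first by move: bc; rewrite b0 eqxx.
    by move=> q qs; left; exact: lines9_12 qs.
  by rewrite prod_lines3 b0 scale0r add0r.
have [c0|c0] := eqVneq c 0.
  exists b, (lines3 i0 i2); split=> //.
    by move=> q qs; left; exact: lines9_02 qs.
  by rewrite prod_lines3 c0 scale0r addr0.
have [d0|d0] := eqVneq (b + c) 0.
  exists b, (lines3 i0 i1); split=> //.
    by move=> q qs; left; exact: lines9_01 qs.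
  rewrite prod_lines3 (_ : c = - b); last by apply/eqP; rewrite -addr_eq0 addrC d0.
  by rewrite scaleNr -scalerBr; congr (_ *: _); ring.
exists 1, [:: fermat b c (- (b + c))]; split; first exact: oner_neq0.
  by move=> q; rewrite inE => /eqP->; right; exists b, c, (- (b + c)); rewrite oppr_eq0 subrr.
rewrite big_seq1 scale1r /fermat mpolyCN mpolyCD -!mul_mpolyC; ring.
Qed.

Lemma pencil_prod_factor (s : seq (K * K)) : all (fun x => x != (0, 0)) s ->
  exists c (s' : seq {mpoly K[3]}), [/\ c != 0, forall q, q \in s' -> component q &
    \prod_(x <- s) (x.1 *: ('X_i0 ^+ 3 - 'X_i2 ^+ 3) + x.2 *: ('X_i1 ^+ 3 - 'X_i2 ^+ 3))
      = c *: \prod_(q <- s') q].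
Proof.
elim: s => [_|x s IHs /= /andP[/pencil_factor[c [s1 [c0 h1 e1]]] /IHs[c' [s2 [c'0 h2 e2]]]]].
  by exists 1, [::]; rewrite !big_nil scale1r oner_neq0.
exists (c * c'), (s1 ++ s2); split; first exact: mulf_neq0.
  by move=> q; rewrite mem_cat => /orP[/h1|/h2].
by rewrite big_cons e1 e2 big_cat /= -scalerAl -scalerAr scalerA.
Qed.

Lemma homog_mul_mderiv F d G i : F \is d.-homog -> G \is 1.-homog -> F^`M(i) * G \is d.-homog.
Proof.
move=> /dhomogP hF hG.
have dm m : m \in msupp F^`M(i) -> (mdeg m).+1 = d.
  rewrite mcoeff_msupp mcoeff_deriv => h.
  have /hF /= <- : (m + U_(i))%MM \in msupp F.
    by rewrite mcoeff_msupp; apply: contraNneq h => ->; rewrite mul0rn.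
  by rewrite mdegD mdeg1 addn1.
case: d {hF} dm => [|d] dm.
  have -> : F^`M(i) = 0; last by rewrite mul0r dhomog0.
  by apply/mpolyP => m; rewrite mcoeff0 memN_msupp_eq0 //; apply/negP => /dm.
have h : F^`M(i) \is d.-homog by apply/dhomogP => m /dm [].
by have := dhomogM h hG; rewrite addn1.
Qed.

Lemma homog_quotient F G H d : G != 0 -> F \is d.-homog -> G \is d.-homog -> F = H * G ->
  exists c, H = c%:MP.
Proof.
move=> G0 hF hG e; have [->|H0] := eqVneq H 0; first by exists 0; rewrite mpolyC0.
have F0 : F != 0 by rewrite e mulf_neq0.
have := msizeM H0 G0; rewrite -e (msize_homog F0 hF) (msize_homog G0 hG) addnS /=.
move=> h.
have /eqP/msize_poly1P[c _ ->] : msize H = 1%N by apply: (@addIn d); rewrite -h add1n.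
by exists c.
Qed.

(* Invariance gives beta = k N; by Euler's relation 'X_i2 times the sum of the
   derivatives is then (k + n) N, and 'X_i2 does not divide N. *)
Lemma invariant_cube s N n : s != 0 -> N \is n.-homog -> undiv (pull (@cube K) N) ->
    invariant_curve (form4 s 0) (pull (@cube K) N) ->
  \sum_i N^`M(i) = 0.
Proof.
move=> s0 hN uM invM; set P := pull (@cube K).
have dP F k : (P F)^`M(k) = 3%:R%:MP * 'X_k ^+ 2 * P F^`M(k).
  have d3 (j : 'I_3) : (@cube K j)^`M(k) = (j == k)%:R * (3%:R%:MP * 'X_k ^+ 2).
    rewrite /cube !exprS expr0 mulr1 !mderivM mderivXi mpolyC_nat.
    by case: eqP => [->|_] /=; ring.
  rewrite /P mderiv_pull (bigD1 k) //= big1 => [|j jk]; rewrite d3.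
    by rewrite eqxx /=; ring.
  by rewrite (negPf jk) /=; ring.
pose beta := N^`M(i0) * ('X_i2 - 'X_i0) - N^`M(i1) * ('X_i1 - 'X_i2).
have [H eH] := invM i0 i1.
have e1 : P N * H = 'X_[U_(i0) + U_(i0) + (U_(i1) + U_(i1))] * ((- 3%:R * s)%:MP * P beta).
  rewrite mulrC -eH -/P !dP /form4 !vec3E !mpolyXD mpolyCM mpolyCN mpolyC0 /beta.
  by rewrite /P !(pullB, pullM) !pullX /cube; ring.
have [B _ eB] := mono_cancel uM e1.
have c0 : - 3%:R * s != 0 by rewrite mulf_neq0 ?oppr_eq0.
have uN i : pull (kill K i) N != 0.
  apply: contraTneq (uM i) => e; apply/negPn/eqP.
  have -> : pull (kill K i) (P N) = P (pull (kill K i) N).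
    rewrite /P !pull_comp; apply: eq_pull => j; rewrite /kill /cube pullXn pullX.
    by case: eqP; rewrite ?rmorph0 ?expr0n // pullX.
  by rewrite e /P rmorph0.
have hb : beta \is n.-homog by rewrite rpredB // homog_mul_mderiv // rpredB // homog_X.
have hP G : G \is n.-homog -> P G \is (3 * n).-homog.
  by apply: homog_pull => i; apply: homog_X3.
have [k ek] : exists k : K, beta = k *: N.
  have e2 : (- 3%:R * s) *: P beta = B * P N by rewrite -mul_mpolyC -eB mulrC.
  have [c ec] := homog_quotient (undiv_neq0 uM) (rpredZ _ (hP _ hb)) (hP _ hN) e2.
  exists ((- 3%:R * s)^-1 * c); apply: pull_cube_inj; first exact: three_neq0.
  by rewrite pullZ -scalerA -[c *: _]mul_mpolyC -/P -ec -e2 scalerA mulVf // scale1r.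
have eu := euler hN; rewrite !sum3 in eu *.
set D := _ + _ + _; have eD : 'X_i2 * D = (k + n%:R) *: N.
  by rewrite scalerDl -ek -eu /beta /D; ring.
have [kn|kn] := eqVneq (k + n%:R) 0.
  by move/eqP: eD; rewrite kn scale0r mulf_eq0 (negPf (mpolyX_neq0 _ _)) => /eqP.
case/negP: (uN i2); apply/eqP/mdvdX; exists ((k + n%:R)^-1 *: D).
by rewrite -scalerAl mulrC eD scalerA mulVf // scale1r.
Qed.

(** The change of variables [T] turns the sum of the partial derivatives into the derivative in z,
    and in characteristic 0 its vanishing means independence of z. *)
Lemma translation_invariant N : \sum_i N^`M(i) = 0 ->
  N = pull (vec3 ('X_i0 - 'X_i2) ('X_i1 - 'X_i2) 0) N.
Proof.
move=> dN; pose T : 'I_3 -> {mpoly K[3]} := vec3 ('X_i0 + 'X_i2) ('X_i1 + 'X_i2) 'X_i2.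
pose T' : 'I_3 -> {mpoly K[3]} := vec3 ('X_i0 - 'X_i2) ('X_i1 - 'X_i2) 'X_i2.
have dT : (pull T N)^`M(i2) = 0.
  rewrite mderiv_pull sum3 /T !vec3E !mderivD !mderivXi /= !add0r !mulr1 -!pullD.
  by have := dN; rewrite sum3 => ->; rewrite rmorph0.
have := congr1 (pull T') (kill_mderiv char0 dT).
rewrite !pull_comp => e; transitivity (pull (fun i => pull T' (T i)) N).
  rewrite -[LHS]pull_id; apply: eq_pull => i.
  by case: (ord3P i) => ->; rewrite /T !vec3E ?pullD !pullX /T' !vec3E ?subrK.
rewrite -e; apply: eq_pull => i.
by case: (ord3P i) => ->; rewrite /T !vec3E ?pullD !pullX /kill /= ?rmorph0 ?addr0 ?pullX.
Qed.

(** With the coordinate lines and the nine lines of the split members excepted, a prime factor of a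
    product of members of the pencil is a Fermat cubic: it is smooth, misses the vertices and passes
    through the nine other points. *)
Lemma Good_base s : s != 0 -> Good w s 0 0 1 1 1.
Proof.
move=> s0; exists ([:: 'X_i0; 'X_i1; 'X_i2] ++ lines9) => F irrF invF nF.
have uF : undiv F.
  case: (irrF) => _ irr; apply: irreducible_undiv irr _ => i k; apply: nF.
  by rewrite mem_cat !inE; case: (ord3P i) => ->; rewrite eqxx ?orbT.
have [[d hF] irr] := irrF.
pose M := nrm w i2 (nrm w i1 (nrm w i0 F)).
have uM : undiv M by do !apply: undiv_nrm => //.
have invM : invariant_curve (form4 s 0) M by do !apply: invariant_nrm => //.
have fixM c : pull (rotate w c) M = M.
  case: (ord3P c) => ->; rewrite /M.
  - by rewrite 2!pull_nrm nrm_fixed.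
  - by rewrite pull_nrm nrm_fixed.
  - by rewrite nrm_fixed.
have [|N eM hN] := @cube_root_fixed _ _ w2 three_neq0 M (9 * d) _ fixM.
  rewrite (_ : 3 * (9 * d) = let e := d + (d + d) in let e' := e + (e + e) in e' + (e' + e'))%N;
    last by lia.
  by do !apply: homog_nrm.
rewrite eM in invM uM.
have dN := invariant_cube s0 hN uM invM.
(* Invariance under translations removes the third argument of [N], leaving a binary form in two
   differences of cubes. *)
have eM2 : M = \sum_(k < (9 * d).+1) (((tay N (vtx0 K))`_k).@[vec3 0 1 0]) *:
    (('X_i0 ^+ 3 - 'X_i2 ^+ 3) ^+ (9 * d - k) * ('X_i1 ^+ 3 - 'X_i2 ^+ 3) ^+ k).
  rewrite eM {1}(translation_invariant dN) pull_comp.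
  (* The factors 1 and 0 bring the substitution into the form (c, e y, e z) required by [slice]. *)
  rewrite (eq_pull (psi := vec3 ('X_i0 ^+ 3 - 'X_i2 ^+ 3) (('X_i1 ^+ 3 - 'X_i2 ^+ 3) * 1) (('X_i1
    ^+ 3 - 'X_i2 ^+ 3) * 0))) => [|i]; last first.
    by case: (ord3P i) => ->; rewrite !vec3E ?pullB ?rmorph0 ?pullX ?mulr1 ?mulr0.
  rewrite pullE (slice _ _ _ _ _ hN); apply: eq_bigr => k _.
  rewrite -mul_mpolyC [RHS]mulrC; congr (_ * _).
  rewrite /meval rmorph_mmap; apply: mmap_eq => [//|i].
  by case: (ord3P i) => ->; rewrite /= !vec3E ?rmorph0 ?rmorph1.
have M0 : M != 0 by rewrite eM undiv_neq0.
have [|c [l [c0 l0 eM3]]] := @binary_split K ('X_i0 ^+ 3 - 'X_i2 ^+ 3) ('X_i1 ^+ 3 - 'X_i2 ^+ 3)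
  (9 * d)
  (fun k => ((tay N (vtx0 K))`_k).@[vec3 0 1 0]).
  by rewrite -eM2.
have [c' [l' [c'0 hl' el']]] := pencil_prod_factor l0.
have [H eH] : mdvd F M.
  by rewrite /M /nrm; do 3 apply: mdvd_mulr; exact: mdvd_refl.
have [||k [q [ql eF]]] := @irreducible_factor _ l' F H (c * c') (mulf_neq0 c0 c'0) irr.
- by move=> q /hl'; apply: prime_component.
- by rewrite -eH eM2 eM3 el' scalerA.
have [F0 _ _] := irr.
have k0 : k != 0 by apply: contraNneq F0 => k0; rewrite eF k0 scale0r.
case: (hl' _ ql) => [q9|[a [b [e [a0 b0 e0 abe eq]]]]].
  by case: (nF q k) => //; rewrite mem_cat q9 orbT.
have dq i v : (fermat a b e)^`M(i).@[v] = 3%:R * vec3 a b e i * v i ^+ 2.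
  by case: (ord3P i) => ->; rewrite /fermat !exprS !expr0 !mulr1 !vec3E !(mderivD, mderivM,
    mderivC, mderivXi) /=
    !(mevalD, mevalM, mevalC, mevalXU, meval1, meval0); ring.
have smF P : nz P -> smooth F P.
  case=> i Pi _; exists i; rewrite eF eq mderivZ mevalZ dq !mulf_neq0 ?expf_neq0 //.
  by case: (ord3P i) => ->; rewrite vec3E.
have qv v : (fermat a b e).@[v] = a * v i0 ^+ 3 + b * v i1 ^+ 3 + e * v i2 ^+ 3.
  by rewrite /fermat !exprS !expr0 !(mevalD, mevalM, mevalC, mevalXU, meval1).
split; first by rewrite eF eq rpredZ // homog_fermat.
have ord1 P : nz P -> F.@[P] = 0 -> Ord F P 1.
  move=> /smF/smooth_Ord[[|[|//]] _ oF FP0 //].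
  by have := simple_zeros_neq0 oF.2; rewrite tay0 FP0 mpolyC0 eqxx.
have ord0 P : nz P -> F.@[P] != 0 -> Ord F P 0.
  move=> /smF/smooth_Ord[[|[|//]] _ oF F0' //].
  by have /eqP := oF.1 0%N isT; rewrite tay0 mpolyC_eq0 (negPf F0').
have tri z P : z != 0 -> nz P -> triangle z P -> Ord F P 1.
  move=> z0 nzP [h0 h1 h2]; apply: ord1 => //.
  have e1 : P i1 ^+ 3 = P i0 ^+ 3.
    apply: (mulfI z0); rewrite !(exprS _ 2) [LHS]mulrCA [RHS]mulrCA -h1 -h0; ring.
  have e2 : P i2 ^+ 3 = P i0 ^+ 3.
    apply: (mulfI z0); rewrite !(exprS _ 2) [LHS]mulrCA [RHS]mulrCA -h2 -h0; ring.
  by rewrite eF eq mevalZ qv e1 e2 -!mulrDl abe mul0r mulr0.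
move=> P nzP; have w0 := w_neq0 w2; split=> [[v0 v1 v2]|||| _].
- apply: ord0 => //; rewrite eF eq mevalZ mulf_neq0 // qv.
  have P3 (x y z u : K) : x != 0 -> y = 0 -> z = 0 -> u != 0 -> u * x ^+ 3 + y + z != 0.
    by move=> x0 -> -> u0; rewrite !addr0 mulf_neq0 ?expf_neq0.
  have z3 (x y u : K) : y != 0 -> x * y = 0 -> u * x ^+ 3 = 0.
    by move=> y0 /eqP; rewrite mulf_eq0 (negPf y0) orbF => /eqP->; rewrite expr0n mulr0.
  case: nzP => i; case: (ord3P i) => -> Pi.
  + by apply: P3 => //; apply: (z3 _ _ _ Pi); rewrite mulrC.
  + by rewrite [X in X + _]addrC; apply: P3 => //; apply: (z3 _ _ _ Pi) => //; rewrite mulrC.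
  + by rewrite addrC addrA; apply: P3 => //; apply: (z3 _ _ _ Pi).
- exact: tri (oner_neq0 _) nzP.
- exact: tri w0 nzP.
- exact: tri (expf_neq0 2 w0) nzP.
- exact: smF.
Qed.

End Base.

(** * Descent in the Eisenstein integers *)

Definition eis_normz (z : eisenstein) : int :=
  eis_im z ^+ 2 - eis_im z * eis_re z + eis_re z ^+ 2.

Lemma eis_normz_ge0 z : 0 <= eis_normz z.
Proof.
case: z => x y; rewrite /eis_normz /=.
have : 0 <= (2 * x - y) ^+ 2 + 3 * y ^+ 2 by rewrite addr_ge0 ?sqr_ge0 // mulr_ge0 ?sqr_ge0.
nia.
Qed.

Lemma eis_normE z : (eis_norm z)%:Z = eis_normz z.
Proof. exact: gez0_abs (eis_normz_ge0 z). Qed.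

Lemma eis_norm_eq z z' : eis_normz z = eis_normz z' -> eis_norm z = eis_norm z'.
Proof. by rewrite /eis_norm -!/(eis_normz _) => ->. Qed.

Lemma eis_normM z z' : eis_norm (z * z') = (eis_norm z * eis_norm z')%N.
Proof.
apply/eqP; rewrite -eqz_nat PoszM !eis_normE; apply/eqP.
case: z z' => x y [x' y']; rewrite /eis_normz /=; ring.
Qed.

Lemma eis_norm_eq0 z : eis_norm z = 0%N -> z = 0.
Proof.
move=> e; have := eis_normE z; rewrite e; case: z {e} => x y; rewrite /eis_normz /= => e.
have h : (2 * x - y) ^+ 2 + 3 * y ^+ 2 = 0 by apply: etrans (congr1 (fun k => 4 * k) (esym e));
  ring.
have y0 : y = 0 by nia.
have x0 : x = 0 by move: h; rewrite y0; nia.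
by rewrite x0 y0.
Qed.

Lemma eis_dvd1_norm z : eis_dvd z 1 -> eis_norm z = 1%N.
Proof.
case=> e /(congr1 eis_norm); rewrite eis_normM => /esym/eqP; rewrite muln_eq1.
by case/andP => _ /eqP.
Qed.

Definition theta : eisenstein := 1 + eis_omega + eis_omega.

Definition norms (p q : eisenstein) :=
  (eis_norm q, eis_norm p, eis_norm (p + eis_omega ^+ 2 * q), eis_norm (p - eis_omega * q)).

Ltac eis := apply: eis_norm_eq; rewrite /eis_normz /=; ring.

Lemma norms_diag p q : norms (p + eis_omega ^+ 2 * q) (eis_omega * q) =
  let: (a, b, c, e) := norms p q in (a, c, e, b).
Proof. by case: p q => x y [x' y']; rewrite /norms; congr (_, _, _, _); eis. Qed.

Lemma norms_fourier p q : norms (- q) p = let: (a, b, c, e) := norms p q in (b, a, e, c).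
Proof. by case: p q => x y [x' y']; rewrite /norms; congr (_, _, _, _); eis. Qed.

Lemma norms_sigma p q : norms (- p) (q + theta * p) =
  let: (a, b, c, e) := norms p q in (eis_norm (q + theta * p), b, e, c).
Proof. by case: p q => x y [x' y']; rewrite /norms; congr (_, _, _, _); eis. Qed.

(** For curves of degree a + b + c + e, the norm of q + theta p is the degree minus 2 a: what a side
    still meets outside its two vertices, and the new multiplicity at the vertices. *)
Lemma norms_sum p q : let: (a, b, c, e) := norms p q in
  (a + eis_norm (q + theta * p)%R = b + c + e)%N.
Proof.
rewrite /norms; apply/eqP; rewrite -eqz_nat !PoszD !eis_normE; apply/eqP.
case: p q => x y [x' y']; rewrite /eis_normz /=; ring.
Qed.

Lemma norms_quadric p q : let: (a, b, c, e) := norms p q in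
  ((a + b + c + e) ^ 2 = 3 * (a ^ 2 + b ^ 2 + c ^ 2 + e ^ 2))%N.
Proof.
rewrite /norms; apply/eqP; rewrite -eqz_nat -!mulnn !(PoszD, PoszM) !eis_normE; apply/eqP.
case: p q => x y [x' y']; rewrite /eis_normz /=; ring.
Qed.

Lemma eis_dvdD d x y : eis_dvd d x -> eis_dvd d y -> eis_dvd d (x + y).
Proof. by case=> a -> [b ->]; exists (a + b); rewrite mulrDl. Qed.

Lemma eis_dvdMl d x y : eis_dvd d y -> eis_dvd d (x * y).
Proof. by case=> a ->; exists (x * a); rewrite mulrA. Qed.

Lemma coprime_lincomb p q p' q' :
    (exists a b, p = a * p' + b * q') -> (exists a b, q = a * p' + b * q') ->
  eis_coprime p q -> eis_coprime p' q'.
Proof.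
move=> [a [b ep]] [a' [b' eq]] cop d dp dq.
by apply: cop; [rewrite ep|rewrite eq]; apply: eis_dvdD; apply: eis_dvdMl.
Qed.

Lemma coprime_diag p q : eis_coprime p q ->
  eis_coprime (p + eis_omega ^+ 2 * q) (eis_omega * q).
Proof.
apply: coprime_lincomb; [exists 1, (- eis_omega)|exists 0, (eis_omega ^+ 2)];
  by case: p q => x y [x' y']; apply: eisP => /=; ring.
Qed.

Lemma coprime_fourier p q : eis_coprime p q -> eis_coprime (- q) p.
Proof. by apply: coprime_lincomb; [exists 0, 1|exists (- 1), 0]; ring. Qed.

Lemma coprime_sigma p q : eis_coprime p q -> eis_coprime (- p) (q + theta * p).
Proof. by apply: coprime_lincomb; [exists (- 1), 0|exists theta, 1]; ring. Qed.

(* The quadric is (S - 3a) a + (S - 3b) b + (S - 3c) c + (S - 3e) e = 0, with S the sum. *)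
Lemma quadric_extremal a b c e (S := (a + b + c + e)%N) :
  (S ^ 2 = 3 * (a ^ 2 + b ^ 2 + c ^ 2 + e ^ 2))%N ->
  (S < 3 * a)%N || (a == 0%N) || ((S < 3 * b)%N || (b == 0%N))
    || ((S < 3 * c)%N || (c == 0%N)) || ((S < 3 * e)%N || (e == 0%N)).
Proof.
move=> h; apply: contraPT h; rewrite !negb_or -!leqNgt.
case/andP=> /andP[/andP[/andP[ha a0] /andP[hb b0]] /andP[hc c0]] /andP[he e0] h.
have [a1 b1 c1 e1] : [/\ S - 3 * a = 0, S - 3 * b = 0, S - 3 * c = 0 & S - 3 * e = 0]%N.
  have h' : ((S - 3 * a) * a + (S - 3 * b) * b + (S - 3 * c) * c + (S - 3 * e) * e = 0)%N.
    rewrite !mulnBl -!mulnA !mulnn.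
    have := leq_mul ha (leqnn a); have := leq_mul hb (leqnn b).
    have := leq_mul hc (leqnn c); have := leq_mul he (leqnn e).
    rewrite -!mulnA !mulnn; have : (S * a + S * b + S * c + S * e = S ^ 2)%N.
      by rewrite -!mulnDr mulnn.
    lia.
  move/eqP: h'; rewrite !addn_eq0 !muln_eq0 (negPf a0) (negPf b0) (negPf c0) (negPf e0) !orbF.
  by case/andP=> /andP[/andP[/eqP-> /eqP->] /eqP->] /eqP->.
by rewrite /S in ha hb hc he a1 b1 c1 e1; lia.
Qed.

(** * The descent on coprime pairs *)

Section Descent.
Variables (K : closedFieldType) (w : K).
Hypothesis w2 : w ^+ 2 = - w - 1.
Hypothesis char0 : forall n, n.+1%:R != 0 :> K.

Definition eval (z : eisenstein) : K := (eis_re z)%:~R + (eis_im z)%:~R * w.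

Lemma evalD x y : eval (x + y) = eval x + eval y.
Proof. by rewrite /eval /= !rmorphD /=; ring. Qed.

Lemma evalN x : eval (- x) = - eval x.
Proof. by rewrite /eval /= !rmorphN /=; ring. Qed.

Lemma evalM x y : eval (x * y) = eval x * eval y.
Proof. by rewrite /eval /= !(rmorphB, rmorphD, rmorphM) /=; ring: w2. Qed.

Lemma eval_omega : eval eis_omega = w.
Proof. by rewrite /eval /= add0r mul1r. Qed.

Lemma eval1 : eval 1 = 1.
Proof. by rewrite /eval /= mul0r addr0. Qed.

Lemma eval_theta : eval theta = 1 + 2%:R * w.
Proof. by rewrite /theta !evalD eval1 eval_omega; ring. Qed.

Lemma eval_neq0 z : eis_norm z != 0%N -> eval z != 0.
Proof.
(* The second factor is the conjugate of z, as w^2 = w - (1 + 2 w). *)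
move=> nz; have e : eval z * (eval z - (eis_im z)%:~R * (1 + 2%:R * w)) = (eis_norm z)%:R.
  rewrite -[RHS]/((eis_norm z)%:Z%:~R) eis_normE /eval /eis_normz.
  by rewrite !(rmorphB, rmorphD, rmorphM, rmorphXn) /=; ring: w2.
apply: contraTneq (char0 (eis_norm z).-1) => z0.
by rewrite prednK ?lt0n // -e z0 mul0r eqxx.
Qed.

Lemma Good_scale k s t a b c e : k != 0 -> Good w s t a b c e -> Good w (k * s) (k * t) a b c e.
Proof.
move=> k0 [S hS]; exists S => F irrF invF; apply: hS => // i j; have [G eG] := invF i j.
have h l : form4 (k * s) (k * t) l = k%:MP * form4 s t l.
  by rewrite /form4 !mpolyCM; case: (ord3P l) => ->; rewrite !vec3E; ring.
exists ((k^-1)%:MP * G); rewrite -mulrA -eG !h.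
have kk : (k^-1)%:MP_[3] * k%:MP = 1 by rewrite -mpolyCM mulVf.
by ring: kk.
Qed.

Definition Good_pair p q := let: (a, b, c, e) := norms p q in
  Good w (eval (q + theta * p)) (eval q) a b c e.

Lemma Good_pair_diag p q :
  Good_pair (p + eis_omega ^+ 2 * q) (eis_omega * q) -> Good_pair p q.
Proof.
rewrite /Good_pair norms_diag; case: (norms p q) => [[[a b] c] e] h.
apply: (Good_diag w2); move: h.
have -> : eis_omega * q + theta * (p + eis_omega ^+ 2 * q) = q + theta * p.
  by case: p q => x y [x' y']; apply: eisP => /=; ring.
by rewrite evalM eval_omega.
Qed.

Lemma theta_neq0 : eval theta != 0.
Proof. exact: eval_neq0. Qed.

(** Since theta^2 = -3, both new parameters s + 2 t and s - t are multiples of theta, which is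
    divided out. *)
Lemma Good_pair_fourier p q : Good_pair (- q) p -> Good_pair p q.
Proof.
rewrite /Good_pair norms_fourier; case: (norms p q) => [[[a b] c] e] h.
apply: (Good_fourier w2 (char0 2)).
have -> : eval (q + theta * p) + 2%:R * eval q = eval theta * eval (p + theta * - q).
  by rewrite !(evalD, evalM, evalN, eval1, eval_omega); ring: w2.
have -> : eval (q + theta * p) - eval q = eval theta * eval p.
  by rewrite !(evalD, evalM); ring.
exact: Good_scale theta_neq0 h.
Qed.

Lemma Good_pair_sigma p q : eis_norm q != 0%N ->
  Good_pair (- p) (q + theta * p) -> Good_pair p q.
Proof.
move=> nq; have := norms_sum p q; rewrite /Good_pair norms_sigma /norms => h_sum.
have -> : q + theta * p + theta * - p = q by ring.
by apply: (Good_sigma char0 w2 _ h_sum); apply: eval_neq0.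
Qed.

Lemma Good_pair_base p : eis_coprime p 0 -> Good_pair p 0.
Proof.
move=> cop; have p1 : eis_norm p = 1%N.
  by apply/eis_dvd1_norm/cop; [exists 1; rewrite mul1r|exists 0; rewrite mul0r].
rewrite /Good_pair /norms !(mulr0, subr0, addr0, add0r) p1.
have -> : eval 0 = 0 by rewrite /eval /= mul0r addr0.
apply: (Good_base w2 (char0 2) char0).
by rewrite evalM mulf_neq0 ?theta_neq0 // eval_neq0 // p1.
Qed.

Lemma Good_coprime p q : eis_coprime p q -> Good_pair p q.
Proof.
pose sum p q := let: (a, b, c, e) := norms p q in (a + b + c + e)%N.
have [n] := ubnP (sum p q); elim: n p q => // n IHn p q hn cop.
have sum_diag p1 q1 : sum (p1 + eis_omega ^+ 2 * q1) (eis_omega * q1) = sum p1 q1.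
  by rewrite /sum norms_diag; case: (norms p1 q1) => [[[a b] c] e]; lia.
have sum_fourier p1 q1 : sum (- q1) p1 = sum p1 q1.
  by rewrite /sum norms_fourier; case: (norms p1 q1) => [[[a b] c] e]; lia.
pose reducible p1 q1 := sum p1 q1 = sum p q -> eis_coprime p1 q1 ->
  (sum p1 q1 < 3 * eis_norm q1)%N || (eis_norm q1 == 0%N) -> Good_pair p1 q1.
have fin p1 q1 : reducible p1 q1.
  move=> e1 c1 /orP[lt_q|/eqP/eis_norm_eq0 q0]; last by move: c1; rewrite q0; apply: Good_pair_base.
  apply: Good_pair_sigma; first by apply: contraTneq lt_q => ->.
  apply: IHn (coprime_sigma c1).
  have := norms_sum p1 q1; move: hn lt_q; rewrite -e1 /sum norms_sigma /=.
  rewrite /norms; move: (eis_norm q1) (eis_norm p1) (eis_norm (p1 + _)) (eis_norm (p1 - _)).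
  by move: (eis_norm _); lia.
have big : (sum p q < 3 * eis_norm q)%N || (eis_norm q == 0%N)
    || ((sum p q < 3 * eis_norm p)%N || (eis_norm p == 0%N))
    || ((sum p q < 3 * eis_norm (p + eis_omega ^+ 2 * q)%R)%N || (eis_norm (p + eis_omega ^+ 2 *
      q) == 0%N))
    || ((sum p q < 3 * eis_norm (p - eis_omega * q)%R)%N || (eis_norm (p - eis_omega * q) == 0%N)).
  have := norms_quadric p q; rewrite /sum /norms.
  exact: quadric_extremal.
have pos_fourier p1 q1 : sum p1 q1 = sum p q -> eis_coprime p1 q1 ->
    (sum p q < 3 * eis_norm p1)%N || (eis_norm p1 == 0%N) -> Good_pair p1 q1.
  move=> e1 c1 h1; apply: Good_pair_fourier; apply: fin.
  - by rewrite sum_fourier.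
  - exact: coprime_fourier.
  - by rewrite sum_fourier e1.
have c1 := coprime_diag cop; have s1 := sum_diag p q.
case/orP: big => [/orP[/orP[hq|hp]|hc]|he].
- exact: fin.
- exact: pos_fourier.
- by apply: Good_pair_diag; apply: pos_fourier.
(* Two diagonal steps replace p by p + omega^2 q + q, which is p - omega q. *)
apply: Good_pair_diag; apply: Good_pair_diag; apply: pos_fourier.
- by rewrite !sum_diag.
- exact: coprime_diag.
have -> : p + eis_omega ^+ 2 * q + eis_omega ^+ 2 * (eis_omega * q) = p - eis_omega * q.
  by case: (p) (q) => x y [x' y']; apply: eisP => /=; ring.
exact: he.
Qed.

End Descent.

(** * Branches of ordinary points *)

(** Course-of-values recursion; [d] fills the values not yet defined. *)
Lemma recursive_choice (T : Type) (F : nat -> (nat -> T) -> T) (d : T) :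
    (forall n u v, (forall k, (k < n)%N -> u k = v k) -> F n u = F n v) ->
  exists u : nat -> T, forall n, u n = F n u.
Proof.
move=> hF; pose approx := fix approx n := if n is n'.+1 then
  fun k => if k == n' then F n' (approx n') else approx n' k else fun=> d.
have stable n k : (k < n)%N -> approx n k = approx k.+1 k.
  elim: n => // n IHn; rewrite ltnS leq_eqVlt => /orP[/eqP->//|kn] /=.
  by rewrite (ltn_eqF kn) IHn //= eqxx.
exists (fun n => approx n.+1 n) => n; rewrite [LHS]/= eqxx; apply: hF => k kn.
exact: stable.
Qed.

(** * Hensel factorization of power series in two variables *)

Section Series.
Variable K : fieldType.
Implicit Types (s t u b : nat -> {poly K}) (f g : fps2 K).

(* A power series in u, v is encoded by its homogeneous components, each of them
   dehomogenized at v = 1. *)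
Definition wf s := forall n, (size (s n) <= n.+1)%N.
Definition of_series s : fps2 K := fun i j => (s (i + j)%N)`_i.
Definition smul s t n : {poly K} := \sum_(k < n.+1) s k * t (n - k)%N.

Lemma wf_smul s t : wf s -> wf t -> wf (smul s t).
Proof.
move=> hs ht n; apply: (leq_trans (size_sum _ _ _)); apply/bigmax_leqP => k _.
apply: leq_trans (size_polyMleq _ _) _; have := hs k; have := ht (n - k)%N.
have := ltn_ord k; lia.
Qed.

Lemma of_series_mul s t : wf s -> wf t ->
  fps2_mul (of_series s) (of_series t) =2 of_series (smul s t).
Proof.
move=> hs ht i j; rewrite /fps2_mul /of_series /smul coef_sum.
rewrite (eq_bigr (fun k : 'I_(i + j).+1 => \sum_(a < i.+1) (s k)`_a * (t (i + j - k)%N)`_(i -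
  a))); last first.
  by move=> k _; rewrite coefM.
rewrite [RHS]exchange_big /=; apply: eq_bigr => a _.
have ai : (a <= i)%N by rewrite -ltnS.
pose G k := (s k)`_a * (t (i + j - k)%N)`_(i - a).
rewrite (eq_bigr (fun l : 'I_j.+1 => G (a + l)%N)) => [|l _]; last first.
  rewrite /G; congr (_ * (t _)`_ _); have := ltn_ord l; lia.
rewrite -(big_mkord xpredT (fun l => G (a + l)%N)) -(big_mkord xpredT G).
have ha : (a <= (i + j).+1)%N by lia.
rewrite [RHS](big_cat_nat (n := a)) //= [X in _ = X + _]big_nat [X in _ = X + _]big1 => [|k /=
  ka]; last first.
  by rewrite /G nth_default ?mul0r // (leq_trans (hs k)).
have haj : (a + j.+1 <= (i + j).+1)%N by lia.
rewrite add0r [RHS](big_cat_nat (n := (a + j.+1)%N)) //=; last by rewrite leq_addr.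
rewrite [X in _ = _ + X]big_nat [X in _ = _ + X]big1 ?addr0 => [|k /= /andP[ka kb]]; last first.
  by rewrite /G [X in _ * X]nth_default ?mulr0 // (leq_trans (ht _)) //; lia.
rewrite -{2}[val a]add0n big_addn addKn.
by apply: eq_bigr => l _; rewrite addnC.
Qed.

Lemma fps2_mul_eq f f' g g' : f =2 f' -> g =2 g' -> fps2_mul f g =2 fps2_mul f' g'.
Proof.
by move=> ef eg i j; apply: eq_bigr => k _; apply: eq_bigr => l _; rewrite ef eg.
Qed.

(** In degree m + 1 + n, for n > 0, the equation s = b h reads ('X - r) H_n = known terms - c_n p.
    As p(r) is nonzero, the constant c_n can be chosen to make the right side vanish at r, and H_n
    is the quotient. *)
Lemma hensel_step s (m : nat) (r : K) (p : {poly K}) : wf s -> (forall n, (n < m.+1)%N -> s n =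
  0) ->
    s m.+1 = ('X - r%:P) * p -> p.[r] != 0 -> (size p <= m.+1)%N ->
  exists b h, [/\ wf b, wf h, b 0%N = 0, b 1%N = 'X - r%:P &
    [/\ forall n, (n < m)%N -> h n = 0, h m = p & s =1 smul b h]].
Proof.
move=> hs s0 sm gr sg.
pose rhs n (u : nat -> K * {poly K}) := s (m.+1 + n)%N - \sum_(1 <= j < n) (u j).1 *: (u (n -
  j)%N).2.
(* The n-th value is the pair (c_n, H_n). The entry c_0 = 0 is a placeholder, the linear part of the
   branch being 'X - r. *)
pose F n (u : nat -> K * {poly K}) : K * {poly K} := if n is 0 then (0, p) else
  let c := (rhs n u).[r] / p.[r] in (c, (rhs n u - c *: p) %/ ('X - r%:P)).
have [|u hu] := @recursive_choice _ F (0, 0).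
  move=> [|n] x y e //; rewrite /F; suff -> : rhs n.+1 x = rhs n.+1 y by [].
  rewrite /rhs !big_nat; congr (_ - _); apply: eq_bigr => j /andP[j0 jn].
  by rewrite e // e // -ltnS; lia.
pose c n := (u n).1; pose H n := (u n).2.
have eH n : ('X - r%:P) * H n.+1 = rhs n.+1 u - c n.+1 *: p.
  rewrite /H /c hu /= mulrC divpK // dvdp_XsubCl rootE hornerD hornerN hornerZ.
  by rewrite divfK // subrr.
have H0 : H 0%N = p by rewrite /H hu.
have sH n : (size (H n) <= m.+1 + n)%N.
  have [k] := ubnP n; elim: k n => // k IHk [|n] hn; first by rewrite H0 addn0.
  have h1 : (size (rhs n.+1 u - c n.+1 *: p)%R <= m.+1 + n.+2)%N.
    rewrite (leq_trans (size_polyD _ _)) // geq_max size_polyN; apply/andP; split.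
      rewrite /rhs (leq_trans (size_polyD _ _)) // geq_max size_polyN; apply/andP; split.
        by apply: leq_trans (hs _) _; lia.
      rewrite big_nat; apply: leq_trans (size_sum _ _ _) _; apply/bigmax_leqP_seq => j _ /andP[j0
        jn].
      rewrite (leq_trans (size_scale_leq _ _)) // (leq_trans (IHk _ _)) //; lia.
    by rewrite (leq_trans (size_scale_leq _ _)) // (leq_trans sg) // leq_addr.
  have [->|Hn0] := eqVneq (H n.+1) 0; first by rewrite size_poly0.
  by move: h1; rewrite -eH mulrC size_Mmonic ?monicXsubC // size_XsubC /=; lia.
(* The branch is u - r v + c_1 v^2 + c_2 v^3 + ..., a graph tangent to u = r v. *)
pose b n : {poly K} := if n is n'.+1 then if n' is 0 then 'X - r%:P else (c n')%:P else 0.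
pose h n := if (n < m)%N then 0 else H (n - m)%N.
exists b, h; split=> //.
- by move=> [|[|n]]; rewrite /b ?size_poly0 ?size_XsubC // (leq_trans (size_polyC_leq1 _)).
- move=> n; rewrite /h; case: ltnP => [_|mn]; first by rewrite size_poly0.
  by rewrite (leq_trans (sH _)) // addSn subnKC.
split=> [n nm||n]; [by rewrite /h nm|by rewrite /h ltnn subnn|].
rewrite /smul; have [nm|mn] := ltnP n m.+1.
  rewrite s0 // big1 // => -[[|k] hk] _; rewrite /= ?mul0r // /h.
  by rewrite ifT ?mulr0 //; lia.
have [k ->] : exists k, n = (m.+1 + k)%N by exists (n - m.+1)%N; lia.
rewrite -(big_mkord xpredT (fun k' => b k' * h (m.+1 + k - k')%N)).
rewrite big_nat_recl // mul0r add0r.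
rewrite (big_cat_nat (n := k.+1)) //=; last by lia.
rewrite [X in _ = _ + X]big_nat [X in _ = _ + X]big1 ?addr0 => [|j /andP[kj jm]]; last first.
  by rewrite /h ifT ?mulr0 //; lia.
have hE l l' : l = (m + l')%N -> h l = H l'.
  by move=> ->; rewrite /h ltnNge leq_addr /= addKn.
rewrite big_nat_recl // (hE _ k); last by lia.
case: k {mn} => [|k].
  by rewrite big_geq // addr0 addn0 sm H0.
rewrite eH /rhs; set S := \sum_(1 <= j < k.+1) _; set T := \sum_(0 <= i < k.+1) _.
suff -> : T = S + c k.+1 *: p by ring.
rewrite /T big_nat_recr // (hE _ 0%N); last by lia.
rewrite H0 mul_polyC /S big_add1; congr (_ + _); apply: eq_big_nat => j /andP[_ jk].
by rewrite (hE _ (k.+1 - j.+1)%N) ?mul_polyC //; lia.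
Qed.

End Series.

Section Factorization.
Variable K : closedFieldType.
Implicit Types (s t u : nat -> {poly K}) (f g : fps2 K).

Definition fcons (T : Type) m (x : T) (b : 'I_m -> T) (i : 'I_m.+1) : T :=
  oapp b x (unlift ord0 i).

Lemma fcons0 (T : Type) m (x : T) (b : 'I_m -> T) : fcons x b ord0 = x.
Proof. by rewrite /fcons unlift_none. Qed.

Lemma fconsS (T : Type) m (x : T) (b : 'I_m -> T) i : fcons x b (lift ord0 i) = b i.
Proof. by rewrite /fcons liftK. Qed.

Lemma map_fcons (T : Type) m (x : T) (b : 'I_m -> T) :
  [seq fcons x b i | i <- enum 'I_m.+1] = x :: [seq b i | i <- enum 'I_m].
Proof.
rewrite enum_ordSl /= fcons0 -map_comp; congr (_ :: _).
by apply: eq_map => i /=; rewrite fconsS.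
Qed.

Definition tangents_differ (s t : nat -> {poly K}) :=
  (s 1%N)`_1 * (t 1%N)`_0 != (s 1%N)`_0 * (t 1%N)`_1.

(** The bound on the size of [s m] says that v divides the leading form at most once. For m > 1 it
    provides a root, that is, a tangent other than v = 0. *)
Lemma factor_series m s : wf s -> (forall n, (n < m)%N -> s n = 0) -> s m != 0 ->
    (m <= size (s m))%N -> (forall r, root (s m) r -> ~~ root (s m)^`() r) ->
  exists u (b : 'I_m -> nat -> {poly K}), [/\ wf u, forall i, wf (b i),
    s m = u 0%N * \prod_i b i 1%N,
    forall n, s n = foldr (@smul K) u [seq b i | i <- enum 'I_m] n &
    (forall i, b i 0%N = 0) /\ forall i j, i != j -> tangents_differ (b i) (b j)].
Proof.
elim: m s => [|[|m] IHm] s hs s0 sn0 size_s simple.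
- exists s, (fun=> s); split=> // [|n|].
  + by rewrite big_ord0 mulr1.
  + by have /size0nil-> : size (enum 'I_0) = 0%N by rewrite size_enum_ord.
  + by split=> -[].
(* The last branch is kept whole, with unit 1: its tangent may be v = 0, which is not a root of the
   dehomogenized form. *)
- exists (fun n => (n == 0)%N%:R), (fun=> s); split=> // [n||n|].
  + by case: n => [|n] /=; rewrite ?size_poly1 ?size_poly0.
  + by rewrite big_ord_recl big_ord0 mulr1 mul1r.
  + rewrite enum_ordSl map_cons; have /size0nil-> : size (enum 'I_0) = 0%N by rewrite size_enum_ord.
    rewrite /= /smul big_ord_recr /= subnn mulr1 big1 ?add0r // => i _.
    by rewrite subn_eq0 leqNgt ltn_ord mulr0.
  + by split=> [_|i j]; [apply: s0|rewrite !ord1 eqxx].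
have [r rs] : exists r, root (s m.+2) r.
  by apply/closed_rootP; case: (size _) size_s => [|[|k]].
have [g eg] : exists g : {poly K}, s m.+2 = ('X - r%:P) * g.
  by have /factor_theorem[g ->] := rs; exists g; rewrite mulrC.
have g0 : g != 0 by apply: contraNneq sn0 => e; rewrite eg e mulr0.
have gr : g.[r] != 0.
  have := simple r rs; rewrite eg derivM derivXsubC mul1r /root hornerD hornerM.
  by rewrite hornerXsubC subrr mul0r addr0.
have size_g : (size (s m.+2) = (size g).+1)%N.
  by rewrite eg mulrC size_Mmonic ?monicXsubC // size_XsubC addn2.
have [|b [h [wb wh b0 b1 [h0 hm e_s]]]] := hensel_step hs s0 eg gr.
  by have := hs m.+2; rewrite size_g.
have [|||u [bs [wu wbs eu hb [bs0 dt]]]] := IHm h wh h0.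
- by rewrite hm.
- by rewrite hm -ltnS -size_g.
- rewrite hm => r' gr'; have gr'0 := rootP gr'.
  have /simple : root (s m.+2) r' by rewrite eg rootM gr' orbT.
  rewrite eg derivM derivXsubC mul1r /root hornerD hornerM gr'0 add0r mulf_eq0.
  by rewrite negb_or => /andP[].
have tangent i : tangents_differ b (bs i).
  have := gr; rewrite -hm eu hornerM horner_prod mulf_eq0 negb_or => /andP[_ /prodf_neq0/(_ i isT)].
  rewrite /tangents_differ b1 coefB coefX coefC coefB coefX coefC /= subr0 mul1r sub0r.
  apply: contraNneq => e; rewrite (horner_coef_wide r (wbs i 1%N)).
  by rewrite !big_ord_recl big_ord0 /bump /= e; apply/eqP; ring.
exists u, (fcons b bs); split=> //.
- by move=> i; case: (unliftP ord0 i) => [j|] ->; rewrite ?fcons0 ?fconsS.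
- rewrite big_ord_recl fcons0 b1 eg -hm eu mulrCA; congr (_ * (_ * _)).
  by apply: eq_bigr => i _; rewrite fconsS.
- move=> n; rewrite e_s map_fcons /smul; apply: eq_bigr => k _; congr (_ * _); exact: hb.
split=> [i|i j].
  by case: (unliftP ord0 i) => [j|] ->; rewrite ?fcons0 ?fconsS.
case: (unliftP ord0 i) => [i'|] ->; case: (unliftP ord0 j) => [j'|] ->; rewrite ?fcons0 ?fconsS
  ?eqxx //.
  by rewrite (inj_eq lift_inj); apply: dt.
move=> _; have := tangent i'; rewrite /tangents_differ eq_sym mulrC [X in _ != X]mulrC.
by [].
Qed.

End Factorization.

Section Branches.
Variable K : closedFieldType.

Lemma ordinary_branches (f : fps2 K) m (L := \poly_(i < m.+1) f i (m - i)%N) :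
    (forall i j, (i + j < m)%N -> f i j = 0) -> L != 0 -> (m <= size L)%N ->
    (forall r, root L r -> ~~ root L^`() r) ->
  has_ordinary_branches f m.
Proof.
move=> f0 L0 sL simple; pose s n := \poly_(i < n.+1) f i (n - i)%N.
have fs : f =2 of_series s.
  by move=> i j; rewrite /of_series coef_poly ltnS leq_addr addKn.
have hs : wf s by move=> n; apply: size_poly.
have s0 n : (n < m)%N -> s n = 0.
  move=> nm; apply/polyP => i; rewrite coef_poly coef0; case: ltnP => // ni.
  by rewrite f0 // subnKC.
have [u [b [wu wb es hf [b0 dt]]]] := factor_series hs s0 L0 sL simple.
have [u0 bn0] : u 0%N != 0 /\ forall i, b i 1%N != 0.
  have : s m != 0 by exact: L0.
  rewrite es mulf_eq0 negb_or => /andP[-> h]; split=> // i.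
  by move: h => /prodf_neq0/(_ i isT).
exists (of_series u), (fun i => of_series (b i)); split.
- rewrite /of_series addn0; apply: contraNneq u0 => e; apply/eqP/polyP => -[|k].
    by rewrite coef0.
  by rewrite coef0 nth_default // (leq_trans (wu 0%N)).
- have [hw ef] : wf (foldr (@smul K) u [seq b i | i <- enum 'I_m]) /\
      foldr (@fps2_mul K) (of_series u) [seq of_series (b i) | i <- enum 'I_m] =2
      of_series (foldr (@smul K) u [seq b i | i <- enum 'I_m]).
    elim: (enum _) => [//|i l [IH1 IH2]]; split; first exact: wf_smul.
    by move=> x y; rewrite -of_series_mul //; apply: fps2_mul_eq.
  by move=> i j; rewrite ef fs /of_series -hf.
- move=> i; split; first by rewrite /of_series addn0 b0 coef0.
  rewrite /of_series addn0 add0n xpair_eqE; apply: contra (bn0 i) => /andP[/eqP e1 /eqP e0].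
  apply/eqP/polyP => -[|[|k]]; rewrite coef0 //.
  by rewrite nth_default // (leq_trans (wb i 1%N)).
- by move=> i j ij; have := dt i j ij.
Qed.

End Branches.

(** * The local equation in an affine chart *)

Section Chart.
Variables (K : closedFieldType) (F : {mpoly K[3]}) (P : 'rV[K]_3) (k : 'I_3) (d m : nat).
Hypothesis Pk : P 0 k != 0.
Hypothesis hF : F \is d.-homog.
Let Q i := P 0 i / P 0 k.
Hypothesis oF : Ord F Q m.

(** The vectors with k-th coordinate 0 represent K^3 / K Q, as the k-th coordinate of Q is 1. *)
Definition chart (S : comNzRingType) (x y : S) (i : 'I_3) : S :=
  oapp (fun j : 'I_2 => if j == ord0 then x else y) 0 (unlift k i).

Let g := local_equation F P k.

Lemma coef_mmap2 (S : comNzRingType) (f : {rmorphism K -> S}) (x y : S) (h : {mpoly K[2]}) n :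
  (mmap (polyC \o f) (fun j : 'I_2 => 'X * (if j == ord0 then x else y)%:P) h)`_n =
  \sum_(i < n.+1) f (fps2_of_mpoly h i (n - i)%N) * (x ^+ i * y ^+ (n - i)).
Proof.
elim/mpolyind: h => [|c a p _ _ IHp].
  by rewrite mmap0 coef0 big1 // => i _; rewrite /fps2_of_mpoly mcoeff0 rmorph0 mul0r.
rewrite mmapD coefD IHp mmapZ mmapX (_ : mmap1 _ a = ('X * x%:P) ^+ a ord0 * ('X * y%:P) ^+ a
  (lift ord0 ord0)); last first.
  by rewrite /mmap1 !big_ord_recl big_ord0 mulr1.
rewrite !exprMn.
rewrite [RHS](eq_bigr (fun i : 'I_n.+1 => f (c * (a == [multinom [tuple val i; (n - i)%N]])%:R) *
  (x ^+ i * y ^+ (n - i))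
   + f (fps2_of_mpoly p i (n - i)%N) * (x ^+ i * y ^+ (n - i)))) => [|i _]; last first.
  by rewrite /fps2_of_mpoly mcoeffD mcoeffZ mcoeffX rmorphD mulrDl.
rewrite [RHS]big_split /=; congr (_ + _).
set a0 := a ord0; set a1 := a _.
have ea i : (a == [multinom [tuple i; (n - i)%N]]) = (a0 == i) && (a1 == n - i)%N.
  apply/eqP/andP => [e|[/eqP e0 /eqP e1]]; first by rewrite /a0 /a1 e !multinomE !(tnth_nth 0%N).
  apply/mnmP => j; rewrite multinomE (tnth_nth 0%N).
  by case: (unliftP ord0 j) => [j'|] -> //=; rewrite ord1 -e1.
have -> : 'X ^+ a0 * (x%:P ^+ a0) * ('X ^+ a1 * y%:P ^+ a1) = (x ^+ a0 * y ^+ a1)%:P * 'X^(a0 + a1).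
  by rewrite exprD polyCM !polyC_exp; ring.
rewrite coefCM coefCM coefXn.
have [e|ne] := eqVneq n (a0 + a1)%N.
  have a0n : (a0 < n.+1)%N by rewrite e ltnS leq_addr.
  rewrite (bigD1 (Ordinal a0n)) //= ea eqxx {1 2}e addKn eqxx big1 ?addr0 => [|i ia].
    by rewrite !mulr1.
  rewrite ea (_ : a0 == i = false) ?mulr0 ?rmorph0 ?mul0r //.
  by apply: contraNF ia => /eqP e0; apply/eqP/val_inj.
rewrite !mulr0 big1 // => i _; rewrite ea.
case: eqP => [e0|]; last by rewrite mulr0 rmorph0 mul0r.
case: eqP => [e1|]; last by rewrite mulr0 rmorph0 mul0r.
by case/eqP: ne; rewrite e0 e1 subnKC // -ltnS.
Qed.

Lemma chart_component (S : comNzRingType) (f : {rmorphism K -> S}) (x y : S) n :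
  \sum_(i < n.+1) f (fps2_of_mpoly g i (n - i)%N) * (x ^+ i * y ^+ (n - i)) =
  mmap f (chart x y) (tay F Q)`_n.
Proof.
rewrite -coef_mmap2 -coef_line; apply: (congr1 (fun p : {poly S} => p`_n)).
rewrite /g /local_equation /comp_mpoly [LHS](rmorph_mmap _ (mmap (polyC \o f) _)).
apply: mmap_eq => [c|i] /=.
  by rewrite mmapC.
rewrite tnth_mktuple /chart; case: (unliftP k i) => [j|] ->.
  by rewrite /= rmorphD /= mmapX mmap1U mmapC addrC.
by rewrite /= rmorph1 /Q divff // rmorph1 mulr0 addr0.
Qed.

Let T := (tay F Q)`_m.

Lemma sum_chart (V : nmodType) (f : 'I_3 -> V) :
  \sum_i f i = f k + (f (lift k ord0) + f (lift k (lift ord0 ord0))).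
Proof. by rewrite (bigD1_ord k) //= !big_ord_recl big_ord0 addr0. Qed.

Lemma chartE (S : comNzRingType) (x y : S) :
  (chart x y k = 0) * (chart x y (lift k ord0) = x) * (chart x y (lift k (lift ord0 ord0)) = y).
Proof. by rewrite /chart unlift_none !liftK. Qed.

(** Euler's relation and [lead_form_dir] are two linear relations between the partial derivatives,
    by which the vanishing of one of them spreads to the whole gradient; the vector is not a
    multiple of Q, since its k-th coordinate is 0. *)
Lemma simple_direction (x y : K) : T.@[chart x y] = 0 ->
    (y != 0 /\ T^`M(lift k ord0).@[chart x y] = 0) \/
    (x != 0 /\ T^`M(lift k (lift ord0 ord0)).@[chart x y] = 0) -> False.
Proof.
move=> T0 h; have [lt_m simple] := oF.
have /(congr1 (meval (chart x y))) := lead_form_dir hF lt_m; rewrite -/T.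
rewrite meval0 (raddf_sum (meval (chart x y))) sum_chart /= !mevalM !mevalC.
have := euler_eval (chart x y) (homog_tay F Q m); rewrite -/T T0 mulr0 sum_chart !chartE mul0r
  add0r.
set t0 := T^`M(lift k ord0).@[_]; set t1 := T^`M(lift k (lift ord0 ord0)).@[_] => e1 e2.
have [z0 z1] : t0 = 0 /\ t1 = 0.
  case: h => -[n0 z]; move: e1; rewrite -/t0 -/t1 in z *; rewrite z mulr0 ?add0r ?addr0 => /eqP.
    by rewrite mulf_eq0 (negPf n0) => /eqP.
  by rewrite mulf_eq0 (negPf n0) => /eqP.
have [i|c hc] := simple _ T0.
  case: (unliftP k i) => [j|] ->.
    by case: (unliftP ord0 j) => [j'|] ->; rewrite ?ord1.
  by move: e2; rewrite z0 z1 !mulr0 !addr0 /Q divff // mul1r.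
have /eqP := hc k; rewrite chartE /Q divff // mulr1 eq_sym => /eqP c0.
have := hc (lift k ord0); have := hc (lift k (lift ord0 ord0)); rewrite c0 !mul0r !chartE.
by case: h => -[/eqP].
Qed.

Lemma deriv_mmap (y : 'I_3 -> {poly K}) G :
  (mmap polyC y G)^`() = \sum_i mmap polyC y G^`M(i) * (y i)^`().
Proof.
elim/mpoly_ring_ind: G => [c|j|p q IHp IHq|p q IHp IHq].
- by rewrite mmapC derivC big1 // => i _; rewrite mderivC mmap0 mul0r.
- rewrite mmapX mmap1U (bigD1 j) //= big1 => [|i ij].
    by rewrite mderivXi eqxx rmorph1 mul1r addr0.
  by rewrite mderivXi eq_sym (negPf ij) mmap0 mul0r.
- rewrite mmapD derivD IHp IHq -big_split; apply: eq_bigr => i _.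
  by rewrite mderivD mmapD mulrDl.
- rewrite rmorphM derivM IHp IHq mulr_suml mulr_sumr -big_split; apply: eq_bigr => i _.
  by rewrite mderivM mmapD !rmorphM /=; ring.
Qed.

Lemma horner_mmap (y : 'I_3 -> {poly K}) G r :
  (mmap polyC y G).[r] = G.@[fun i => (y i).[r]].
Proof.
rewrite -[LHS]/(horner_eval r _) rmorph_mmap; apply: mmap_eq => [c|//].
by rewrite /= /horner_eval hornerC.
Qed.

Lemma poly_component n : \poly_(i < n.+1) fps2_of_mpoly g i (n - i)%N =
  mmap polyC (chart 'X 1) (tay F Q)`_n.
Proof.
rewrite -(chart_component polyC) poly_def; apply: eq_bigr => i _.
by rewrite expr1n mulr1 mul_polyC.
Qed.

Lemma chart_branches : has_ordinary_branches (fps2_of_mpoly g) m.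
Proof.
have [lt_m simple] := oF; set L := \poly_(i < m.+1) fps2_of_mpoly g i (m - i)%N.
have eL : L = mmap polyC (chart 'X 1) T by apply: poly_component.
have eR : \sum_(i < m.+1) (fps2_of_mpoly g i (m - i)%N)%:P * 'X^(m - i) = mmap polyC (chart 1 'X) T.
  rewrite -(chart_component polyC); apply: eq_bigr => i _.
  by rewrite expr1n mul1r.
have d0 : (0 : {poly K})^`() = 0 by rewrite -polyC0 derivC.
have d1 : (1 : {poly K})^`() = 0 by rewrite -polyC1 derivC.
have size_L : (m <= size L)%N.
  rewrite leqNgt; apply/negP => sL.
  have m0 : (0 < m)%N by apply: leq_trans sL.
  have c0 i : (m.-1 <= i)%N -> (i < m.+1)%N -> fps2_of_mpoly g i (m - i)%N = 0.
    move=> i1 i2; have := coef_poly m.+1 (fun i => fps2_of_mpoly g i (m - i)%N) i.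
    by rewrite i2 -/L nth_default //; apply: leq_trans i1; rewrite -ltnS prednK.
  (* If the size were less than m, then v^2 would divide the leading form and (1, 0) would be a
     double direction. *)
  have [R eR'] : exists R : {poly K}, mmap polyC (chart 1 'X) T = 'X^2 * R.
    exists (\sum_(i < m.+1) (fps2_of_mpoly g i (m - i)%N)%:P * 'X^(m - i - 2)).
    rewrite -eR mulr_sumr; apply: eq_bigr => i _; have [h|h] := leqP m.-1 i.
      by rewrite c0 ?ltn_ord // !mul0r mulr0.
    by rewrite mulrCA -exprD subnKC //; lia.
  have e0 i : (chart 1 ('X : {poly K}) i).[0] = chart 1 0 i.
    rewrite /chart; case: unlift => [j|] /=; last by rewrite horner0.
    by case: ifP; rewrite ?hornerX ?hornerC.
  apply: (@simple_direction 1 0).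
    have := congr1 (horner^~ 0) eR'; rewrite horner_mmap (meval_eq _ e0) => ->.
    by rewrite hornerM hornerXn expr0n mul0r.
  right; split; first exact: oner_neq0.
  have := congr1 (fun p => p^`().[0]) eR'; rewrite /= deriv_mmap derivM derivXn.
  rewrite hornerD !hornerM hornerMn !hornerXn expr0n /= mul0rn !mul0r addr0 sum_chart !chartE.
  rewrite derivX d0 d1 !mulr0 !add0r mulr1 horner_mmap.
  by rewrite (meval_eq _ e0).
apply: ordinary_branches => //.
- move=> i j ij; have := poly_component (i + j); rewrite lt_m // mmap0.
  move/(congr1 (fun p : {poly K} => p`_i)); rewrite coef0 coef_poly ltnS leq_addr.
  by rewrite addKn.
- case: (posnP m) => [m0|m0]; last by rewrite -size_poly_gt0 (leq_trans m0).
  rewrite -/L eL; have := simple_zeros_neq0 simple; rewrite -/T /T m0 tay0 mmapC.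
  by rewrite polyC_eq0 mpolyC_eq0.
- move=> r; rewrite -/L eL => rL.
  have er i : (chart ('X : {poly K}) 1 i).[r] = chart r 1 i.
    rewrite /chart; case: unlift => [j|] /=; last by rewrite horner0.
    by case: ifP; rewrite ?hornerX ?hornerC.
  apply/negP => rL'; apply: (@simple_direction r 1).
    by move: rL; rewrite rootE horner_mmap (meval_eq _ er) => /eqP.
  left; split; first exact: oner_neq0.
  move: rL'; rewrite rootE deriv_mmap sum_chart !chartE.
  rewrite derivX d0 d1 !mulr0 !add0r addr0 mulr1 horner_mmap.
  by rewrite (meval_eq _ er) => /eqP.
Qed.

End Chart.

Lemma Ord_ordinary_point (K : closedFieldType) (F : {mpoly K[3]}) (P : 'rV[K]_3) d m :
  F \is d.-homog -> Ord F (P 0) m -> ordinary_point F P m.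
Proof.
move=> hF oF k Pk; have h : Ord F (fun i => P 0 i / P 0 k) m.
  by apply: Ord_eq (Ord_scale (invr_neq0 Pk) hF oF) => i; rewrite mulrC.
exact: chart_branches Pk hF h.
Qed.

(** * The dual Hesse configuration *)

Section Points.
Variable K : fieldType.
Implicit Types (P : 'rV[K]_3) (v : 'I_3 -> K).

Lemma row3E (a b c : K) : row3 a b c 0 =1 vec3 a b c.
Proof. by move=> i; rewrite mxE; case: (ord3P i) => ->. Qed.

Lemma same_point_row3 P (a b c k : K) : k != 0 -> P 0 i0 = k * a -> P 0 i1 = k * b ->
  P 0 i2 = k * c -> same_point P (row3 a b c).
Proof.
move=> k0 e0 e1 e2; exists k => //; apply/rowP => i; rewrite mxE row3E.
by case: (ord3P i) => ->.
Qed.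

Lemma nz_point P : P != 0 -> nz (P 0).
Proof.
move=> P0; apply/existsP; apply: contraNT P0; rewrite negb_exists => /forallP h.
by apply/eqP/rowP => i; rewrite mxE; apply/eqP; have := h i; rewrite negbK.
Qed.

Lemma vertex_point P : P != 0 -> vertex (P 0) ->
  exists2 Q, Q \in [:: row3 0 0 1; row3 0 1 0; row3 1 0 0] & same_point P Q.
Proof.
move=> /nz_point[i Pi] [h0 h1 h2].
have z (x y : K) : x != 0 -> x * y = 0 -> y = 0.
  by move=> x0 /eqP; rewrite mulf_eq0 (negPf x0) => /eqP.
move: Pi; case: (ord3P i) => -> Pi.
- exists (row3 1 0 0); first by rewrite !inE eqxx !orbT.
  by apply: (same_point_row3 Pi); rewrite ?mulr1 ?mulr0 //; apply: (z _ _ Pi).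
- exists (row3 0 1 0); first by rewrite !inE eqxx !orbT.
  by apply: (same_point_row3 Pi); rewrite ?mulr1 ?mulr0 //; apply: (z _ _ Pi); rewrite // mulrC.
- exists (row3 0 0 1); first by rewrite !inE eqxx.
  by apply: (same_point_row3 Pi); rewrite ?mulr1 ?mulr0 //; apply: (z _ _ Pi); rewrite mulrC.
Qed.

Variable w : K.
Hypothesis w2 : w ^+ 2 = - w - 1.

Lemma triangle_coord z P : P != 0 -> z ^+ 3 = 1 -> triangle z (P 0) ->
  exists2 k, k != 0 & exists2 e, e \in [:: 1; w; w ^+ 2] &
    [/\ P 0 i0 = k, P 0 i1 = k * e & P 0 i2 = k * (z * e ^+ 2)].
Proof.
move=> /nz_point nzP z3 tr; have z0 : z != 0.
  by apply: contra_eq_neq z3 => ->; rewrite expr0n eq_sym oner_neq0.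
have [x0 y0 _] := triangle_neq0 nzP z0 tr; case: tr => h0 h1 h2.
exists (P 0 i0) => //; exists (P 0 i1 / P 0 i0).
  have e3 : (P 0 i1 / P 0 i0) ^+ 3 = 1.
    rewrite expr_div_n; apply: canLR (mulfK (expf_neq0 3 x0)) _; rewrite mul1r.
    by apply: (mulfI z0); rewrite !(exprS _ 2) [LHS]mulrCA [RHS]mulrCA -h1 -h0; ring.
  move: e3; set e := _ / _ => e3; rewrite !inE.
  have : (e - 1) * ((e - w) * (e - w ^+ 2)) = e ^+ 3 - 1 by ring: w2.
  rewrite e3 subrr.
  by move/eqP; rewrite !mulf_eq0 !subr_eq0.
split=> //; first by rewrite mulrC divfK.
have -> : P 0 i2 = z * P 0 i0 ^+ 2 / P 0 i1 by rewrite -h0 mulrC mulKf.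
have e1 : P 0 i1 ^+ 3 = P 0 i0 ^+ 3.
  by apply: (mulfI z0); rewrite !(exprS _ 2) [LHS]mulrCA [RHS]mulrCA -h1 -h0; ring.
apply: (mulfI (mulf_neq0 (expf_neq0 2 x0) y0)).
have -> : P 0 i0 ^+ 2 * P 0 i1 * (z * P 0 i0 ^+ 2 / P 0 i1) = z * P 0 i0 * P 0 i0 ^+ 3.
  by field.
by rewrite -e1; field.
Qed.

Lemma triangle1_point P : P != 0 -> triangle 1 (P 0) ->
  exists2 Q, Q \in [:: row3 1 1 1; row3 1 w (w ^+ 2); row3 1 (w ^+ 2) w] & same_point P Q.
Proof.
move=> P0 tr; have [k k0 [e]] := triangle_coord P0 (expr1n _ 3) tr.
rewrite !inE => /or3P[] /eqP-> [e0 e1 e2].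
- exists (row3 1 1 1); first by rewrite !inE eqxx.
  by apply: (same_point_row3 k0); rewrite ?e0 ?e1 ?e2; ring.
- exists (row3 1 w (w ^+ 2)); first by rewrite !inE eqxx orbT.
  by apply: (same_point_row3 k0); rewrite ?e0 ?e1 ?e2; ring.
- exists (row3 1 (w ^+ 2) w); first by rewrite !inE eqxx !orbT.
  by apply: (same_point_row3 k0); rewrite ?e0 ?e1 ?e2; ring: w2.
Qed.

Lemma triangle_w_point P : P != 0 -> triangle w (P 0) ->
  exists2 Q, Q \in [:: row3 1 w 1; row3 1 1 w; row3 w 1 1] & same_point P Q.
Proof.
move=> P0 tr; have [k k0 [e]] := triangle_coord P0 (w3 w2) tr.
rewrite !inE => /or3P[] /eqP-> [e0 e1 e2].
- exists (row3 1 1 w); first by rewrite !inE eqxx orbT.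
  by apply: (same_point_row3 k0); rewrite ?e0 ?e1 ?e2; ring.
- exists (row3 1 w 1); first by rewrite !inE eqxx.
  by apply: (same_point_row3 k0); rewrite ?e0 ?e1 ?e2; ring: w2.
- exists (row3 w 1 1); first by rewrite !inE eqxx !orbT.
  (* Here (1 : w^2 : w^2) is rewritten as w^2 (w : 1 : 1). *)
  have kw : k * w ^+ 2 != 0 by rewrite mulf_neq0 ?expf_neq0 ?(w_neq0 w2).
  by apply: (same_point_row3 kw); rewrite ?e0 ?e1 ?e2; ring: w2.
Qed.

Lemma triangle_w2_point P : P != 0 -> triangle (w ^+ 2) (P 0) ->
  exists2 Q, Q \in [:: row3 1 1 (w ^+ 2); row3 (w ^+ 2) 1 1; row3 1 (w ^+ 2) 1] & same_point P Q.
Proof.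
move=> P0 tr; have [|k k0 [e]] := triangle_coord P0 _ tr; first by ring: w2.
rewrite !inE => /or3P[] /eqP-> [e0 e1 e2].
- exists (row3 1 1 (w ^+ 2)); first by rewrite !inE eqxx.
  by apply: (same_point_row3 k0); rewrite ?e0 ?e1 ?e2; ring.
- exists (row3 (w ^+ 2) 1 1); first by rewrite !inE eqxx orbT.
  have kw : k * w != 0 by rewrite mulf_neq0 ?(w_neq0 w2).
  by apply: (same_point_row3 kw); rewrite ?e0 ?e1 ?e2; ring: w2.
- exists (row3 1 (w ^+ 2) 1); first by rewrite !inE eqxx !orbT.
  by apply: (same_point_row3 k0); rewrite ?e0 ?e1 ?e2; ring: w2.
Qed.

Lemma nz_row3 (a b c : K) : [|| a != 0, b != 0 | c != 0] -> nz (row3 a b c 0).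
Proof.
by case/or3P=> h; [exists i0|exists i1|exists i2]; rewrite row3E.
Qed.

Lemma triangle_row3 z (a b c : K) : b * c = z * a ^+ 2 -> a * c = z * b ^+ 2 ->
  a * b = z * c ^+ 2 -> triangle z (row3 a b c 0).
Proof. by rewrite /triangle !row3E. Qed.

Lemma vertex_row3 (a b c : K) : b * c = 0 -> a * c = 0 -> a * b = 0 ->
  vertex (row3 a b c 0).
Proof. by rewrite /vertex !row3E. Qed.

End Points.

(** * The complex numbers and the conclusion *)

(** With t = 2 pi / 3 and sin t > 0, the relation sin 3t = 0 gives 4 cos^2 t = 1, and then cos 3t =
    1 gives cos t = -1/2. *)
Lemma omega2 (R : realType) : omega R ^+ 2 = - omega R - 1.
Proof.
rewrite /omega; set t := 2 * trigo.pi / 3.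
have t3 : t + t + t = trigo.pi *+ 2 by rewrite /t mulr2n; field.
have := trigo.cos2pi R; have := trigo.sin2pi R; have := trigo.cos2Dsin2 t.
have s0 : trigo.sin t > 0.
  have := trigo.pi_gt0 R => pi0; apply: trigo.sin_gt0_pi; rewrite /t; apply/andP; split.
    by rewrite divr_gt0 ?mulr_gt0.
  by rewrite ltr_pdivrMr // mulrC ltr_pM2l // ltr_nat.
rewrite -t3 !(trigo.sinD, trigo.cosD); move: s0; set c := trigo.cos t; set s := trigo.sin t.
move=> s0 cs es ec; have s2 : s ^+ 2 = 1 - c ^+ 2 by rewrite -cs; ring.
have e1 : 4 * c ^+ 2 = 1.
  have : s * (4 * c ^+ 2 - 1) = 0 by rewrite -es; ring: s2.
  by move/eqP; rewrite mulf_eq0 (negPf (lt0r_neq0 s0)) subr_eq0 => /eqP.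
have c1 : c = - 2^-1.
  have : c * (4 * c ^+ 2) - 3 * c = 1 by rewrite -[RHS]ec; ring: s2.
  rewrite e1 => h; lra.
apply/eqP; rewrite eq_complex; apply/andP; split; apply/eqP; rewrite /=.
  rewrite -[s * s]/(s ^+ 2) s2 c1; lra.
rewrite c1; lra.
Qed.

Lemma form4_F4 (K : fieldType) (s t alpha : K) i : s = t * alpha ->
  form4 s t i = t%:MP * F4 alpha i.
Proof.
move=> ->; have e0 : 0%R = i0 :> 'I_3 by apply: val_inj.
have e1 : 1%R = i1 :> 'I_3 by apply: val_inj.
have e2 : 2%R = i2 :> 'I_3 by apply: val_inj.
rewrite /F4 e2 e1 e0 /form4 mpolyCM (tnth_nth 0) -!mul_mpolyC.
by case: (ord3P i) => ->; rewrite vec3E /=; ring.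
Qed.

Lemma invariant_form4 (K : fieldType) (s t alpha : K) F : s = t * alpha ->
  invariant_curve (F4 alpha) F -> invariant_curve (form4 s t) F.
Proof.
move=> e invF i j; have [G eG] := invF i j; exists (t%:MP * G).
by rewrite !(form4_F4 _ e) -mulrA -eG; ring.
Qed.

Theorem theorem1p3 (R : realType) (alpha : R[i]) (p q : eisenstein)
    (alpha_Qomega : exists a b : rat, alpha = ratr a + ratr b * omega R)
    (alpha_neq : alpha \notin [:: 1; omega R; omega R ^+ 2])
    (q_neq0 : q != 0) (coprime_pq : eis_coprime p q)
    (slope_pq : slope alpha = eis_val R p / eis_val R q) :
  for_generic_curve (F4 alpha) (fun F =>
    (forall P, singular_point F P ->
       exists2 Q, Q \in points_dual_Hesse R & same_point P Q) /\
    [/\ {in points_infty R, forall Q, ordinary_point F Q (eis_norm q)},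
        {in points_1 R, forall Q, ordinary_point F Q (eis_norm p)},
        {in points_omega R, forall Q,
          ordinary_point F Q (eis_norm (p + eis_omega ^+ 2 * q))}
      & {in points_omega2 R, forall Q,
          ordinary_point F Q (eis_norm (p - eis_omega * q))}]).
Proof.
have w2 := omega2 R; set w := omega R in w2.
have char0 n : n.+1%:R != 0 :> R[i] by rewrite pnatr_eq0.
have q0 : eis_val R q != 0.
  apply: (@eval_neq0 _ w w2 char0 q); apply: contra q_neq0 => /eqP/eis_norm_eq0 ->.
  exact: eqxx.
(* The slope relation is 3 p = theta (1 - alpha) q; multiplication by theta, with theta^2 = -3,
   turns it into q + theta p = q alpha. *)
have es : eval w (q + theta * p) = eval w q * alpha.
  rewrite (evalD w) (evalM w2) (eval_theta w).
  have : 3 * slope alpha * eis_val R q = 3 * eis_val R p by rewrite slope_pq -mulrA divfK.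
  rewrite /slope -/w -[eval w q]/(eis_val R q) -[eval w p]/(eis_val R p) !mulrA mulfV ?(char0 2)
    // mul1r.
  move=> e; apply: (mulfI (char0 2)).
  set P := eis_val R p in e *; set Q := eis_val R q in e *.
  transitivity (3 * Q + (1 + 2 * w) * (3 * P)); first by ring.
  by rewrite -e; ring: w2.
have [S hS] := Good_coprime w2 char0 coprime_pq.
exists S => F irrF invF nF.
have [hF loc] := hS F irrF (invariant_form4 es invF) (fun G k GS => nF G k GS).
split.
  move=> P [P0 FP dP]; have [v tr1 trw trw2 sm] := loc (P 0) (nz_point P0).
  have [sp|/sm] := boolp.pselect (special w (P 0)); last first.
    by case/(_ FP) => i /eqP[]; apply: dP.
  rewrite /points_dual_Hesse.
  case: sp => [/(vertex_point P0)|[/(triangle1_point w2 P0)|/(triangle_w_point w2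
    P0)|/(triangle_w2_point w2 P0)]];
    case=> Q hQ PQ; exists Q => //; rewrite !mem_cat; apply/or4P.
  - exact: Or44.
  - exact: Or41.
  - exact: Or42.
  - exact: Or43.
have ord a b c m : [|| a != 0, b != 0 | c != 0] ->
    (type_at w (eis_norm q) (eis_norm p) (eis_norm (p + eis_omega ^+ 2 * q))
       (eis_norm (p - eis_omega * q)) F (row3 a b c 0) -> Ord F (row3 a b c 0) m) ->
    ordinary_point F (row3 a b c) m.
  by move=> nzv h; apply: (Ord_ordinary_point hF); apply/h/loc/nz_row3.
have w0 := w_neq0 w2; have n1 : 1 != 0 :> R[i] := oner_neq0 _.
split=> Q; rewrite !inE => /or3P[] /eqP->; apply: ord; rewrite ?n1 ?orbT //;
  case=> v t1 tw tw2 _.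
- by apply: v; apply: vertex_row3; ring.
- by apply: v; apply: vertex_row3; ring.
- by apply: v; apply: vertex_row3; ring.
- by apply: t1; apply: triangle_row3; rewrite -/w; ring: w2.
- by apply: t1; apply: triangle_row3; rewrite -/w; ring: w2.
- by apply: t1; apply: triangle_row3; rewrite -/w; ring: w2.
- by apply: tw; apply: triangle_row3; rewrite -/w; ring: w2.
- by apply: tw; apply: triangle_row3; rewrite -/w; ring: w2.
- by apply: tw; apply: triangle_row3; rewrite -/w; ring: w2.
- by apply: tw2; apply: triangle_row3; rewrite -/w; ring: w2.
- by apply: tw2; apply: triangle_row3; rewrite -/w; ring: w2.
- by apply: tw2; apply: triangle_row3; rewrite -/w; ring: w2.
Qed.
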